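(* Let $T>0$, $\xi\in\mathbb{R}^d$, and let $b\colon\mathbb{R}^d\to\mathbb{R}^d$ be Lipschitz continuous with Lipschitz constant $L>0$. Let $X\colon[0,T]\to\mathbb{R}^d$ be a continuous Gaussian process starting at $0$ with Cameron–Martin space $\mathcal{H}$, and assume that there is a continuous embedding $$\iota\colon\mathcal{H}\hookrightarrow C^{q\text{-var}}([0,T];\mathbb{R}^d)$$ for some $q\in[1,\infty)$. Let $Y$ be the (pathwise) solution to $$Y_t=\xi+\int_0^t b(Y_s)\,ds+X_t,\qquad t\in[0,T],$$ and let $\mu$ be the law of $Y$ on $C_\xi$. Then for every Borel probability measure $\nu$ on $C_\xi$, $$\inf_{\pi\in\Pi(\nu,\mu)}\int_{C_\xi\times C_\xi} d_{q\text{-var}}(x,y)^2\,d\pi(x,y)\;\le\; 2^{3-\frac{2}{q}}\exp\left(2^{2-\frac1q}LT\right)\|\iota\|^2_{\mathcal{H}\hookrightarrow C^{q\text{-var}}}\,H(\nu\,|\,\mu).$$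
   Context: $C_\xi=C_\xi([0,T];\mathbb{R}^d)$ is the space of continuous paths $x\colon[0,T]\to\mathbb{R}^d$ with $x_0=\xi$, with the uniform topology. For a path $x$, $\|x\|_{q\text{-var}}=\sup_{D}\left(\sum_{t_i\in D}|x_{t_{i+1}}-x_{t_i}|^q\right)^{1/q}$, the supremum being over finite partitions $D$ of $[0,T]$; $d_{q\text{-var}}(x,y)=\|x-y\|_{q\text{-var}}\in[0,\infty]$; $C^{q\text{-var}}([0,T];\mathbb{R}^d)$ is the set of continuous paths with $\|x\|_{q\text{-var}}<\infty$. The Cameron–Martin space $\mathcal{H}$ of $X$ is that of the law $\gamma$ of $X$ on $C_0([0,T];\mathbb{R}^d)$; its elements are continuous paths starting at $0$, and $\iota$ is the inclusion, with $\|\iota\|_{\mathcal{H}\hookrightarrow C^{q\text{-var}}}=\sup\{\|h\|_{q\text{-var}}:|h|_{\mathcal{H}}\le 1\}$. $\Pi(\nu,\mu)$ is the set of probability measures on the product space with marginals $\nu$ and $\mu$. The relative entropy is $H(\nu\,|\,\mu)=\int\log\left(\frac{d\nu}{d\mu}\right)d\nu$ if $\nu\ll\mu$ and $+\infty$ otherwise. *)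

(* Defs.v *)
From HB Require Import structures.
From mathcomp Require Import all_boot all_order all_algebra.
From mathcomp Require Import all_classical all_reals all_analysis.

Set Implicit Arguments.
Unset Strict Implicit.
Unset Printing Implicit Defensive.

Import Order.TTheory GRing.Theory Num.Theory.
Import numFieldNormedType.Exports.

Local Open Scope classical_set_scope.
Local Open Scope ring_scope.

(* The library norm on 'rV[R]_d is the max norm; |.| on R^d is Euclidean. *)
Definition enorm (R : realType) (d : nat) (x : 'rV[R]_d) : R :=
  Num.sqrt (\sum_(i < d) x 0 i ^+ 2).

(* C_xi([0,T]; R^d).  A path is stored as a total function that is frozen at xi
   outside [0,T], so that two paths are equal iff they agree on [0,T]. *)
Record cpath (R : realType) (d : nat) (T : R) (xi : 'rV[R]_d) := Cpath {
  cpath_fun :> R -> 'rV[R]_d;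
  cpath_continuous : {within `[0, T], continuous cpath_fun};
  cpath_start : cpath_fun 0 = xi;
  cpath_outside : forall t, t \notin `[0, T] -> cpath_fun t = xi
}.
Arguments cpath {R d} T xi.

Section path_space.
Context (R : realType) (d : nat) (T : R) (xi : 'rV[R]_d).

HB.instance Definition _ := gen_eqMixin (cpath T xi).
HB.instance Definition _ := gen_choiceMixin (cpath T xi).

Lemma cst_cpath_continuous :
  {within `[0, T], continuous (cst xi : R -> 'rV[R]_d)}.
Proof. by move=> x; exact: cst_continuous. Qed.

HB.instance Definition _ := isPointed.Build (cpath T xi)
  (Cpath cst_cpath_continuous erefl (fun _ _ => erefl)).

Definition to_uniform (x : cpath T xi) : {uniform` `[0, T] -> 'rV[R]_d} := x.

HB.instance Definition _ :=
  Uniform.copy (cpath T xi) (initial_topology to_uniform).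

HB.instance Definition _ :=
  Measurable.copy (cpath T xi) (g_sigma_algebraType (@open (cpath T xi))).

End path_space.

Section variation.
Context (R : realType) (d : nat) (T : R).

(* [itv_partition 0 T s] says that 0 :: s lists the points of a finite
   partition of [0,T] in increasing order. *)
Definition qvar (q : R) (x : R -> 'rV[R]_d) : \bar R :=
  ereal_sup [set ((\sum_(0 <= i < size s)
      enorm (x (nth T (0 :: s) i.+1) - x (nth T (0 :: s) i)) `^ q) `^ q^-1)%:E
    | s in itv_partition 0 T].

Definition dqvar (q : R) (x y : R -> 'rV[R]_d) : \bar R :=
  qvar q (fun t => x t - y t).

End variation.

Section laws.
Context {R : realType}.

(* No measurability of Z is assumed: mu is the law of Z as soon as it agrees
   with the image of P on the measurable sets. *)
Definition is_law {d d' : measure_display} {Omega : measurableType d}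
    {E : measurableType d'} (P : probability Omega R) (Z : Omega -> E)
    (mu : probability E R) : Prop :=
  forall A, measurable A -> mu A = P (Z @^-1` A).

(* [normal_prob m 0] is not the Dirac mass at m, so the degenerate case is
   treated apart. *)
Definition gaussian_law (m s : R) (A : set R) : \bar R :=
  if s == 0 then \d_m A else normal_prob m s A.

Definition gaussian_variable {d : measure_display} {Omega : measurableType d}
    (P : probability Omega R) (Z : Omega -> R) : Prop :=
  measurable_fun setT Z /\
  exists m s : R, forall A : set R, measurable A ->
    P (Z @^-1` A) = gaussian_law m s A.

(* Finite-dimensional marginals are jointly (possibly degenerate, not
   necessarily centred) Gaussian. *)
Definition gaussian_process {d : measure_display} {Omega : measurableType d}
    (P : probability Omega R) {n : nat} (T : R)
    (X : Omega -> R -> 'rV[R]_n) : Prop :=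
  forall (k : nat) (t : 'I_k -> R) (a : 'I_k -> 'rV[R]_n),
    (forall j, t j \in `[0, T]) ->
    gaussian_variable P
      (fun w => \sum_(j < k) \sum_(i < n) a j 0 i * X w (t j) 0 i).

Definition coupling {d d' : measure_display} {E : measurableType d}
    {F : measurableType d'} (nu : probability E R) (mu : probability F R)
    : set (probability (E * F)%type R) :=
  [set pi | is_law pi fst nu /\ is_law pi snd mu].

Definition relative_entropy {d : measure_display} {E : measurableType d}
    (nu mu : probability E R) : \bar R :=
  if pselect (nu `<< mu) then
    (\int[nu]_x lne (Radon_Nikodym (charge_of_finite_measure nu) mu x))%E
  else +oo%E.

End laws.

Section cameron_martin.
Context (R : realType) (d : nat) (T : R).
Local Notation C0 := (cpath T (0 : 'rV[R]_d)).

Definition dual (l : C0 -> R) : Prop :=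
  continuous (l : C0 -> R^o) /\
  forall (a : R) (x y z : C0), (forall t, z t = a *: x t + y t) ->
    l z = a * l x + l y.

(* The Cameron-Martin space of a Gaussian measure as in Bogachev, Gaussian
   Measures: |h|_H is the supremum of l(h) over the continuous linear
   functionals l of variance at most 1 under gamma, and H is the set where it
   is finite. *)
Definition cm_norm (gamma : probability C0 R) (h : C0) : \bar R :=
  ereal_sup [set (l h)%:E | l in [set l | dual l /\ ('V_gamma[l] <= 1)%E]].

Definition cm_space (gamma : probability C0 R) : set C0 :=
  [set h | (cm_norm gamma h < +oo)%E].

Definition cm_embeds (q : R) (gamma : probability C0 R) : Prop :=
  cm_space gamma `<=` [set h | (qvar T q h < +oo)%E] /\
  exists C : R, forall h, cm_space gamma h ->
    (qvar T q h <= C%:E * cm_norm gamma h)%E.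

Definition cm_embedding_norm (q : R) (gamma : probability C0 R) : \bar R :=
  ereal_sup [set qvar T q h | h in [set h | (cm_norm gamma h <= 1)%E]].

End cameron_martin.

Section transport.
Context (R : realType) (d : nat) (T : R) (xi : 'rV[R]_d).

Definition transport_cost (q : R) (nu mu : probability (cpath T xi) R) :
    \bar R :=
  ereal_inf [set (\int[pi]_z (dqvar T q z.1 z.2 ^+ 2))%E
    | pi in coupling nu mu].

End transport.

(* The product of a constant with a relative entropy, where c * +oo = +oo also
   for c = 0; the library has 0 * +oo = 0. *)
Definition mul_entropy (R : realType) (c h : \bar R) : \bar R :=
  if h == +oo%E then +oo%E else (c * h)%E.

(* Main.v *)
(* Evaluations of X at rational times, orthonormalised by Gram-Schmidt in
   L^2(gamma), give independent standard Gaussian (or null) coordinates xi_k that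
   determine the path.  Let Psi y = y - xi - int b(y) recover the driving noise of
   y, so that mu o Psi^-1 = gamma.  When nu << mu, the Knothe-Rosenblatt map turns
   the coordinates xi_k o Psi into variables G_k which have under nu the joint law
   that xi has under gamma, and the tensorised Talagrand inequality reads
   int sum_k u_k^2 dnu <= 2 H(nu | mu) with u_k = G_k - xi_k o Psi.  The u_k(y) are
   the coordinates of a path h(y) with |h(y)|_H <= |u(y)|_2, and Psi y + h(y) has
   law gamma under nu.  Solving the equation driven by Psi y + h(y) therefore
   couples nu with mu, and Gronwall's lemma, applied to increments, bounds the
   q-variation distance of the two solutions by
   2^(1-1/q) e^(LT) |h(y)|_(q-var) <= 2^(1-1/q) e^(LT) |iota| |u(y)|_2. *)
Require Import Defs.
From HB Require Import structures.
From mathcomp Require Import all_boot all_order all_algebra.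
From mathcomp Require Import all_classical all_reals all_analysis.
From mathcomp Require Import measurable_realfun ring lra.
Import Order.TTheory GRing.Theory Num.Theory.
Import numFieldNormedType.Exports.
Local Open Scope classical_set_scope.
Local Open Scope ring_scope.
Set Implicit Arguments.
Unset Strict Implicit.
Unset Printing Implicit Defensive.

(** * Densities and moments of Gaussian laws *)

(** Densities are only measurable, so the one-dimensional transport map need not be differentiable
    and no change of variables is at hand: the line is cut into short cells, Jensen's inequality
    bounds the entropy of each cell, and boundary terms telescope. Entropies may be infinite, so
    positive and negative parts of logarithms stay on opposite sides; the negative parts integrate
    to at most 1 because [- x ln x <= 1]. The Cameron-Martin norm tests a path against all
    continuous linear functionals, while only finite combinations of evaluations are known to be
    Gaussian: the others are reached by piecewise linear interpolation, and the variance is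
    controlled in the limit through characteristic functions, since pointwise convergence alone does
    not bound it. Laws are identified by cosines with a free phase instead of complex exponentials.
    In the constant, one factor 2 is Talagrand's and [2^(2-2/q)] is the square of the cost of
    splitting a q-variation in two; the estimate gives [exp(2LT)], which lies below the stated
    exponential because [2 - 1/q >= 1]. *)

Lemma is_derive_continuous (R : realType) (f : R -> R) (x df : R) :
  is_derive x (1:R) f df -> {for x, continuous f}.
Proof.
by move=> h; apply: differentiable_continuous; apply/derivable1_diffP.
Qed.

Lemma is_derive_ge0_le (R : realType) (f df : R -> R) (a b : R) :
  (forall x, x \in `[a, b] -> is_derive x (1:R) f (df x)) ->
  (forall x, x \in `[a, b] -> 0 <= df x) -> a <= b -> f a <= f b.
Proof.
move=> fd df0 ab.
apply: (@ger0_derive1_le_cc _ f a b) => //.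
- by move=> x xab; have [] := fd x (subset_itv_oo_cc xab).
- move=> x xab; have xab' := subset_itv_oo_cc xab.
  by rewrite derive1E (@derive_val _ _ _ _ _ _ _ (fd x xab')) df0.
- apply: continuous_in_subspaceT => x; rewrite inE => xab.
  exact: is_derive_continuous (fd x xab).
- by rewrite in_itv /= lexx.
- by rewrite in_itv /= lexx ab.
Qed.

Section integral_derivative.
Context {R : realType}.
Local Notation mu := (@lebesgue_measure R).

Lemma Rintegral_derive_itv (F f : R -> R) (a b : R) : a < b -> continuous f ->
  (forall x, is_derive x (1:R) F (f x)) ->
  \int[mu]_(x in `[a, b]) f x = F b - F a.
Proof.
move=> ab cf Ff; rewrite /Rintegral (@continuous_FTC2 _ f F) //.
- exact: continuous_subspaceT.
- split=> [x _||]; first by have [] := Ff x.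
    apply: cvg_at_right_filter; exact: is_derive_continuous (Ff a).
  apply: cvg_at_left_filter; exact: is_derive_continuous (Ff b).
- by move=> x _; rewrite derive1E (@derive_val _ _ _ _ _ _ _ (Ff x)).
Qed.

(** The bound on [|x| |F x|] kills both boundary terms of the integral over [[-n, n]] as [n] grows,
    and dominated convergence carries these integrals to the one over the line. *)
Lemma Rintegral_derive_eq0 (F f : R -> R) (C : R) : continuous f ->
  (forall x, is_derive x (1:R) F (f x)) -> mu.-integrable setT (EFin \o f) ->
  (forall x, `|x| * `|F x| <= C) -> \int[mu]_x f x = 0.
Proof.
move=> cf Ff fi FC.
pose D n : set R := `[- n%:R, n%:R]%classic.
have mf : measurable_fun setT f by exact: continuous_measurable_fun.
have h1 : (\int[mu]_(x in D n) (f x)%:E)%E @[n --> \oo] -->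
    (\int[mu]_x (f x)%:E)%E.
  under eq_fun do rewrite integral_mkcond.
  apply: (@dominated_cvg _ _ _ mu setT measurableT _ _ (abse \o (EFin \o f))).
  - move=> n; have mfD : measurable_fun (D n) (EFin \o f).
      by apply: measurable_funTS; exact/measurable_EFinP.
    exact: (measurable_restrictT (EFin \o f) (measurable_itv _)).1 mfD.
  - move=> x _; apply: cvg_near_cst; near=> n.
    rewrite patchE ifT // inE /D /= in_itv /= -ler_norml.
    by near: n; exact: nbhs_infty_ger.
  - by move=> x _.
  - exact: integrable_abse.
  - by move=> n x _; rewrite /= patchE; case: ifPn => // _; rewrite ?abse0 ?normr0 // abse_ge0.
have h2 : (\int[mu]_(x in D n) (f x)%:E)%E @[n --> \oo] --> 0%:E.
  rewrite -(cvg_shiftS (fun n => \int[mu]_(x in D n) (f x)%:E)%E) /=.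
  have E n : (\int[mu]_(x in D n.+1) (f x)%:E)%E = (F n.+1%:R - F (- n.+1%:R))%:E.
    rewrite -(@Rintegral_derive_itv F f) ?fineK //; last first.
      by rewrite (@lt_trans _ _ 0) // oppr_lt0.
    by apply: integrable_fin_num => //; exact: integrableS fi.
  under eq_fun do rewrite E.
  apply: cvg_EFin; first by near=> n.
  apply/cvgrPdist_le => e e0; near=> n.
  rewrite sub0r normrN /=.
  have C0 : 0 <= C by apply: le_trans (FC 0); rewrite mulr_ge0.
  have nC : 2 * C / e <= n.+1%:R.
    rewrite (@le_trans _ _ n%:R) ?ler_nat //; near: n; exact: nbhs_infty_ger.
  have n0 : 0 < n.+1%:R :> R by [].
  have H1 := FC n.+1%:R; have H2 := FC (- n.+1%:R).
  rewrite normrN in H2; rewrite ger0_norm // in H1 H2.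
  rewrite ler_pdivrMr // in nC.
  rewrite (le_trans (ler_normB _ _)) //.
  rewrite -(@ler_pM2l _ n.+1%:R) // mulrDr (le_trans (lerD H1 H2)) //.
  lra.
have := cvg_unique _ h1 h2.
by rewrite /Rintegral => ->.
Unshelve. all: by end_near. Qed.
End integral_derivative.

Section density.
Local Open Scope ereal_scope.
Context {d : measure_display} {T : measurableType d} {R : realType}.
Variables (mu nu : {measure set T -> \bar R}) (g : T -> R).
Hypotheses (mg : measurable_fun setT g) (g0 : forall x, (0 <= g x)%R).
Hypothesis nuE : forall A, measurable A -> nu A = \int[mu]_(x in A) (g x)%:E.
Import HBNNSimple.

(** Stated for an explicit real density, so that the normal density, the conditional densities and
    the density behind the relative entropy are treated alike. Approximation by simple functions
    reduces it to [nuE]. *)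
Lemma ge0_integral_density (f : T -> \bar R) (E : set T) :
  (forall x, 0 <= f x) -> measurable E -> measurable_fun E f ->
  \int[nu]_(x in E) f x = \int[mu]_(x in E) (f x * (g x)%:E).
Proof.
move=> f0 mE mf; symmetry.
pose h := nnsfun_approx mE mf.
have mgE : measurable_fun E (EFin \o g).
  by apply/measurable_EFinP; exact: measurable_funTS.
have -> : \int[nu]_(x in E) f x =
    lim (\int[nu]_(x in E) (EFin \o h n) x @[n --> \oo]).
  have fE x : E x -> f x = lim ((EFin \o h n) x @[n --> \oo]).
    by move=> Ex; apply/esym/cvg_lim => //; exact: cvg_nnsfun_approx.
  under eq_integral => x /[!inE] /fE -> //.
  apply: monotone_convergence => //.
  - move=> n; apply/measurable_EFinP.
    by apply: (measurable_funS measurableT) => //; exact/measurable_funP.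
  - by move=> n x Ex //=; rewrite lee_fin.
  - by move=> x Ex a b ab; rewrite lee_fin; exact/lefP/nd_nnsfun_approx.
have -> : \int[mu]_(x in E) (f x * (g x)%:E) =
    lim (\int[mu]_(x in E) ((EFin \o h n) x * (g x)%:E) @[n --> \oo]).
  have fg x : E x -> f x * (g x)%:E = lim (((EFin \o h n) x * (g x)%:E) @[n --> \oo]).
    by move=> Ex; apply/esym/cvg_lim => //; apply: cvgeZr => //; exact: cvg_nnsfun_approx.
  under eq_integral => x /[!inE] /fg -> //.
  apply: monotone_convergence => [//| | |].
  - move=> n; apply/emeasurable_funM => //; apply/measurable_funTS.
    exact/measurable_EFinP.
  - by move=> n x Ex /=; rewrite mule_ge0 ?lee_fin.
  - by move=> x Ex a b ab/=; rewrite lee_wpmul2r ?lee_fin//; exact/lefP/nd_nnsfun_approx.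
suff suf n : \int[mu]_(x in E) ((EFin \o h n) x * (g x)%:E) =
    \int[nu]_(x in E) (EFin \o h n) x.
  by under eq_fun do rewrite suf.
transitivity (\int[nu]_(x in E)
   (\sum_(y \in range (h n)) (y * \1_(h n @^-1` [set y]) x)%:E)); last first.
  by apply: eq_integral => t tE; rewrite /= fimfunE -fsumEFin.
have indich m r : measurable_fun E (fun x => (r * \1_(h m @^-1` [set r]) x)%:E).
  by apply: (measurable_comp measurableT) => //; exact: measurable_funM.
rewrite ge0_integral_fsum//; last by move=> m y Ey; exact: nnfun_muleindic_ge0.
transitivity (\int[mu]_(x in E) (\sum_(y \in range (h n))
    (y * \1_(h n @^-1` [set y]) x)%:E * (g x)%:E)).
  under [RHS]eq_integral => x xE.
    rewrite -ge0_mule_fsuml => [|y]; last exact: nnfun_muleindic_ge0.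
    rewrite fsumEFin // -(fimfunE _ x); over.
  by [].
rewrite ge0_integral_fsum//; last 2 first.
  - by move=> y; apply: emeasurable_funM.
  - by move=> m y Ey; apply: mule_ge0; [exact: nnfun_muleindic_ge0|rewrite lee_fin].
apply: eq_fsbigr => r rhn.
under [RHS]eq_integral do rewrite EFinM.
rewrite integralZl_indic_nnsfun => //.
under eq_integral do rewrite EFinM -muleA.
rewrite ge0_integralZl//.
- under eq_integral do rewrite muleC.
  rewrite (eq_integral ((EFin \o g) \_ (h n @^-1` [set r]))); last first.
    by move=> x xE; rewrite epatch_indic.
  rewrite -integral_mkcondr -nuE; last by apply: measurableI.
  by rewrite integral_indic// setIC.
- apply: emeasurable_funM => //; apply/measurable_EFinP; exact: measurable_funTS.
- by move=> t Et; rewrite mule_ge0 ?lee_fin.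
- by move: rhn; rewrite inE => -[t _ <-]; rewrite lee_fin.
Qed.

Lemma integral_density (f : T -> R) : measurable_fun setT f ->
  nu.-integrable setT (EFin \o f) <-> mu.-integrable setT (fun x => (f x * g x)%:E).
Proof.
move=> mf; have mfg : measurable_fun setT (fun x => (f x * g x)%:E).
  by apply/measurable_EFinP; exact: measurable_funM.
have E : \int[nu]_x `|(f x)%:E| = \int[mu]_x `|(f x * g x)%:E|.
  rewrite ge0_integral_density //; last first.
    by apply: measurableT_comp => //; exact/measurable_EFinP.
  by apply: eq_integral => x _; rewrite EFinM abseM (@gee0_abs _ (g x)%:E) // lee_fin.
split=> /integrableP[_ h]; apply/integrableP; split => //.
- by rewrite -E.
- exact/measurable_EFinP.
- by rewrite E.
Qed.

Lemma Rintegral_density (f : T -> R) : measurable_fun setT f ->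
  nu.-integrable setT (EFin \o f) ->
  (\int[nu]_x f x = \int[mu]_x (f x * g x))%R.
Proof.
move=> mf fi; rewrite /Rintegral; congr fine.
rewrite [LHS]integralE [RHS]integralE.
have mfE : measurable_fun setT (EFin \o f) by exact/measurable_EFinP.
rewrite !ge0_integral_density //; last first.
- exact: measurable_funepos.
- exact: measurable_funeneg.
congr (_ - _); apply: eq_integral => x _.
- rewrite !funeposE /= EFinM; have [h|h] := leP 0%R (f x).
    by rewrite !max_l ?lee_fin // mulr_ge0.
  by rewrite !max_r ?mul0e // lee_fin ?(ltW h) // mulr_le0_ge0 // ltW.
- rewrite !funenegE /=; have [h|h] := leP 0%R (f x).
    by rewrite !max_r ?mul0e // ?lee_fin ?oppr_le0 // mulr_ge0.
  by rewrite !max_l ?lee_fin ?oppr_ge0 ?mulr_le0_ge0 // ?ltW // -mulNr.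
Qed.

End density.

Section normal_moments.
Context {R : realType}.
Variables (m s : R).
Hypothesis s0 : s != 0.
Local Notation mu := (@lebesgue_measure R).
Local Notation p := (normal_pdf m s).

Lemma is_derive_normal_pdf (x : R) :
  is_derive x (1:R) p (- ((x - m) / s ^+ 2) * p x).
Proof.
rewrite normal_pdfE // /normal_fun; apply: is_derive_eq.
by rewrite /GRing.scale /=; field.
Qed.

Lemma normal_pdf_gt0 (x : R) : 0 < p x.
Proof. by rewrite normal_pdfE // mulr_gt0 ?expR_gt0 // normal_peak_gt0. Qed.

(** Half of the exponent absorbs the quadratic factor: with [v = (x - m)^2 / (4 s^2)] the kernel is
    [exp(-v) exp(-v)]; one factor beats [1 + 4 s^2 v] up to a constant, the other is at most
    [exp(-v/2)], the kernel of deviation [2 s]. Domination by another normal density then settles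
    integrability. *)
Lemma sqr_normal_pdf_le : exists2 C : R, 0 <= C &
  forall x, (1 + (x - m) ^+ 2) * p x <= C * normal_pdf m (2 * s) x.
Proof.
exists ((1 + 4 * s ^+ 2) * (normal_peak s / normal_peak (2 * s))).
  apply: mulr_ge0; first by rewrite addr_ge0 // mulr_ge0 ?sqr_ge0.
  by rewrite divr_ge0 // normal_peak_ge0.
have s20 : 2 * s != 0 by rewrite mulf_neq0.
have s2_gt0 : 0 < s ^+ 2 by rewrite exprn_even_gt0.
move=> x; rewrite !normal_pdfE // [leRHS]mulrA -[X in _ <= X * _]mulrA.
rewrite divfK ?gt_eqF ?normal_peak_gt0 // mulrCA [X in _ <= X * _]mulrC -[leRHS]mulrA.
rewrite ler_pM2l ?normal_peak_gt0 // /normal_fun.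
set u := (x - m) ^+ 2; have u0 : 0 <= u by exact: sqr_ge0.
have -> : expR (- u / (s ^+ 2 *+ 2)) =
    expR (- u / (4 * s ^+ 2)) * expR (- (u / (4 * s ^+ 2))).
  by rewrite -expRD; congr expR; field.
have -> : - (x - m) ^+ 2 / ((2 * s) ^+ 2 *+ 2) = - (u / (8 * s ^+ 2)).
  by rewrite -/u; field.
set v := u / (4 * s ^+ 2).
have v0 : 0 <= v by rewrite divr_ge0 // mulr_ge0 // ltW.
have -> : - u / (4 * s ^+ 2) = - v by rewrite mulNr.
have -> : u / (8 * s ^+ 2) = v / 2 by rewrite /v; field.
have uv : u = v * (4 * s ^+ 2) by rewrite divfK // mulf_neq0 // gt_eqF.
rewrite mulrA; apply: ler_pM.
- by rewrite mulr_ge0 ?expR_ge0 // addr_ge0.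
- exact: expR_ge0.
- rewrite expRN ler_pdivrMr ?expR_gt0 //.
  have h1 : 1 + v <= expR v by exact: expR_ge1Dx.
  rewrite uv (@le_trans _ _ ((1 + 4 * s ^+ 2) * (1 + v))) //; last first.
    by rewrite ler_pM2l // addr_gt0 // mulr_gt0.
  by set w := s ^+ 2 in s2_gt0 *; nra.
- by rewrite ler_expR; lra.
Qed.

Lemma integrable_mul_normal_pdf (f : R -> R) (C : R) : measurable_fun setT f ->
  (forall x, `|f x| <= C * (1 + (x - m) ^+ 2)) ->
  mu.-integrable setT (fun x => (f x * p x)%:E).
Proof.
move=> mf fC; have [D D0 pD] := sqr_normal_pdf_le.
have C0 : 0 <= C.
  have := fC m; rewrite subrr expr0n addr0 mulr1; exact: le_trans.
apply: (@le_integrable _ _ _ mu setT measurableT _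
  (fun x => ((C * D)%:E * (normal_pdf m (2 * s) x)%:E)%E)).
- by apply/measurable_EFinP; apply: measurable_funM => //; exact: measurable_normal_pdf.
- move=> x _; rewrite -EFinM !abse_EFin lee_fin normrM (ger0_norm (normal_pdf_ge0 _ _ _)).
  rewrite normrM (ger0_norm (normal_pdf_ge0 _ _ _)) (ger0_norm (mulr_ge0 C0 D0)).
  rewrite -mulrA (le_trans _ (ler_wpM2l C0 (pD x))) // mulrA ler_wpM2r //.
  exact: normal_pdf_ge0.
- by apply: integrableZl => //; exact: integrable_normal_pdf.
Qed.

(** Integration by parts against the normal density. [F = - s^2] yields the mean,
    [F = - s^2 (x - m)] the variance, and [F = s^2 sin] the differential equation behind the
    characteristic function. *)
Lemma Rintegral_normal_derive_eq0 (F f : R -> R) (C : R) : continuous f ->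
  (forall x, is_derive x (1:R) (fun x => F x * p x) (f x * p x)) ->
  (forall x, `|f x| <= C * (1 + (x - m) ^+ 2)) ->
  (forall x, `|F x| <= C * (1 + `|x - m|)) ->
  \int[mu]_x (f x * p x) = 0.
Proof.
move=> cf Fd fC FC.
have [D D0 pD] := sqr_normal_pdf_le.
have C0 : 0 <= C.
  have := fC m; rewrite subrr expr0n addr0 mulr1; exact: le_trans.
apply: (@Rintegral_derive_eq0 _ (fun x => F x * p x) _
  (2 * (1 + `|m|) * C * (D * normal_peak (2 * s)))).
- move=> x; apply: cvgM; first exact: cf.
  exact: (continuous_normal_pdf s0).
- by apply: integrable_mul_normal_pdf fC; exact: continuous_measurable_fun.
move=> x; rewrite normrM (ger0_norm (normal_pdf_ge0 _ _ _)).
have s20 : 2 * s != 0 by rewrite mulf_neq0.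
have H : (1 + (x - m) ^+ 2) * p x <= D * normal_peak (2 * s).
  by rewrite (le_trans (pD x)) // ler_wpM2l // normal_pdf_ub.
have p0 := normal_pdf_gt0 x.
set u := `|x - m|; have u0 : 0 <= u by exact: normr_ge0.
have xu : `|x| <= `|m| + u by rewrite -{1}(subrK m x) addrC (le_trans (ler_normD _ _)).
have uE : (x - m) ^+ 2 = u ^+ 2 by rewrite /u real_normK // num_real.
rewrite uE in H.
have m0 : 0 <= `|m| by exact: normr_ge0.
rewrite mulrA; apply: (@le_trans _ _ ((`|m| + u) * (C * (1 + u)) * p x)).
  by rewrite ler_wpM2r ?(ltW p0) // ler_pM.
apply: (@le_trans _ _ (2 * (1 + `|m|) * C * ((1 + u ^+ 2) * p x))); last first.
  by rewrite ler_wpM2l // !mulr_ge0 // addr_ge0.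
rewrite [leRHS]mulrA ler_wpM2r ?(ltW p0) //.
have h : (`|m| + u) * (1 + u) <= 2 * (1 + `|m|) * (1 + u ^+ 2).
  by have := sqr_ge0 (u - 1); have := mulr_ge0 m0 (sqr_ge0 (u - 1)); nra.
by have := ler_wpM2l C0 h; lra.
Qed.

Lemma normal_mean : \int[mu]_x ((x - m) * p x) = 0.
Proof.
apply: (@Rintegral_normal_derive_eq0 (fun=> - s ^+ 2) _ (1 + s ^+ 2)).
- by move=> x; apply: cvgB; [exact: cvg_id|exact: cvg_cst].
- move=> x; have h := is_derive_normal_pdf x; apply: is_derive_eq.
  by rewrite /GRing.scale /=; field.
- move=> x; have := sqr_ge0 s; have := sqr_ge0 (x - m); have := sqr_ge0 (`|x - m| - 1).
  by rewrite -(real_normK (num_real (x - m))); set u := `|_|; nra.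
- by move=> x; rewrite normrN ger0_norm ?sqr_ge0 //; have := normr_ge0 (x - m);
    have := sqr_ge0 s; nra.
Qed.

Lemma normal_variance : \int[mu]_x ((x - m) ^+ 2 * p x) = s ^+ 2.
Proof.
have h : \int[mu]_x (((x - m) ^+ 2 - s ^+ 2) * p x) = 0.
  apply: (@Rintegral_normal_derive_eq0 (fun x => - s ^+ 2 * (x - m)) _ (1 + s ^+ 2)).
  - by move=> x; exact: is_derive_continuous.
  - move=> x; have h := is_derive_normal_pdf x; apply: is_derive_eq.
    by rewrite /GRing.scale /=; field.
  - move=> x; rewrite (le_trans (ler_normB _ _)) // !ger0_norm ?sqr_ge0 //.
    by have := sqr_ge0 s; have := sqr_ge0 (x - m); nra.
  - move=> x; rewrite normrM normrN (ger0_norm (sqr_ge0 s)).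
    by have := normr_ge0 (x - m); have := sqr_ge0 s; nra.
move: h; under eq_Rintegral do rewrite mulrBl.
have mx : measurable_fun setT (fun x : R => (x - m) ^+ 2).
  by apply: measurable_funX; exact: measurable_funB.
rewrite RintegralB //.
- move/eqP; rewrite subr_eq0 => /eqP ->; rewrite RintegralZl //; last first.
    exact: integrable_normal_pdf.
  by rewrite /Rintegral integral_normal_pdf mulr1.
- apply: (@integrable_mul_normal_pdf _ 1) => // x.
  by rewrite ger0_norm ?sqr_ge0 // mul1r lerDr.
- apply: (@integrable_mul_normal_pdf _ (s ^+ 2)) => // x.
  by rewrite ger0_norm ?sqr_ge0 // ler_peMr ?sqr_ge0 // lerDl sqr_ge0.
Qed.

(** As a function of [t] the left side satisfies [psi' = - s^2 t psi], so [psi exp(s^2 t^2 / 2)] is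
    constant. The free phase [c] lets cosines carry the information of complex exponentials. *)
Lemma normal_cos (t c : R) :
  \int[mu]_x (cos (t * (x - m) + c) * p x) = expR (- (s ^+ 2 * t ^+ 2) / 2) * cos c.
Proof.
pose psi t := \int[mu]_x (cos (t * (x - m) + c) * p x).
pose g t := \int[mu]_x (- (x - m) * sin (t * (x - m) + c) * p x).
have mcos t' : measurable_fun setT (fun x : R => cos (t' * (x - m) + c)).
  by apply: continuous_measurable_fun => x; exact: is_derive_continuous.
have csin t' : continuous (fun x : R => - (x - m) * sin (t' * (x - m) + c)).
  by move=> x; exact: is_derive_continuous.
have icos t' : mu.-integrable setT (fun x => (cos (t' * (x - m) + c) * p x)%:E).
  apply: (@integrable_mul_normal_pdf _ 1) => // x.
  by rewrite mul1r (le_trans (cos_max _)) // lerDl sqr_ge0.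
have sin_le (t' x : R) : `|- (x - m) * sin (t' * (x - m) + c)| <= 1 + (x - m) ^+ 2.
  rewrite normrM normrN (@le_trans _ _ `|x - m|) ?ler_piMr ?sin_max //.
  rewrite -(real_normK (num_real (x - m))); set u := `|_|.
  by have := sqr_ge0 (u - 1); nra.
have is1 (t' x : R) : is_derive t' (1:R) (fun t' : R => cos (t' * (x - m) + c) * p x)
    (- (x - m) * sin (t' * (x - m) + c) * p x).
  by apply: is_derive_eq; rewrite /GRing.scale /=; ring.
have d1E t' x : partial1of2 (fun t' x : R => cos (t' * (x - m) + c) * p x) t' x =
    - (x - m) * sin (t' * (x - m) + c) * p x.
  by rewrite partial1of2E; exact: (@derive_val _ _ _ _ _ _ _ (is1 t' x)).
have psid (t' : R) : is_derive t' (1:R) psi (g t').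
  have tI : `]t' - 1, t' + 1[%classic t' by rewrite /= in_itv /=; lra.
  have d1 (t1 x : R) : `]t' - 1, t' + 1[%classic t1 -> setT x ->
    derivable (fun t' : R => cos (t' * (x - m) + c) * p x) t1 1 by move=> _ _.
  have d2 (x : R) : 0 <= (1 + (x - m) ^+ 2) * p x.
    by rewrite mulr_ge0 ?addr_ge0 ?sqr_ge0 ?normal_pdf_ge0.
  have d3 : mu.-integrable setT (EFin \o fun x => (1 + (x - m) ^+ 2) * p x).
    apply: (@integrable_mul_normal_pdf _ 1) => [|x].
      by apply: measurable_funD => //; apply: measurable_funX; exact: measurable_funB.
    by rewrite mul1r ger0_norm // addr_ge0 ?sqr_ge0.
  have d4 (t1 x : R) : `]t' - 1, t' + 1[%classic t1 -> setT x ->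
      `|partial1of2 (fun t' x : R => cos (t' * (x - m) + c) * p x) t1 x| <=
      (1 + (x - m) ^+ 2) * p x.
    move=> _ _; rewrite d1E normrM (ger0_norm (normal_pdf_ge0 _ _ _)).
    by rewrite ler_wpM2r ?normal_pdf_ge0.
  apply: DeriveDef.
    exact: (@derivable_under_integral _ _ _ mu _ setT measurableT _ _ _ tI
      (fun t1 _ => icos t1) d1 _ d2 d3 d4).
  rewrite -derive1E (@differentiation_under_integral _ _ _ mu _ setT measurableT
    _ _ _ tI (fun t1 _ => icos t1) d1 _ d2 d3 d4).
  by apply: eq_Rintegral => x _; rewrite d1E.
have gE t' : g t' = - (s ^+ 2 * t') * psi t'.
  have h : \int[mu]_x (((- (x - m)) * sin (t' * (x - m) + c) +
      s ^+ 2 * t' * cos (t' * (x - m) + c)) * p x) = 0.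
    apply: (@Rintegral_normal_derive_eq0
      (fun x => s ^+ 2 * sin (t' * (x - m) + c)) _ (1 + s ^+ 2 * (1 + `|t'|))).
    - by move=> x; exact: is_derive_continuous.
    - move=> x; have h := is_derive_normal_pdf x; apply: is_derive_eq.
      by rewrite /GRing.scale /=; field.
    - move=> x; rewrite (le_trans (ler_normD _ _)) //.
      have h1 := sin_le t' x; have h2 := cos_max (t' * (x - m) + c).
      rewrite [X in _ + X](_ : _ = s ^+ 2 * `|t'| * `|cos (t' * (x - m) + c)|); last first.
        by rewrite 2!normrM (ger0_norm (sqr_ge0 s)).
      have h3 : s ^+ 2 * `|t'| * `|cos (t' * (x - m) + c)| <= s ^+ 2 * `|t'|.
        by rewrite ler_piMr // mulr_ge0 ?sqr_ge0.
      have w0 := sqr_ge0 s; have y0 := sqr_ge0 (x - m).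
      have := mulr_ge0 w0 y0; have := mulr_ge0 (mulr_ge0 w0 (normr_ge0 t')) y0.
      by lra.
    - move=> x; rewrite normrM (ger0_norm (sqr_ge0 _)).
      have h1 : s ^+ 2 * `|sin (t' * (x - m) + c)| <= s ^+ 2.
        by rewrite ler_piMr ?sin_max ?sqr_ge0.
      rewrite (le_trans h1) //.
      have := sqr_ge0 s; have := normr_ge0 t'; have := normr_ge0 (x - m).
      have w0 := sqr_ge0 s; have y0 := normr_ge0 (x - m).
      have := mulr_ge0 w0 y0; have := mulr_ge0 (mulr_ge0 w0 (normr_ge0 t')) y0.
      have := mulr_ge0 w0 (normr_ge0 t').
      by lra.
  move: h; under eq_Rintegral do rewrite mulrDl.
  rewrite RintegralD //; last 2 first.
  - apply: (@integrable_mul_normal_pdf _ 1) => [|x]; last by rewrite mul1r.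
    exact: continuous_measurable_fun.
  - rewrite (_ : EFin \o _ = (fun x => (s ^+ 2 * t')%:E * (cos (t' * (x - m) + c) * p x)%:E)%E).
      exact: integrableZl.
    by apply/funext => x /=; rewrite -EFinM mulrA.
  move=> /eqP; rewrite addr_eq0 => /eqP h; rewrite /g h.
  under eq_Rintegral do rewrite -(mulrA (s ^+ 2 * t')).
  rewrite mulNr; congr (- _).
  by apply: (@RintegralZl _ _ _ mu setT (fun x => cos (t' * (x - m) + c) * p x)) => //; exact: icos.
have : psi t * expR (s ^+ 2 * t ^+ 2 / 2) = psi 0 * expR (s ^+ 2 * 0 ^+ 2 / 2).
  apply: (@is_derive_0_is_cst _ (fun t => psi t * expR (s ^+ 2 * t ^+ 2 / 2))) => t'.
  have h := psid t'; apply: is_derive_eq; rewrite gE /GRing.scale /=.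
  by field.
rewrite expr0n /= mulr0 mul0r expR0 mulr1 -/(psi t) => h.
have -> : psi t = psi 0 * expR (- (s ^+ 2 * t ^+ 2) / 2).
  by rewrite -h -mulrA -expRD mulNr addrN expR0 mulr1.
rewrite mulrC; congr (_ * _); rewrite /psi.
under eq_Rintegral do rewrite mul0r add0r.
rewrite RintegralZl //; last exact: integrable_normal_pdf.
by rewrite /Rintegral integral_normal_pdf mulr1.
Qed.

End normal_moments.

(** * Uniform continuity on compact sets, and monotonicity from short intervals *)

Section uniform_continuity.
Context {R : realType} {V : normedModType R}.

Lemma within_continuous_dist (f : R -> V) (K : set R) (x : R) (e : R) :
  {within K, continuous f} -> K x -> 0 < e ->
  exists2 dl, 0 < dl & forall y, K y -> `|x - y| < dl -> `|f x - f y| < e.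
Proof.
move=> cf Kx e0.
have := cf x => /cvgrPdist_lt/(_ e e0).
rewrite /nbhs /= -nbhs_subspace_in //.
move=> [dl /= dl0 h].
by exists dl => // y Ky xy; exact: h.
Qed.

Lemma compact_unif_continuous (f : R -> V) (K : set R) (e : R) : compact K ->
  {within K, continuous f} -> 0 < e ->
  exists2 dl, 0 < dl & forall x y, K x -> K y -> `|x - y| < dl -> `|f x - f y| < e.
Proof.
move=> /compact_near_coveringP cK cf e0.
pose P (n : nat) (x : R) := K x -> forall y, K y -> `|x - y| < n.+1%:R^-1 -> `|f x - f y| < e.
have /(cK _ _ P) : forall x, K x -> \forall x' \near x & i \near \oo, P i x'.
  move=> x Kx.
  have [dl dl0 h] := within_continuous_dist cf Kx (divr_gt0 e0 (@ltr0Sn R 1)).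
  have dl20 : 0 < dl / 2 by rewrite divr_gt0.
  near=> x' i => /= Kx' y Ky xy.
  have x'x : `|x - x'| < dl / 2 by near: x'; exact: cvgr_dist_lt.
  have i2 : i.+1%:R^-1 < dl / 2.
    near: i; exact: (near_infty_natSinv_lt (PosNum dl20)).
  have h1 : `|f x - f x'| < e / 2 by apply: h => //; lra.
  have h2 : `|f x - f y| < e / 2.
    apply: h => //; rewrite (le_lt_trans (ler_distD x' _ _)) //.
    by rewrite [ltRHS](splitr dl) ltrD // (lt_trans xy).
  rewrite (le_lt_trans (ler_distD (f x) _ _)) // (distrC (f x')); lra.
move=> [N _ /(_ N (leqnn N)) h].
exists N.+1%:R^-1 => // x y Kx Ky xy; exact: h xy.
Unshelve. all: by end_near. Qed.

End uniform_continuity.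

(** Chains estimates that hold only on intervals shorter than [eta]; steps of length [eta / 2]
    respect the strict bound. *)
Lemma locally_nondecreasing_le (R : realType) (C : R -> R) (a b eta : R) :
  0 < eta -> a <= b ->
  (forall x y, a <= x -> x <= y -> y <= b -> y - x < eta -> C x <= C y) ->
  C a <= C b.
Proof.
move=> eta0 ab h.
have [n hn] : exists n : nat, b - a < n%:R * (eta / 2).
  exists (Num.truncn ((b - a) / (eta / 2))).+1.
  by rewrite -ltr_pdivrMr ?divr_gt0 // truncnS_gt // divr_ge0 ?subr_ge0 // divr_ge0 // ltW.
elim: n a ab h hn => [|n IH] a ab h hn; first by rewrite mul0r in hn; lra.
have [/h h1|ba] := ltP (b - a) eta; first by apply: h1.
apply: (@le_trans _ _ (C (a + eta / 2))); first by apply: h; lra.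
apply: IH; first by lra.
- by move=> x y ax xy yb; apply: h => //; lra.
- by move: hn; rewrite -natr1 mulrDl mul1r; lra.
Qed.

(** * The Gaussian quantile transform *)

Section cdf_real.
Context {R : realType}.
Variable rho : probability (measurableTypeR R) R.

Definition cdfr (x : R) : R := fine (rho `]-oo, x]%classic).

Lemma cdfrE (x : R) : (cdfr x)%:E = rho `]-oo, x]%classic.
Proof. by rewrite /cdfr fineK // fin_num_measure. Qed.

Lemma cdfr_itv (x y : R) : x <= y -> rho `]x, y]%classic = (cdfr y - cdfr x)%:E.
Proof.
move=> xy; rewrite EFinB !cdfrE.
have -> : `]-oo, y]%classic = `]-oo, x]%classic `|` `]x, y]%classic.
  by rewrite -itv_bndbnd_setU // ?bnd_simp.
have -> : rho (`]-oo, x]%classic `|` `]x, y]%classic) =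
    ((cdfr x)%:E + rho `]x, y]%classic)%E.
  rewrite cdfrE measureU // -subset0 => z [/=]; rewrite !in_itv /= => h1 /andP[h2 _].
  by move: (le_lt_trans h1 h2); rewrite ltxx.
rewrite cdfrE -(cdfrE x); set c := rho _.
have /fineK <- : c \is a fin_num by rewrite fin_num_measure.
have {1}-> : fine c = cdfr x + fine c - cdfr x by lra.
by [].
Qed.

Lemma cdfr_oy (x : R) : rho `]x, +oo[%classic = (1 - cdfr x)%:E.
Proof.
rewrite EFinB cdfrE -probability_setC //; congr (rho _).
by rewrite setCitvl.
Qed.

Lemma cdfr_le (x y : R) : x <= y -> cdfr x <= cdfr y.
Proof. by move=> xy; rewrite -subr_ge0 -lee_fin -cdfr_itv. Qed.

Lemma cdfr_ge0 (x : R) : 0 <= cdfr x.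
Proof. by rewrite -lee_fin cdfrE. Qed.

Lemma cdfr_le1 (x : R) : cdfr x <= 1.
Proof. by rewrite -lee_fin cdfrE probability_le1. Qed.

Lemma cdfr_exists_lt (e : R) : 0 < e -> exists x, cdfr x < e.
Proof.
move=> e0.
have h : rho (`]-oo, (- n%:R)]%classic : set R) @[n --> \oo] -->
    rho (\bigcap_n (`]-oo, (- n%:R)]%classic : set R)).
  apply: (@nonincreasing_cvg_mu _ _ _ rho (fun n => `]-oo, (- n%:R)]%classic)) => //.
  - by rewrite (le_lt_trans (probability_le1 _ _)) ?ltry.
  - exact: bigcapT_measurable.
  - move=> m n mn; apply/subsetPset => x /=; rewrite !in_itv /= => /le_trans; apply.
    by rewrite lerN2 ler_nat.
have E : \bigcap_n (`]-oo, (- n%:R)]%classic : set R) = set0.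
  rewrite -subset0 => x /(_ (Num.truncn `|x|).+1 I) /=; rewrite in_itv /=.
  have := truncnS_gt `|x|; have := ler_norm (- x); rewrite normrN; lra.
rewrite E measure0 in h.
move/fine_cvgP: h => [_ /cvgrPdist_lt/(_ e e0)[N _ /(_ N (leqnn N))]].
rewrite /= sub0r normrN ger0_norm => [h|]; first by exists (- N%:R).
exact: cdfr_ge0.
Qed.

Lemma cdfr_exists_gt (e : R) : e < 1 -> exists x, e < cdfr x.
Proof.
move=> e0.
have h : rho (`]-oo, n%:R]%classic : set R) @[n --> \oo] -->
    rho (\bigcup_n (`]-oo, n%:R]%classic : set R)).
  apply: (@nondecreasing_cvg_mu _ _ _ rho (fun n => `]-oo, n%:R]%classic)) => //.
  - exact: bigcupT_measurable.
  - move=> m n mn; apply/subsetPset => x /=; rewrite !in_itv /= => /le_trans; apply.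
    by rewrite ler_nat.
have E : \bigcup_n (`]-oo, n%:R]%classic : set R) = setT.
  rewrite -subTset => x _; exists (Num.truncn `|x|).+1 => //=; rewrite in_itv /=.
  have := truncnS_gt `|x|; have := ler_norm x; lra.
have e1 : 0 < 1 - e by lra.
rewrite E probability_setT in h.
move/fine_cvgP: h => [_ /cvgrPdist_lt/(_ _ e1)[N _ /(_ N (leqnn N))]] /= h.
exists N%:R; move: h; rewrite -/(cdfr _) ger0_norm ?subr_ge0 ?cdfr_le1 //; lra.
Qed.

Hypothesis noatom : forall x, rho [set x] = 0%E.

(** The intervals of radius [1/(n+1)] around [x] decrease to a point of mass zero, and their mass
    bounds the oscillation of [cdfr] on them. *)
Lemma cdfr_continuous : continuous cdfr.
Proof.
move=> x; apply/cvgrPdist_lt => e e0.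
pose I (n : nat) := `[x - n.+1%:R^-1, x + n.+1%:R^-1]%classic : set R.
have h : rho (I n) @[n --> \oo] --> rho (\bigcap_n I n).
  apply: (@nonincreasing_cvg_mu _ _ _ rho I) => //.
  - by rewrite (le_lt_trans (probability_le1 rho (measurable_itv `[x - 1%:R^-1, x + 1%:R^-1]))) ?ltry.
  - by move=> i; exact: measurable_itv.
  - by apply: bigcapT_measurable => i; exact: measurable_itv.
  - move=> m n mn; apply/subsetPset => y; rewrite /I /= !in_itv /=.
    have : n.+1%:R^-1 <= m.+1%:R^-1 :> R by rewrite lef_pV2 ?posrE // ler_nat.
    by set a := n.+1%:R^-1; set b := m.+1%:R^-1 => ab /andP[? ?]; apply/andP; split; lra.
have E : \bigcap_n I n = [set x].
  apply/seteqP; split => [y h1|_ -> n _]; last first.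
    by rewrite /I /= in_itv /= gerBl lerDl invr_ge0 ler0n.
  apply/eqP; rewrite eq_sym -subr_eq0 -normr_le0; apply/ler_addgt0Pr => r r0.
  have [N _ /(_ N (leqnn N)) hN] := near_infty_natSinv_lt (PosNum r0).
  have := h1 N Logic.I; rewrite /I /= in_itv /= => /andP[h2 h3].
  rewrite add0r ler_norml; move: hN h2 h3 => /=; set a := _.+1%:R^-1 => hN h2 h3.
  by apply/andP; split; lra.
rewrite E noatom in h.
move/fine_cvgP: h => [_ /cvgrPdist_lt/(_ _ e0)[N _ /(_ N (leqnn N))]] /= hN.
rewrite sub0r normrN ger0_norm ?fine_ge0 // in hN.
have iN : 0 < N.+1%:R^-1 :> R by rewrite invr_gt0 ltr0n.
near=> y.
have xy : `|x - y| <= N.+1%:R^-1 by near: y; exact: cvgr_dist_le.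
suff : (`|cdfr x - cdfr y|%:E <= rho (I N))%E.
  move=> h; rewrite (le_lt_trans _ hN) // -lee_fin fineK // fin_num_measure //.
  exact: measurable_itv.
rewrite /I; case: (leP x y) => h.
  rewrite distrC ger0_norm ?subr_ge0 ?cdfr_le // -cdfr_itv //.
  apply: le_measure; rewrite ?inE //; try exact: measurable_itv.
  move=> z /=; rewrite !in_itv /= => /andP[h1 h2].
  rewrite distrC ger0_norm ?subr_ge0 // in xy; move: xy; set a := _^-1 => xy.
  by apply/andP; split; lra.
have h' := ltW h.
rewrite ger0_norm ?subr_ge0 ?cdfr_le // -cdfr_itv //.
apply: le_measure; rewrite ?inE //; try exact: measurable_itv.
move=> z /=; rewrite !in_itv /= => /andP[h1 h2].
rewrite ger0_norm ?subr_ge0 // in xy; move: xy; set a := _^-1 => xy.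
by apply/andP; split; lra.
Unshelve. all: by end_near. Qed.

Lemma cdfr_surj (p : R) : 0 < p -> p < 1 -> exists x, cdfr x = p.
Proof.
move=> p0 p1.
have [a ha] := cdfr_exists_lt p0; have [c hc] := cdfr_exists_gt p1.
have ac : a <= c.
  rewrite leNgt; apply/negP => /ltW /cdfr_le; lra.
have cF : {within `[a, c], continuous cdfr}.
  by apply: continuous_subspaceT; exact: cdfr_continuous.
have [|x _ hx] := IVT ac cF (v := p); last by exists x.
by rewrite ge_min le_max (ltW ha) (ltW hc) orbT.
Qed.

End cdf_real.

Section gauss_cdf.
Context {R : realType}.
Local Notation mu := (@lebesgue_measure R).
Definition gauss : probability (measurableTypeR R) R := normal_prob (0:R) 1.
Definition gpdf : R -> R := normal_pdf (0:R) 1.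
Definition Phi : R -> R := cdfr gauss.

Lemma gpdf_gt0 (x : R) : 0 < gpdf x.
Proof. exact: normal_pdf_gt0. Qed.

Lemma integrable_gpdf : mu.-integrable setT (EFin \o gpdf).
Proof. exact: integrable_normal_pdf. Qed.

#[global] Instance is_derive_gpdf (x : R) : is_derive x (1:R) gpdf (- x * gpdf x).
Proof.
have := is_derive_normal_pdf 0 (oner_neq0 R) x.
by rewrite subr0 expr1n divr1.
Qed.

#[global] Instance is_derive_Phi (x : R) : is_derive x (1:R) Phi (gpdf x).
Proof.
have hi : mu.-integrable [set` Interval (BInfty R true) (BRight (x + 1))] (EFin \o gpdf).
  by apply: (integrableS measurableT) => //; exact: integrable_gpdf.
have x1 : x < x + 1 by rewrite ltrDl.
have [|h1 h2] := continuous_FTC1 x1 hi _ (@continuous_normal_pdf R 0 1 (oner_neq0 R) x).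
  by rewrite /= ltNyr.
apply: DeriveDef; first exact: h1.
by rewrite -derive1E -h2.
Qed.

Lemma Phi_continuous : continuous Phi.
Proof. by move=> x; exact: is_derive_continuous. Qed.

Lemma Phi_lt (x y : R) : x < y -> Phi x < Phi y.
Proof.
move=> xy.
have [|c _ h] := @MVT _ Phi gpdf x y xy.
  by apply: continuous_subspaceT; exact: Phi_continuous.
by rewrite -subr_gt0 h mulr_gt0 ?gpdf_gt0 // subr_gt0.
Qed.

Lemma Phi_inj : injective Phi.
Proof.
move=> x y xy; case: (ltgtP x y) => // /Phi_lt; rewrite xy ltxx //.
Qed.

Lemma Phi_ltE (x y : R) : (Phi x < Phi y) = (x < y).
Proof.
apply/idP/idP; last exact: Phi_lt.
by rewrite !ltNge; apply: contraNN; exact: cdfr_le.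
Qed.

Lemma Phi_leE (x y : R) : (Phi x <= Phi y) = (x <= y).
Proof. by rewrite leNgt Phi_ltE -leNgt. Qed.

Lemma Phi_gt0 (x : R) : 0 < Phi x.
Proof. by apply: (le_lt_trans (cdfr_ge0 gauss (x - 1))); rewrite Phi_lt // gtrBl. Qed.

Lemma Phi_lt1 (x : R) : Phi x < 1.
Proof. by apply: (lt_le_trans _ (cdfr_le1 gauss (x + 1))); rewrite Phi_lt // ltrDl. Qed.

Lemma gauss_set1 (x : R) : gauss [set x] = 0%E.
Proof.
rewrite /gauss /= /normal_prob integral_set1 //.
Qed.

Lemma Phi_surj (p : R) : 0 < p -> p < 1 -> exists x, Phi x = p.
Proof. by apply: cdfr_surj => x; exact: gauss_set1. Qed.

(** [Phi (- y) + Phi y] has derivative zero, and the tails identify the constant as 1. *)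
Lemma PhiN (x : R) : Phi (- x) = 1 - Phi x.
Proof.
pose c := Phi (- 0) + Phi 0.
have E y : Phi (- y) + Phi y = c.
  apply: (@is_derive_0_is_cst _ (fun y => Phi (- y) + Phi y)) => z.
  have h : is_derive z (1:R) (Phi \o -%R) (gpdf (- z) * (- 1)).
    exact: is_derive1_comp.
  have -> : 0 = gpdf (- z) * (- 1) + gpdf z.
    by rewrite /gpdf !normal_pdfE ?oner_neq0 // /normal_fun !subr0 sqrrN; ring.
  exact: is_deriveD.
suff c1 : c = 1 by rewrite -c1 -(E x) addrK.
apply/eqP; rewrite -subr_eq0 -normr_le0; apply/ler_addgt0Pr => e e0.
have e1 : 1 - e / 2 < 1 by lra.
have e2 : 0 < e / 2 by lra.
have [a ha] := cdfr_exists_lt gauss e2; have [b hb] := cdfr_exists_gt gauss e1.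
set z := Num.max (- a) b.
have h1 : Phi (- z) < e / 2.
  by rewrite (le_lt_trans _ ha) // cdfr_le // lerNl le_max lexx.
have h2 : 1 - e / 2 < Phi z by rewrite (lt_le_trans hb) // cdfr_le // le_max lexx orbT.
rewrite add0r -(E z) ler_norml; have := Phi_gt0 (- z); have := Phi_lt1 z; lra.
Qed.

Lemma gpdfN (x : R) : gpdf (- x) = gpdf x.
Proof. by rewrite /gpdf !normal_pdfE ?oner_neq0 // /normal_fun !subr0 sqrrN. Qed.

(* Mills ratio: [Phi x - gpdf x / (- x)] decreases from its limit 0 at minus infinity *)
Lemma mills (x : R) : 0 <= x * Phi x + gpdf x.
Proof.
have [x0|x0] := leP 0 x.
  by rewrite addr_ge0 ?mulr_ge0 // ltW ?gpdf_gt0 ?Phi_gt0.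
rewrite leNgt; apply/negP => h.
pose w (x : R) := Phi x + gpdf x * x^-1.
have wx : 0 < w x.
  have : 0 < (x * Phi x + gpdf x) / x by rewrite nmulr_lgt0 // invr_lt0.
  by rewrite /w mulrDl mulrAC divff ?lt_eqF // mul1r.
have wle y : y <= x -> w x <= w y.
  move=> yx; rewrite -lerN2.
  apply: (@is_derive_ge0_le _ (fun z => - w z) (fun z => gpdf z / z ^+ 2)) => // z.
    rewrite in_itv /= => /andP[yz zx].
    have z0 : z != 0 by rewrite lt_eqF // (le_lt_trans zx).
    have hV : is_derive z (1:R) (fun z : R => z^-1) (- z ^- 2 *: 1).
      exact: is_deriveV.
    by apply: is_derive_eq; rewrite /GRing.scale /=; field.
  by move=> _; rewrite divr_ge0 ?sqr_ge0 // ltW ?gpdf_gt0.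
have [a ha] := cdfr_exists_lt gauss wx.
have := wle (Num.min a x); rewrite ge_min lexx orbT => /(_ isT).
apply/negP; rewrite -ltNge (le_lt_trans _ ha) //.
have y0 : Num.min a x < 0 by rewrite gt_min x0 orbT.
rewrite /w (@le_trans _ _ (Phi (Num.min a x))) //.
  by rewrite gerDl nmulr_lle0 ?invr_lt0 // ltW ?gpdf_gt0 // .
by apply: cdfr_le; rewrite ge_min lexx.
Qed.

(** [ln Phi] is concave, because its derivative [gpdf / Phi] decreases by [mills]; this is its
    tangent line at [s], multiplied by [Phi s]. It serves as the lower bound for the entropy of a
    left half-line. *)
Lemma Phi_tail (s p : R) : - ((p - s) * gpdf s) <= Phi s * ln (Phi s / Phi p).
Proof.
have hd z : is_derive z (1:R) (fun z => gpdf z / Phi z)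
    (- (z * Phi z + gpdf z) * gpdf z / Phi z ^+ 2).
  have P0 : Phi z != 0 by rewrite gt_eqF ?Phi_gt0.
  have hV : is_derive z (1:R) (fun z : R => (Phi z)^-1) (- (Phi z) ^- 2 *: gpdf z).
    exact: is_deriveV.
  by apply: is_derive_eq; rewrite /GRing.scale /=; field.
have hz y z : y <= z -> gpdf z / Phi z <= gpdf y / Phi y.
  move=> yz; rewrite -lerN2.
  apply: (@is_derive_ge0_le _ (fun z => - (gpdf z / Phi z))
    (fun z => (z * Phi z + gpdf z) * gpdf z / Phi z ^+ 2)) => // t _.
    have h := hd t; apply: is_derive_eq; ring.
  by rewrite !mulr_ge0 ?mills ?invr_ge0 ?sqr_ge0 // ltW ?gpdf_gt0.
pose k p := (p - s) * (gpdf s / Phi s) - ln (Phi p).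
have kd z : is_derive z (1:R) k (gpdf s / Phi s - gpdf z / Phi z).
  have hl : is_derive z (1:R) (@ln R \o Phi) ((Phi z)^-1 * gpdf z).
    by apply: is_derive1_comp; exact: is_derive1_ln (Phi_gt0 z).
  have -> : k = (fun p => (p - s) * (gpdf s / Phi s)) - (@ln R \o Phi) by [].
  by apply: is_derive_eq; rewrite /GRing.scale /=; ring.
have kle : k s <= k p.
  have [sp|/ltW ps] := leP s p.
    apply: (is_derive_ge0_le (fun z _ => kd z)) => // z.
    by rewrite in_itv /= => /andP[sz _]; rewrite subr_ge0 hz.
  rewrite -lerN2.
  apply: (@is_derive_ge0_le _ (fun z => - k z) (fun z => gpdf z / Phi z - gpdf s / Phi s)) => //.
    by move=> z _; have h := kd z; apply: is_derive_eq; rewrite opprB.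
  by move=> z; rewrite in_itv /= => /andP[_ sz]; rewrite subr_ge0 hz.
rewrite /k subrr mul0r sub0r in kle.
rewrite ln_div ?posrE ?Phi_gt0 //.
have : 0 <= Phi s * ((p - s) * (gpdf s / Phi s) - ln (Phi p) + ln (Phi s)).
  rewrite mulr_ge0 ?(ltW (Phi_gt0 _)) //; lra.
have -> : Phi s * ((p - s) * (gpdf s / Phi s) - ln (Phi p) + ln (Phi s)) =
   (p - s) * gpdf s + Phi s * (ln (Phi s) - ln (Phi p)).
  have P0 : Phi s != 0 by rewrite gt_eqF ?Phi_gt0.
  by field.
lra.
Qed.

Lemma Phi_tailN (s p : R) :
  (p - s) * gpdf s <= (1 - Phi s) * ln ((1 - Phi s) / (1 - Phi p)).
Proof. by have := Phi_tail (- s) (- p); rewrite !PhiN gpdfN; lra. Qed.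

End gauss_cdf.

Section gauss_quantile.
Context {R : realType}.
Local Notation Phi := (@Phi R).
Local Notation gpdf := (@gpdf R).

Definition PhiInv (p : R) : R := get [set x | Phi x = p].

Lemma PhiInvK (p : R) : 0 < p -> p < 1 -> Phi (PhiInv p) = p.
Proof.
by move=> p0 p1; have [x hx] := Phi_surj p0 p1; apply: (@getI _ [set x | Phi x = p] x).
Qed.

Lemma PhiK (x : R) : PhiInv (Phi x) = x.
Proof. by apply: Phi_inj; rewrite PhiInvK ?Phi_gt0 ?Phi_lt1. Qed.

Lemma is_derive_PhiInv (p : R) : 0 < p -> p < 1 ->
  is_derive p (1:R) PhiInv (gpdf (PhiInv p))^-1.
Proof.
move=> p0 p1; rewrite -{1}(PhiInvK p0 p1).
apply: (@is_derive_inverse _ Phi).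
- by near=> x; exact: PhiK.
- by near=> x; exact: Phi_continuous.
- by rewrite gt_eqF // gpdf_gt0.
Unshelve. all: by end_near. Qed.

Lemma PhiInv_le (p p' : R) : 0 < p -> p <= p' -> p' < 1 -> PhiInv p <= PhiInv p'.
Proof.
by move=> p0 pp' p1; rewrite -Phi_leE !PhiInvK // ?(lt_le_trans p0) ?(le_lt_trans pp').
Qed.

Lemma measurable_PhiInv : measurable_fun setT PhiInv.
Proof.
(* Outside []0, 1[] there is no preimage and [get] returns the default point, so [PhiInv] is
   constant there; inside it is continuous. *)
have -> : PhiInv = fun p => if (0 < p) && (p < 1) then PhiInv p else point.
  apply/funext => p; case: ifPn => // h; rewrite /PhiInv getPN // => x hx.
  by move: h; rewrite -hx Phi_gt0 Phi_lt1.
have E (b : bool) : (fun p : R => (0 < p) && (p < 1)) @^-1` [set b] =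
    if b then `]0, 1[%classic else ~` `]0, 1[%classic.
  by case: b; apply/seteqP; split => x; rewrite /= in_itv /=;
    [|move=> -> |move=> -> |move/negP/negbTE ->].
apply: measurable_fun_if => //.
- have -> : (fun p : R => (0 < p) && (p < 1)) = (fun p => p \in `]0, 1[).
    by apply/funext => p; rewrite in_itv.
  apply: (@measurable_fun_bool _ _ _ _ true); rewrite setTI.
  rewrite (_ : _ @^-1` _ = `]0, 1[%classic) //.
- rewrite setTI E; apply: open_continuous_measurable_fun => //.
  move=> p; rewrite inE /= in_itv /= => /andP[p0 p1].
  by apply: is_derive_continuous; exact: is_derive_PhiInv.
Qed.

(** The expression is the derivative of the function [D] of [transport_cell]. Divided by [r] it
    equals [ln (r/n) - d2/2 + (z - 1) - x (t - x)] with [z = n gpdf x / (r gpdf t)]; the bound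
    [ln z <= z - 1] leaves [((t - x)^2 - d2) / 2]. *)
Lemma transport_cell_derive_ge0 (r n x t d2 : R) : 0 < r -> 0 < n ->
  d2 <= (t - x) ^+ 2 ->
  0 <= r * (ln (r / n) - d2 / 2) +
    (((gpdf t)^-1 * n - (gpdf x)^-1 * r) * gpdf x +
     (t - x) * (- x * gpdf x * ((gpdf x)^-1 * r))).
Proof.
move=> r0 n0 hd; have gx0 := gpdf_gt0 x; have gt0 := gpdf_gt0 t.
set z := (n * gpdf x) / (r * gpdf t).
have z0 : 0 < z by rewrite divr_gt0 // mulr_gt0.
have lnz : ln z <= z - 1 by rewrite lerBrDl -[in leRHS](lnK z0) expR_ge1Dx.
have lnzE : ln z = - ln (r / n) + (t ^+ 2 - x ^+ 2) / 2.
  have lg w : ln (gpdf w) = ln (normal_peak (1:R)) - w ^+ 2 / 2.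
    rewrite /gpdf normal_pdfE ?oner_neq0 // lnM ?posrE ?expR_gt0 ?normal_peak_gt0 ?oner_neq0 //.
    by rewrite /normal_fun expRK subr0 expr1n; congr (_ + _); field.
  by rewrite /z !ln_div ?posrE ?mulr_gt0 // !lnM ?posrE // !lg; field.
rewrite [leRHS](_ : _ = r * (ln (r / n) - d2 / 2 + (z - 1) - x * (t - x))); last first.
  by rewrite /z; field; rewrite !gt_eqF.
rewrite mulr_ge0 ?(ltW r0) //.
rewrite lnzE in lnz; nra.
Qed.

(* Along the paths [x u = PhiInv (Phi s + u r)] and [t u = PhiInv (Phi y + u n)]
   the function [u r ln (r/n) - u r d2 / 2 + (t u - x u) gpdf (x u)] increases. *)
Lemma transport_cell (s s' y y' d2 : R) : s < s' -> y < y' ->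
  (forall x t, s <= x <= s' -> y <= t <= y' -> d2 <= (t - x) ^+ 2) ->
  d2 / 2 * (Phi s' - Phi s) - ((y' - s') * gpdf s' - (y - s) * gpdf s) <=
  (Phi s' - Phi s) * ln ((Phi s' - Phi s) / (Phi y' - Phi y)).
Proof.
move=> ss' yy' hd2.
set r := Phi s' - Phi s; set n := Phi y' - Phi y.
have r0 : 0 < r by rewrite subr_gt0 Phi_lt.
have n0 : 0 < n by rewrite subr_gt0 Phi_lt.
pose x u := PhiInv (Phi s + u * r); pose t u := PhiInv (Phi y + u * n).
pose D u := u * (r * (ln (r / n) - d2 / 2)) + (t u - x u) * gpdf (x u).
have bds (u : R) : u \in `[0, 1] -> Phi s <= Phi s + u * r <= Phi s'.
  rewrite in_itv /= => /andP[u0 u1]; apply/andP; split.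
    by rewrite lerDl mulr_ge0 // ltW.
  by rewrite -lerBrDl -/r ler_piMl // ltW.
have bdy (u : R) : u \in `[0, 1] -> Phi y <= Phi y + u * n <= Phi y'.
  rewrite in_itv /= => /andP[u0 u1]; apply/andP; split.
    by rewrite lerDl mulr_ge0 // ltW.
  by rewrite -lerBrDl -/n ler_piMl // ltW.
have rs (u : R) : u \in `[0, 1] -> 0 < Phi s + u * r /\ Phi s + u * r < 1.
  by move=> /bds /andP[h1 h2]; rewrite (lt_le_trans (Phi_gt0 _) h1) (le_lt_trans h2 (Phi_lt1 _)).
have ry (u : R) : u \in `[0, 1] -> 0 < Phi y + u * n /\ Phi y + u * n < 1.
  by move=> /bdy /andP[h1 h2]; rewrite (lt_le_trans (Phi_gt0 _) h1) (le_lt_trans h2 (Phi_lt1 _)).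
have xd (u : R) : u \in `[0, 1] -> is_derive u (1:R) x ((gpdf (x u))^-1 * r).
  move=> /rs[h1 h2]; have h := is_derive_PhiInv h1 h2.
  apply: (@is_derive1_comp _ PhiInv (fun u => Phi s + u * r)).
  by apply: is_derive_eq; rewrite /GRing.scale /=; ring.
have td (u : R) : u \in `[0, 1] -> is_derive u (1:R) t ((gpdf (t u))^-1 * n).
  move=> /ry[h1 h2]; have h := is_derive_PhiInv h1 h2.
  apply: (@is_derive1_comp _ PhiInv (fun u => Phi y + u * n)).
  by apply: is_derive_eq; rewrite /GRing.scale /=; ring.
pose D' u := r * (ln (r / n) - d2 / 2) +
  (((gpdf (t u))^-1 * n - (gpdf (x u))^-1 * r) * gpdf (x u) +
  (t u - x u) * (- x u * gpdf (x u) * ((gpdf (x u))^-1 * r))).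
have Dd (u : R) : u \in `[0, 1] -> is_derive u (1:R) D (D' u).
  move=> hu; have h1 := xd u hu; have h2 := td u hu.
  have h3 : is_derive u (1:R) (gpdf \o x) (- x u * gpdf (x u) * ((gpdf (x u))^-1 * r)).
    exact: is_derive1_comp.
  have -> : D = (fun u => u * (r * (ln (r / n) - d2 / 2))) + (t - x) * (gpdf \o x) by [].
  have h4 : is_derive u (1:R) (fun u => u * (r * (ln (r / n) - d2 / 2)))
      (r * (ln (r / n) - d2 / 2)).
    by apply: is_derive_eq; rewrite /GRing.scale /= mulr0 add0r mulr1.
  apply: (is_derive_eq (is_deriveD h4 (is_deriveM (is_deriveB h2 h1) h3))).
  by congr (_ + _); rewrite addrC; congr (_ + _); exact: mulrC.
have D'0 (u : R) : u \in `[0, 1] -> 0 <= D' u.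
  move=> hu; have [hs1 hs2] := rs u hu; have [hy1 hy2] := ry u hu.
  apply: transport_cell_derive_ge0 => //.
  have PxE : Phi (x u) = Phi s + u * r by exact: PhiInvK hs1 hs2.
  have PtE : Phi (t u) = Phi y + u * n by exact: PhiInvK hy1 hy2.
  apply: hd2.
    by rewrite -(Phi_leE s) -(Phi_leE _ s') PxE; exact: bds.
  by rewrite -(Phi_leE y) -(Phi_leE _ y') PtE; exact: bdy.
have : D 0 <= D 1 by exact: is_derive_ge0_le Dd D'0 ler01.
have -> : D 0 = (y - s) * gpdf s by rewrite /D /x /t !mul0r !addr0 !PhiK add0r.
have -> : D 1 = r * (ln (r / n) - d2 / 2) + (y' - s') * gpdf s'.
  have E1 : Phi s + r = Phi s' by rewrite /r addrC subrK.
  have E2 : Phi y + n = Phi y' by rewrite /n addrC subrK.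
  by rewrite /D /x /t !mul1r E1 E2 !PhiK.
lra.
Qed.

End gauss_quantile.

(** * Talagrand's inequality on the line *)

Section real_integrable.
Context d {T : measurableType d} {R : realType} (mu : {measure set T -> \bar R}).
Variables (D : set T) (f g : T -> R).
Hypotheses (mD : measurable D) (fi : mu.-integrable D (EFin \o f))
  (gi : mu.-integrable D (EFin \o g)).

Lemma integrableZlR (c : R) : mu.-integrable D (EFin \o (fun x => c * f x)).
Proof.
rewrite (_ : _ \o _ = (fun x => c%:E * (EFin \o f) x)%E) //.
exact: integrableZl.
Qed.

Lemma integrableDR : mu.-integrable D (EFin \o (fun x => f x + g x)).
Proof.
rewrite (_ : _ \o _ = ((EFin \o f) \+ (EFin \o g))%E) //.
exact: integrableD.
Qed.

Lemma integrableBR : mu.-integrable D (EFin \o (fun x => f x - g x)).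
Proof.
rewrite (_ : _ \o _ = ((EFin \o f) \- (EFin \o g))%E) //.
exact: integrableB.
Qed.

End real_integrable.

Section law.
Context d d' {T : measurableType d} {T' : measurableType d'} {R : realType}.
Variables (P : probability T R) (f : T -> T').
Hypothesis mf : measurable_fun setT f.
Let mf_mixin := isMeasurableFun.Build _ _ _ _ _ mf.
Let mf_pack : {mfun _ >-> _} := HB.pack f mf_mixin.

Definition law : probability T' R := distribution P mf_pack.

Lemma lawE (A : set T') : law A = P (f @^-1` A).
Proof. by []. Qed.

Lemma ge0_integral_law (g : T' -> \bar R) : measurable_fun setT g ->
  (forall y, 0 <= g y)%E -> (\int[law]_y g y = \int[P]_x g (f x))%E.
Proof. by move=> mg g0; rewrite ge0_integral_pushforward. Qed.

Lemma integrable_law (g : T' -> R) : measurable_fun setT g ->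
  law.-integrable setT (EFin \o g) <-> P.-integrable setT (fun x => (g (f x))%:E).
Proof.
move=> mg; have mgf : measurable_fun setT (fun x => (g (f x))%:E).
  by apply/measurable_EFinP; exact: measurableT_comp.
have E : (\int[law]_x `|(g x)%:E| = \int[P]_x `|(g (f x))%:E|)%E.
  by rewrite ge0_integral_law //; apply: measurableT_comp => //; exact/measurable_EFinP.
split=> /integrableP[_ h]; apply/integrableP; split => //.
- by rewrite -E.
- exact/measurable_EFinP.
- by rewrite E.
Qed.

Lemma Rintegral_law (g : T' -> R) : measurable_fun setT g ->
  P.-integrable setT (fun x => (g (f x))%:E) ->
  \int[law]_y g y = \int[P]_x g (f x).
Proof.
move=> mg ig; rewrite /Rintegral integral_pushforward //.
exact/measurable_EFinP.
Qed.

End law.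

Section density_probability.
Context d {T : measurableType d} {R : realType}.
Variables (mu : {measure set T -> \bar R}) (g : T -> R).
Hypotheses (mg : measurable_fun setT g) (g0 : forall x, 0 <= g x).
Hypothesis g1 : (\int[mu]_x (g x)%:E = 1)%E.

Let dens (A : set T) := (\int[mu]_(x in A) (g x)%:E)%E.

Let dens0 : dens set0 = 0%E.
Proof. by rewrite /dens integral_set0. Qed.

Let dens_ge0 A : (0 <= dens A)%E.
Proof. by apply: integral_ge0 => x _; rewrite lee_fin. Qed.

Let dens_sigma_additive : semi_sigma_additive dens.
Proof.
move=> A mA tA mUA; rewrite /dens ge0_integral_bigcup //; first last.
- by move=> x _; rewrite lee_fin.
- by apply: measurable_funTS; exact/measurable_EFinP.
apply: is_cvg_ereal_nneg_natsum_cond => n _ _.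
by apply: integral_ge0 => x _; rewrite lee_fin.
Qed.

HB.instance Definition _ := isMeasure.Build _ _ _ dens dens0 dens_ge0 dens_sigma_additive.

Let dens_setT : dens setT = 1%E.
Proof. exact: g1. Qed.

HB.instance Definition _ := @Measure_isProbability.Build _ _ R dens dens_setT.

Definition density_prob : probability T R := dens.

End density_probability.

Lemma measure_eq_oy (R : realType) (m1 m2 : {measure set (measurableTypeR R) -> \bar R}) :
  (forall x : R, m1 `]x, +oo[%classic = m2 `]x, +oo[%classic) ->
  (forall x : R, m1 `]x, +oo[%classic < +oo)%E ->
  forall A : set (measurableTypeR R), measurable A -> m1 A = m2 A.
Proof.
move=> h1 h2 A; refine (@measure_unique _ _ (measurableTypeR R) (@RGenOInfty.G R) (fun k => `](- k%:R), +oo[%classic) _ _ _ _ m1 m2 _ _ A).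
- exact: RGenOInfty.measurableE.
- move=> _ _ [x ->] [y ->]; exists (Num.max x y).
  by apply/seteqP; split => z /=; rewrite !in_itv /= !andbT gt_max; [case=> -> ->|move=> /andP].
- by move=> i; exists (- i%:R).
- rewrite -subTset => x _; exists (Num.truncn `|x|).+1 => //=; rewrite in_itv /= andbT.
  have := truncnS_gt `|x|; have := ler_norm (- x); rewrite normrN; lra.
- by move=> _ [x ->].
- by move=> k.
Qed.

Section talagrand_1d.
Context {R : realType}.
Variables (rho : probability (measurableTypeR R) R) (r : R -> R).
Hypotheses (mr : measurable_fun setT r) (r0 : forall x, 0 <= r x).
Local Notation gauss := (@gauss R).
Hypothesis rhoE : forall A, measurable A -> rho A = (\int[gauss]_(x in A) (r x)%:E)%E.
Local Notation F := (cdfr rho).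

(** The monotone rearrangement of [rho] onto [gauss]. This direction inverts [Phi], which is
    strictly increasing, whereas [F] may be flat. *)
Definition gauss_map (x : R) : R := PhiInv (F x).
Local Notation G := gauss_map.

Lemma density_noatom (x : R) : rho [set x] = 0%E.
Proof.
rewrite rhoE //; apply: null_set_integral => //; last exact: gauss_set1.
by apply/measurable_EFinP; exact: measurable_funTS.
Qed.

Lemma density_cdf_continuous : continuous F.
Proof. by apply: cdfr_continuous; exact: density_noatom. Qed.

Lemma measurable_gauss_map : measurable_fun setT G.
Proof.
apply: (measurableT_comp measurable_PhiInv).
by apply: continuous_measurable_fun; exact: density_cdf_continuous.
Qed.

Lemma measurable_cdf_le (p : R) : measurable [set x | F x <= p].
Proof.
rewrite -[X in measurable X]setTI; apply: measurable_fun_le => //.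
by apply: continuous_measurable_fun; exact: density_cdf_continuous.
Qed.

Lemma measurable_cdf_ge (p : R) : measurable [set x | p <= F x].
Proof.
rewrite -[X in measurable X]setTI; apply: measurable_fun_le => //.
by apply: continuous_measurable_fun; exact: density_cdf_continuous.
Qed.

(** [F] may be flat at level [p], so the sublevel set is enclosed in a half-line that ends where [F]
    takes a slightly higher value [p']. *)
Lemma cdf_le_measure (p : R) : 0 <= p -> p < 1 -> (rho [set x | (F x <= p)%R] <= p%:E)%E.
Proof.
move=> p0 p1; apply/lee_addgt0Pr => e e0.
have [p1' hp'] : exists p', p < p' < 1 /\ p' <= p + e.
  exists (Num.min ((p + 1) / 2) (p + e)); rewrite lt_min gt_min ge_min lexx orbT; split => //.
  by apply/andP; split; [apply/andP; split; lra|apply/orP; left; lra].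
case: hp' => /andP[pp' p'1] p'e.
have [w hw] := cdfr_surj density_noatom (le_lt_trans p0 pp') p'1.
apply: (@le_trans _ _ (rho `]-oo, w]%classic)).
  apply: le_measure; rewrite ?inE //; first exact: measurable_cdf_le.
  move=> x /= Fx; rewrite in_itv /= leNgt; apply/negP => /ltW /(cdfr_le rho); lra.
by rewrite -cdfrE hw -EFinD lee_fin.
Qed.

Lemma cdf_le0_measure : rho [set x | F x <= 0] = 0%E.
Proof. by apply/eqP; rewrite eq_le measure_ge0 andbT cdf_le_measure. Qed.

Lemma cdf_ge1_measure : rho [set x | 1 <= F x] = 0%E.
Proof.
apply/eqP; rewrite eq_le measure_ge0 andbT; apply/lee_addgt0Pr => e e0; rewrite add0e.
pose p := Num.max (1 / 2) (1 - e).
have p01 : 0 < p < 1 by rewrite lt_max gt_max; apply/andP; split; [apply/orP; left|apply/andP; split]; lra.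
have pe : 1 - e <= p by rewrite le_max lexx orbT.
case/andP: p01 => p0 p1.
have [w hw] := cdfr_surj density_noatom p0 p1.
apply: (@le_trans _ _ (rho `]w, +oo[%classic)).
  apply: le_measure; rewrite ?inE //; first exact: measurable_cdf_ge.
  move=> x /= Fx; rewrite in_itv /= andbT ltNge; apply/negP => /(cdfr_le rho); lra.
by rewrite cdfr_oy hw lee_fin; lra.
Qed.

Lemma Phi_gauss_map (x : R) : 0 < F x -> F x < 1 -> Phi (G x) = F x.
Proof. exact: PhiInvK. Qed.

(** [Phi_gauss_map] can fail only where [F] is 0 or 1. These sets are [rho]-null, and the inclusions
    between level sets are taken up to them. *)
Lemma gauss_map_oy (z : R) : rho (G @^-1` `]z, +oo[) = gauss `]z, +oo[%classic.
Proof.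
have mG : measurable (G @^-1` `]z, +oo[).
  by rewrite -[X in measurable X]setTI; exact: measurable_gauss_map.
have p0 := Phi_gt0 z; have p1 := Phi_lt1 z; set p := Phi z in p0 p1.
rewrite cdfr_oy -/(Phi z) -/p.
have m1 : (1 - p)%:E = (1 - p%:E)%E by [].
apply/eqP; rewrite eq_le; apply/andP; split.
- have [w hw] := cdfr_surj density_noatom p0 p1.
  apply: (@le_trans _ _ (rho (`]w, +oo[%classic `|` ([set x | F x <= 0] `|` [set x | 1 <= F x])))).
    apply: le_measure; rewrite ?inE //.
      by apply: measurableU => //; apply: measurableU; [exact: measurable_cdf_le|exact: measurable_cdf_ge].
    move=> x /=; rewrite !in_itv /= !andbT => zx.
    have [|Fx0] := leP (F x) 0; first by right; left.
    have [|Fx1] := leP 1 (F x); first by right; right.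
    left; move: zx; rewrite -Phi_ltE Phi_gauss_map // -/p -hw => h.
    by rewrite ltNge; apply/negP => /(cdfr_le rho); lra.
  apply: (le_trans (measureU2 _ _ _)) => //.
    by apply: measurableU; [exact: measurable_cdf_le|exact: measurable_cdf_ge].
  rewrite -[leRHS]adde0; apply: leeD; first by rewrite -hw -(cdfr_oy rho).
  apply: (le_trans (measureU2 _ _ _)); [exact: measurable_cdf_le|exact: measurable_cdf_ge|].
  rewrite -[leRHS]adde0; apply: leeD; rewrite le_eqVlt; apply/orP; left; apply/eqP.
    exact: cdf_le0_measure.
  exact: cdf_ge1_measure.
- apply: (@le_trans _ _ (rho (~` [set x | F x <= p]))).
    rewrite probability_setC; last exact: measurable_cdf_le.
    by rewrite m1 leeB // cdf_le_measure // ltW.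
  apply: (@le_trans _ _ (rho (G @^-1` `]z, +oo[%classic `|` [set x | 1 <= F x]))).
    apply: le_measure; rewrite ?inE //.
    - by apply: measurableC; exact: measurable_cdf_le.
    - by apply: measurableU => //; exact: measurable_cdf_ge.
    move=> x /=; rewrite in_itv /= andbT => /negP; rewrite -ltNge => pF.
    have [|Fx1] := leP 1 (F x); first by right.
    by left; rewrite -Phi_ltE Phi_gauss_map // (lt_trans p0).
  apply: (le_trans (measureU2 _ _ _)) => //; first exact: measurable_cdf_ge.
  rewrite -[leRHS]adde0; apply: leeD => //; rewrite le_eqVlt; apply/orP; left; apply/eqP.
  exact: cdf_ge1_measure.
Qed.

Lemma gauss_map_law (B : set R) : measurable B -> rho (G @^-1` B) = gauss B.
Proof.
move=> mB; refine (@measure_eq_oy R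
  (@law _ _ _ (measurableTypeR R) R rho G measurable_gauss_map) gauss _ _ B mB).
- exact: gauss_map_oy.
- by move=> x; rewrite (le_lt_trans (probability_le1 _ _)) ?ltry.
Qed.

Local Notation k := (fun x => ln (r x) * r x).
Hypothesis hk : rho.-integrable setT (fun x => (ln (r x))%:E).

Lemma measurable_ln_density : measurable_fun setT (fun x => ln (r x)).
Proof. by apply: measurableT_comp => //; exact: measurable_ln. Qed.

Lemma integrable_entropy : gauss.-integrable setT (EFin \o k).
Proof.
pose f : measurableTypeR R -> R := fun x => ln (r x).
have mf : measurable_fun setT f by exact: measurable_ln_density.
exact: (@integral_density _ (measurableTypeR R) R gauss rho r mr r0 rhoE f mf).1 hk.
Qed.

Lemma integrable_density1 : gauss.-integrable setT (EFin \o r).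
Proof.
apply/integrableP; split; first exact/measurable_EFinP.
under eq_integral do rewrite /= ger0_norm //.
by rewrite -rhoE // probability_setT ltry.
Qed.

Lemma integrable_densityS (I : set (measurableTypeR R)) : measurable I ->
  gauss.-integrable I (EFin \o r).
Proof. by move=> mI; apply: integrableS integrable_density1. Qed.

Lemma integrable_entropyS (I : set (measurableTypeR R)) : measurable I ->
  gauss.-integrable I (EFin \o k).
Proof. by move=> mI; apply: integrableS integrable_entropy. Qed.

(** Integrates over [I] the tangent line at [y = c] of the convex function [y ln y]. The choice
    [c = rho I / gauss I] is Jensen's inequality on [I]. *)
Lemma entropy_ge (I : set (measurableTypeR R)) (c : R) : measurable I -> 0 < c ->
  fine (rho I) * (ln c + 1) - c * fine (gauss I) <= \int[gauss]_(x in I) k x.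
Proof.
move=> mI c0.
have iI := integrable_densityS mI; have ik := integrable_entropyS mI.
have i1 : gauss.-integrable I (EFin \o (fun x => (ln c + 1) * r x)).
  exact: integrableZlR.
have i2 : gauss.-integrable I (EFin \o (fun=> c)).
  exact: finite_measure_integrable_cst.
have -> : fine (rho I) * (ln c + 1) - c * fine (gauss I) =
    \int[gauss]_(x in I) ((ln c + 1) * r x - c).
  rewrite RintegralB // RintegralZl // Rintegral_cst // mulrC; congr (_ * _ - _).
  by rewrite rhoE.
apply: le_Rintegral => //.
  exact: integrableBR.
move=> x _; have := r0 x; rewrite le_eqVlt => /predU1P[<-|rx0].
  by rewrite !mulr0; lra.
have h : ln (c / r x) <= c / r x - 1.
  by rewrite lerBrDl -[in leRHS](@lnK _ (c / r x)) ?posrE ?divr_gt0 // expR_ge1Dx.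
rewrite ln_div ?posrE // in h.
have : (ln c - ln (r x)) * r x <= (c / r x - 1) * r x by rewrite ler_wpM2r.
rewrite [X in _ <= X]mulrBl divfK ?gt_eqF //; lra.
Qed.

(** The constant [c] of [entropy_ge] is sent to 0. *)
Lemma entropy_ge0_of_null (I : set (measurableTypeR R)) : measurable I ->
  fine (rho I) = 0 -> 0 <= \int[gauss]_(x in I) k x.
Proof.
move=> mI rI; rewrite -lerN2 oppr0; apply/ler_addgt0Pr => e e0; rewrite add0r.
have := entropy_ge mI e0; rewrite rI mul0r sub0r.
have : fine (gauss I) <= 1 by rewrite -lee_fin fineK ?fin_num_measure // probability_le1.
have : 0 <= fine (gauss I) by rewrite fine_ge0.
by move: (fine _) => y; nra.
Qed.

Lemma entropy_ge_ln (I : set (measurableTypeR R)) : measurable I ->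
  0 < fine (gauss I) -> 0 < fine (rho I) ->
  fine (rho I) * ln (fine (rho I) / fine (gauss I)) <= \int[gauss]_(x in I) k x.
Proof.
move=> mI g0 f0; apply: le_trans (entropy_ge mI (divr_gt0 f0 g0)).
by rewrite mulrDr mulr1 divfK ?gt_eqF // addrK.
Qed.

Lemma gauss_Rintegral_split (f : R -> R) (y z z' : R) : y <= z -> z <= z' ->
  gauss.-integrable `]y, z'] (EFin \o f) ->
  \int[gauss]_(x in `]y, z']) f x =
  \int[gauss]_(x in `]y, z]) f x + \int[gauss]_(x in `]z, z']) f x.
Proof.
move=> yz zz'; have -> : `]y, z']%classic = `]y, z] `|` `]z, z'] :> set R.
  by rewrite -itv_bndbnd_setU // bnd_simp.
move=> fi; apply: Rintegral_setU => //; rewrite -?itv_bndbnd_setU //.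
rewrite disj_set2E; apply/eqP; rewrite -subset0 => x [/=]; rewrite !in_itv /=.
by move=> /andP[_ h1] /andP[h2 _]; move: (le_lt_trans h1 h2); rewrite ltxx.
Qed.

Definition gauss_gap (x : R) : R := G x - x.

Lemma cdf_interval (y y' v : R) : 0 < F y -> F y' < 1 -> y <= v -> v <= y' ->
  0 < F v /\ F v < 1.
Proof.
move=> h1 h2 yv vy'; split.
  exact: lt_le_trans (cdfr_le rho yv).
exact: le_lt_trans (cdfr_le rho vy') _.
Qed.

Lemma gauss_map_le (y y' v w : R) : 0 < F y -> F y' < 1 ->
  y <= v -> v <= w -> w <= y' -> G v <= G w.
Proof.
move=> h1 h2 yv vw wy'.
have [v1 v2] := cdf_interval h1 h2 yv (le_trans vw wy').
have [w1 w2] := cdf_interval h1 h2 (le_trans yv vw) wy'.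
by apply: PhiInv_le => //; exact: cdfr_le.
Qed.

Lemma gauss_map_continuous (y y' : R) : 0 < F y -> F y' < 1 ->
  {within `[y, y'], continuous G}.
Proof.
move=> h1 h2; apply: continuous_in_subspaceT => x; rewrite inE /= in_itv /= => /andP[yx xy'].
have [x1 x2] := cdf_interval h1 h2 yx xy'.
apply: (@continuous_comp _ _ _ F PhiInv); first exact: density_cdf_continuous.
by apply: is_derive_continuous; exact: is_derive_PhiInv.
Qed.

Lemma gauss_gap_bound (y y' : R) : 0 < F y -> F y' < 1 -> exists2 M : R, 0 <= M &
  forall v, y <= v <= y' -> `|gauss_gap v| <= M.
Proof.
move=> h1 h2; exists (`|G y| + `|G y'| + `|y| + `|y'|).
  by rewrite !addr_ge0.
move=> v /andP[yv vy'].
have g1 := gauss_map_le h1 h2 (lexx _) yv vy'.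
have g2 := gauss_map_le h1 h2 yv vy' (lexx _).
rewrite /gauss_gap ler_norml.
have := ler_norm (G y); have := ler_norm (- G y); have := ler_norm (G y').
have := ler_norm (- G y'); have := ler_norm y; have := ler_norm (- y).
have := ler_norm y'; have := ler_norm (- y'); rewrite !normrN.
by move: (`|G y|) (`|G y'|) (`|y|) (`|y'|) => a1 a2 a3 a4 *; apply/andP; split; lra.
Qed.

Local Notation bdry := (fun z => (z - G z) * gpdf (G z)).
Local Notation q := (fun x => (gauss_gap x) ^+ 2 * r x).

Lemma integrable_gap (y y' : R) (I : set (measurableTypeR R)) : 0 < F y -> F y' < 1 ->
  measurable I -> I `<=` `[y, y'] -> gauss.-integrable I (EFin \o q).
Proof.
move=> h1 h2 mI Iy; have [M M0 hM] := gauss_gap_bound h1 h2.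
have iI := @integrableZlR _ _ _ _ _ _ mI (integrable_densityS mI) (M ^+ 2).
apply: le_integrable iI => //.
  apply/measurable_EFinP; apply: measurable_funTS; apply: measurable_funM => //.
  apply: measurable_funX; apply: measurable_funB => //; exact: measurable_gauss_map.
move=> x /Iy /= /[!in_itv] /= /hM h; rewrite lee_fin !normrM !(ger0_norm (r0 _)).
by rewrite ler_wpM2r // (ger0_norm M0) ler_pM.
Qed.

(** Jensen's inequality on the cell stands in for a change of variables by the possibly
    non-differentiable [G]: [transport_cell] compares the images [G z], [G z'] with the end points
    [z], [z'], at squared distance at least [gauss_gap z ^ 2 - e], while the integral of the squared
    gap is bounded with [gauss_gap z ^ 2 + e]. The two half-errors make up [e (F z' - F z)], and the
    [bdry] terms telescope over adjacent cells. *)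
Lemma cell_le (e y y' z z' : R) : 0 <= e -> 0 < F y -> F y' < 1 -> y <= z -> z < z' -> z' <= y' ->
  (forall w x, z <= w <= z' -> G z <= x <= G z' -> `|(x - w) ^+ 2 - (gauss_gap z) ^+ 2| <= e) ->
  bdry z - bdry z' - e * (F z' - F z) <=
  \int[gauss]_(x in `]z, z']) k x - 2^-1 * \int[gauss]_(x in `]z, z']) q x.
Proof.
move=> e0 h1 h2 yz zz' zy' hd.
pose I : set (measurableTypeR R) := `]z, z']%classic.
have mI : measurable I by exact: measurable_itv.
have rI : fine (rho I) = F z' - F z by rewrite /I cdfr_itv // ltW.
have gI : fine (gauss I) = Phi z' - Phi z by rewrite /I cdfr_itv // ltW.
have g0 : 0 < fine (gauss I) by rewrite gI subr_gt0 Phi_lt.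
have [z1 z2] := cdf_interval h1 h2 yz (le_trans (ltW zz') zy').
have [z'1 z'2] := cdf_interval h1 h2 (le_trans yz (ltW zz')) zy'.
set a := (gauss_gap z) ^+ 2 in hd *.
have Iy : I `<=` `[y, y'].
  move=> x; rewrite /I /= !in_itv /= => /andP[zx xz'].
  by rewrite (le_trans yz (ltW zx)) (le_trans xz').
have iq := integrable_gap h1 h2 mI Iy.
have qle : \int[gauss]_(x in I) q x <= (a + e) * fine (rho I).
  have -> : (a + e) * fine (rho I) = \int[gauss]_(x in I) ((a + e) * r x).
    by rewrite RintegralZl //; [rewrite rhoE|exact: integrable_densityS].
  apply: le_Rintegral => //; first by apply: integrableZlR => //; exact: integrable_densityS.
  move=> x; rewrite /I /= in_itv /= => /andP[zx xz'].
  rewrite ler_wpM2r // -lerBlDl (le_trans (ler_norm _)) // hd //.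
    by rewrite (ltW zx).
  by rewrite (gauss_map_le h1 h2 yz (ltW zx)) ?(le_trans xz') // (gauss_map_le h1 h2 _ xz' zy') // (le_trans yz (ltW zx)).
rewrite -rI.
(* A cell without mass is collapsed to a point by [G], and [transport_cell] requires distinct image
   points. *)
have [rI0|rI0] := eqVneq (fine (rho I)) 0.
  have ek := entropy_ge0_of_null mI rI0.
  have FF : F z = F z' by apply/eqP; rewrite eq_sym -subr_eq0 -rI rI0.
  have GG : G z = G z' by rewrite /G /gauss_map FF.
  rewrite rI0 mulr0 in qle; rewrite rI0 mulr0 subr0 -GG.
  have : 0 <= (z' - z) * gpdf (G z) by rewrite mulr_ge0 ?subr_ge0 ?(ltW zz') // ltW // gpdf_gt0.
  by move: ek qle; rewrite -/I; lra.
have rI1 : 0 < fine (rho I) by rewrite lt_neqAle eq_sym rI0 fine_ge0.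
have ek := entropy_ge_ln mI g0 rI1.
have ss' : G z < G z' by rewrite -Phi_ltE !Phi_gauss_map // -subr_gt0 -rI.
have cell : (a - e) / 2 * fine (rho I) - (bdry z' - bdry z) <=
    fine (rho I) * ln (fine (rho I) / fine (gauss I)).
  rewrite rI gI -(Phi_gauss_map z1 z2) -(Phi_gauss_map z'1 z'2).
  refine (@transport_cell R (G z) (G z') z z' (a - e) ss' zz' _) => x t hx ht.
  have := hd t x ht hx; rewrite -[(x - t) ^+ 2]sqrrN opprB; set w := (t - x) ^+ 2.
  by rewrite ler_norml => /andP[h _]; lra.
move: ek qle cell; rewrite -/I.
set A := \int[gauss]_(x in I) _; set B := \int[gauss]_(x in I) _.
set l := ln _; lra.
Qed.

Lemma entropy_gap_itv (y y' : R) : 0 < F y -> F y' < 1 -> y < y' ->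
  bdry y - bdry y' + 2^-1 * \int[gauss]_(x in `]y, y']) q x <=
  \int[gauss]_(x in `]y, y']) k x.
Proof.
move=> h1 h2 yy'.
have [M M0 hM] := gauss_gap_bound h1 h2.
pose I z : set (measurableTypeR R) := `]y, z]%classic.
have mI z : measurable (I z) by exact: measurable_itv.
apply/ler_addgt0Pr => e e0.
(* The term [e * F z] pays for the cell errors; as [F] grows by at most 1, they cost at most [e] in
   total. *)
pose C z := \int[gauss]_(x in I z) k x - 2^-1 * \int[gauss]_(x in I z) q x + bdry z + e * F z.
(* One [dl] bounds the variation of [G] on a cell and another the width of the cell, so squared gaps
   vary by at most [2 dl (2 dl + 2 M)], which is at most [e] for this choice. *)
pose dl := Num.min 1 (e / (4 * M + 4)).
have M4 : 0 < 4 * M + 4 by lra.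
have dl0 : 0 < dl by rewrite lt_min ltr01 divr_gt0.
have dl1 : dl <= 1 by rewrite ge_min lexx.
have dle : dl * (4 * M + 4) <= e by rewrite -ler_pdivlMr // ge_min lexx orbT.
have [eta eta0 heta] := compact_unif_continuous (@segment_compact _ y y')
  (gauss_map_continuous h1 h2) dl0.
have eta1 : 0 < Num.min eta dl by rewrite lt_min eta0.
have CC : C y <= C y'.
  apply: (locally_nondecreasing_le eta1 (ltW yy')) => z z' yz; rewrite le_eqVlt.
  move=> /predU1P[-> //|zz'] z'y'; rewrite lt_min => /andP[hz1 hz2].
  have hG : `|G z - G z'| < dl.
    apply: heta; rewrite /= ?in_itv /= ?yz ?z'y' ?(le_trans yz (ltW zz')) ?(le_trans (ltW zz')) //.
    by rewrite distrC ger0_norm // subr_ge0 ltW.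
  have := cell_le (ltW e0) h1 h2 yz zz' z'y' _.
  rewrite /C /I (@gauss_Rintegral_split k y z z') ?(ltW zz') //; last first.
    by apply: integrable_entropyS; exact: measurable_itv.
  rewrite (@gauss_Rintegral_split q y z z') ?(ltW zz') //; last first.
    apply: (integrable_gap h1 h2); first exact: measurable_itv.
    by move=> x /=; rewrite !in_itv /= => /andP[yx xz]; rewrite (ltW yx) (le_trans xz).
  have H : forall w x : R, z <= w <= z' -> G z <= x <= G z' ->
      `|(x - w) ^+ 2 - gauss_gap z ^+ 2| <= e.
    move=> w x /andP[zw wz'] /andP[Gx xG].
    have ha : `|gauss_gap z| <= M by apply: hM; rewrite yz (le_trans (ltW zz')).
    rewrite ltr_norml in hG; move: ha; rewrite ler_norml ler_norml /gauss_gap.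
    case/andP: hG => hG1 hG2 /andP[ha1 ha2].
    set a := G z - z in ha1 ha2 *; pose D := x - w - a.
    have D1 : - (2 * dl) <= D by rewrite /D /a; lra.
    have D2 : D <= 2 * dl by rewrite /D /a; lra.
    have -> : (x - w) ^+ 2 - a ^+ 2 = D * (D + 2 * a) by rewrite /D; ring.
    have : `|D * (D + 2 * a)| <= 2 * dl * (2 * dl + 2 * M).
      rewrite normrM ler_pM // ler_norml; apply/andP; split; lra.
    rewrite -ler_norml => h; apply: (le_trans h); nra.
  move=> /(_ H).
  set A := \int[gauss]_(x in _) k x; set A' := \int[gauss]_(x in _) k x.
  set B := \int[gauss]_(x in _) q x; set B' := \int[gauss]_(x in _) q x.
  lra.
move: CC; rewrite /C /I.
rewrite [X in Rintegral _ X](_ : `]y, y]%classic = set0); last first.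
  by rewrite set_itv_ge // bnd_simp ltxx.
rewrite !Rintegral_set0 mulr0 subrr add0r.
have := cdfr_ge0 rho y; have := cdfr_le1 rho y'.
set A := \int[gauss]_(x in _) _; set B := \int[gauss]_(x in _) _.
move=> F1 F0 CC.
have : e * (F y' - F y) <= e by rewrite ler_piMr ?(ltW e0) //; lra.
lra.
Qed.

(** Jensen's inequality on the two outer half-lines, followed by [Phi_tail] and [Phi_tailN], returns
    exactly the boundary terms lost in [entropy_gap_itv]. *)
Lemma gap_le_entropy (y y' : R) : 0 < F y -> F y' < 1 -> y < y' ->
  2^-1 * \int[gauss]_(x in `]y, y']) q x <= \int[gauss]_x k x.
Proof.
move=> h1 h2 yy'.
have [y1 y2] := cdf_interval h1 h2 (lexx y) (ltW yy').
have [y'1 y'2] := cdf_interval h1 h2 (ltW yy') (lexx y').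
have hm := entropy_gap_itv h1 h2 yy'.
have mL : measurable (`]-oo, y]%classic : set (measurableTypeR R)) by exact: measurable_itv.
have mI : measurable (`]y, y']%classic : set (measurableTypeR R)) by exact: measurable_itv.
have mR : measurable (`]y', +oo[%classic : set (measurableTypeR R)) by exact: measurable_itv.
have hL : - bdry y <= \int[gauss]_(x in `]-oo, y]) k x.
  apply: le_trans (entropy_ge_ln mL _ _); rewrite -?/(Phi y) ?Phi_gt0 //.
  by rewrite -/(F y) -(Phi_gauss_map y1 y2); exact: Phi_tail.
have hR : bdry y' <= \int[gauss]_(x in `]y', +oo[) k x.
  have e1 : fine (rho `]y', +oo[%classic) = 1 - F y' by rewrite cdfr_oy.
  have e2 : fine (gauss `]y', +oo[%classic) = 1 - Phi y' by rewrite cdfr_oy.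
  apply: le_trans (entropy_ge_ln mR _ _); rewrite ?e1 ?e2 ?subr_gt0 ?Phi_lt1 //.
  by rewrite -(Phi_gauss_map y'1 y'2); exact: Phi_tailN.
have E : (setT : set (measurableTypeR R)) = (`]-oo, y]%classic `|` `]y, y']%classic) `|` `]y', +oo[%classic.
  by rewrite -itv_bndbnd_setU // ?bnd_simp ?(ltW yy') // -itv_bndbnd_setU // set_itvNyy.
rewrite E Rintegral_setU //; last 3 first.
- exact: measurableU.
- by apply: integrable_entropyS; rewrite -E.
- rewrite disj_set2E; apply/eqP; rewrite -subset0 => x [/=]; rewrite !in_itv /= andbT.
  by move=> [|/andP[_]] hx h; [have := lt_trans (le_lt_trans hx yy') h|have := le_lt_trans hx h];
    rewrite ltxx.
rewrite Rintegral_setU //; last 2 first.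
- by apply: integrable_entropyS; exact: measurableU.
- rewrite disj_set2E; apply/eqP; rewrite -subset0 => x [/=]; rewrite !in_itv /=.
  by move=> hx /andP[h _]; have := le_lt_trans hx h; rewrite ltxx.
move: hm hL hR.
set A := \int[gauss]_(x in _) k x; set B := \int[gauss]_(x in _) k x.
set C := \int[gauss]_(x in _) k x; set D := \int[gauss]_(x in _) q x.
lra.
Qed.

Theorem talagrand_1d :
  (\int[rho]_x ((gauss_gap x) ^+ 2)%:E <= (2 * \int[rho]_x ln (r x))%:E)%E.
Proof.
have mgap : measurable_fun setT (fun x => gauss_gap x ^+ 2).
  apply: measurable_funX; apply: measurable_funB => //; exact: measurable_gauss_map.
have kE : \int[rho]_x ln (r x) = \int[gauss]_x k x.
  pose f : measurableTypeR R -> R := fun x => ln (r x).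
  have mf : measurable_fun setT f by exact: measurable_ln_density.
  exact: (@Rintegral_density _ (measurableTypeR R) R gauss rho r mr r0 rhoE f mf hk).
(* Levels strictly inside []0, 1[], where [gap_le_entropy] applies; [n.+3] keeps the lower level
   under 1/2 and hence under the upper one. The union misses only a [rho]-null set. *)
pose J (n : nat) : set (measurableTypeR R) :=
  [set x | n.+3%:R^-1 < F x /\ F x < 1 - n.+3%:R^-1].
have mJ n : measurable (J n).
  rewrite (_ : J n = ~` [set x | F x <= n.+3%:R^-1] `&` ~` [set x | 1 - n.+3%:R^-1 <= F x]).
    by apply: measurableI; apply: measurableC; [exact: measurable_cdf_le|exact: measurable_cdf_ge].
  by apply/seteqP; split => x /= [h1 h2]; split; do ?[apply/negP; rewrite -ltNge //]; 
    move/negP: h1 h2 => + /negP; rewrite -!ltNge.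
have hJ n : (\int[rho]_(x in J n) ((gauss_gap x) ^+ 2)%:E <= (2 * \int[gauss]_x k x)%:E)%E.
  have n0 : 0 < n.+3%:R^-1 :> R by rewrite invr_gt0 ltr0n.
  have n1 : n.+3%:R^-1 < 2^-1 :> R by rewrite ltf_pV2 ?posrE // ltr_nat.
  have n2 : n.+3%:R^-1 < 1 - n.+3%:R^-1 :> R.
    by move: n0 n1; set a := n.+3%:R^-1 => n0 n1; lra.
  have n3 : 0 < 1 - n.+3%:R^-1 :> R by exact: lt_trans n2.
  have n4 : 1 - n.+3%:R^-1 < 1 :> R by rewrite gtrBl.
  have [y hy] := cdfr_surj density_noatom n0 (lt_trans n2 n4).
  have [y' hy'] := cdfr_surj density_noatom n3 n4.
  have h1 : 0 < F y by rewrite hy.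
  have h2 : F y' < 1 by rewrite hy'.
  have yy' : y < y' by rewrite ltNge; apply/negP => /(cdfr_le rho); rewrite hy hy' leNgt n2.
  have mI : measurable (`]y, y']%classic : set (measurableTypeR R)) by exact: measurable_itv.
  apply: (@le_trans _ _ (\int[rho]_(x in `]y, y']) ((gauss_gap x) ^+ 2)%:E)%E).
    apply: ge0_subset_integral => //.
    - by apply/measurable_EFinP; exact: measurable_funTS.
    - by move=> x _; rewrite lee_fin sqr_ge0.
    - move=> x [hx1 hx2]; rewrite /= in_itv /=; apply/andP; split.
        by rewrite ltNge; apply/negP => /(cdfr_le rho); rewrite hy leNgt hx1.
      by rewrite leNgt; apply/negP => /ltW /(cdfr_le rho); rewrite hy' leNgt hx2.
  rewrite (@ge0_integral_density _ (measurableTypeR R) R gauss rho r) //; first last.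
  - by apply/measurable_EFinP; exact: measurable_funTS.
  - by move=> x; rewrite lee_fin sqr_ge0.
  have iq : gauss.-integrable `]y, y'] (EFin \o q).
    apply: (integrable_gap h1 h2) => //.
    by move=> x /=; rewrite !in_itv /= => /andP[yx ->]; rewrite ltW.
  rewrite -[leLHS]fineK; last exact: (integrable_fin_num mI iq).
  rewrite lee_fin; have := gap_le_entropy h1 h2 yy'; rewrite /Rintegral.
  set A := fine _; set B := fine _ => h.
  by lra.
have ndJ : nondecreasing_seq J.
  move=> m n mn; apply/subsetPset => x [h1 h2].
  have h : n.+3%:R^-1 <= m.+3%:R^-1 :> R by rewrite lef_pV2 ?posrE // ler_nat !ltnS.
  move: h h1 h2; rewrite /J /=; set a := n.+3%:R^-1; set b := m.+3%:R^-1 => h h1 h2.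
  split; lra.
have mfJ i : measurable_fun (J i) (fun x => (gauss_gap x ^+ 2)%:E).
  by apply/measurable_EFinP; exact: measurable_funTS.
have fJ0 i x : J i x -> (0 <= (gauss_gap x ^+ 2)%:E)%E by rewrite lee_fin sqr_ge0.
have cvgJ := @ge0_nondecreasing_set_cvg_integral _ (measurableTypeR R) R J _ rho ndJ mJ mfJ fJ0.
have mUJ : measurable (\bigcup_i J i) by exact: bigcupT_measurable.
have NJ : rho (~` (\bigcup_i J i)) = 0%E.
  apply/eqP; rewrite eq_le measure_ge0 andbT.
  apply: (@le_trans _ _ (rho ([set x | F x <= 0] `|` [set x | 1 <= F x]))).
    apply: le_measure; rewrite ?inE.
    - exact: measurableC.
    - by apply: measurableU; [exact: measurable_cdf_le|exact: measurable_cdf_ge].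
    move=> x /= nJ; have [|Fx0] := leP (F x) 0; first by left.
    have [|Fx1] := leP 1 (F x); first by right.
    exfalso; apply: nJ.
    have e0 : 0 < Num.min (F x) (1 - F x) by rewrite lt_min Fx0 subr_gt0.
    have [n _ /(_ n (leqnn n)) hn] := near_infty_natSinv_lt (PosNum e0).
    exists n => //=; move: hn; rewrite /= lt_min => /andP[hn1 hn2].
    have : n.+3%:R^-1 <= n.+1%:R^-1 :> R by rewrite lef_pV2 ?posrE // ler_nat !ltnS leqW.
    rewrite /J /=; move: hn1 hn2; set a := n.+3%:R^-1; set b := n.+1%:R^-1 => hn1 hn2 ab.
    split; lra.
  apply: (le_trans (measureU2 _ _ _)); [exact: measurable_cdf_le|exact: measurable_cdf_ge|].
  rewrite -[leRHS]adde0; apply: leeD; rewrite le_eqVlt; apply/orP; left; apply/eqP.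
    exact: cdf_le0_measure.
  exact: cdf_ge1_measure.
rewrite kE (@ge0_negligible_integral _ (measurableTypeR R) R rho setT (~` (\bigcup_i J i))) //; first last.
- by move=> x _; rewrite lee_fin sqr_ge0.
- exact/measurable_EFinP.
- exact: measurableC.
rewrite setTD setCK -(cvg_lim _ cvgJ) //; apply: lime_le; first exact: cvgP cvgJ.
by near=> n; exact: hJ.
Unshelve. all: by end_near. Qed.

End talagrand_1d.

(** * Conditional transport *)

Lemma density_exists d (T : measurableType d) (R : realType)
  (nu mu : probability T R) : nu `<< mu -> exists f : T -> R,
  [/\ measurable_fun setT f, forall x, 0 <= f x &
      forall A, measurable A -> nu A = (\int[mu]_(x in A) (f x)%:E)%E].
Proof.
move=> numu; pose f := Radon_Nikodym_SigmaFinite.f nu mu.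
exists (fine \o f); split.
- apply: measurableT_comp => //.
  exact: measurable_int (Radon_Nikodym_SigmaFinite.f_integrable numu).
- by move=> x; rewrite fine_ge0 // Radon_Nikodym_SigmaFinite.f_ge0.
- move=> A mA; rewrite (Radon_Nikodym_SigmaFinite.f_integral numu) //.
  by apply: eq_integral => x _; rewrite /= fineK // Radon_Nikodym_SigmaFinite.f_fin_num.
Qed.

Section conditional_density.
Context d {A : measurableType d} {R : realType}.
Local Notation gauss := (@gauss R).
Local Notation RR := (measurableTypeR R).
Variables (alpha : probability A R) (rho : probability (A * RR)%type R).
Variable g : A * RR -> R.
Hypotheses (mg : measurable_fun setT g) (g0 : forall x, 0 <= g x).
Hypothesis rhoE : forall C, measurable C ->
  rho C = (\int[alpha \x gauss]_(x in C) (g x)%:E)%E.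

Let g1 (a : A) : \bar R := (\int[gauss]_w (g (a, w))%:E)%E.
Let good a := (0 < g1 a)%E && (g1 a < +oo)%E.

(* [expR (- ln y)] is [y^-1] for [0 < y], and visibly measurable *)
Definition cond_density (z : A * RR) : R :=
  if good z.1 then g z * expR (- ln (fine (g1 z.1))) else 1.
Local Notation r := cond_density.

Let mgE : measurable_fun setT (EFin \o g).
Proof. exact/measurable_EFinP. Qed.

Let mg1 : measurable_fun setT g1.
Proof.
by apply: (@measurable_fun_fubini_tonelli_F _ _ A RR R gauss (EFin \o g)) => // x.
Qed.

Let mgood : measurable_fun setT good.
Proof.
apply: measurable_and.
- exact: (@measurable_fun_lte _ _ _ setT (cst 0%E) g1).
- exact: (@measurable_fun_lte _ _ _ setT g1 (cst +oo%E)).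
Qed.

Lemma measurable_cond_density : measurable_fun setT r.
Proof.
apply: measurable_fun_ifT => //.
- exact: (measurableT_comp mgood measurable_fst).
- apply: measurable_funM => //.
  apply: measurableT_comp => //; apply: measurableT_comp => //.
  apply: (measurableT_comp (@measurable_ln R)).
  apply: measurableT_comp => //.
  exact: (measurableT_comp mg1 measurable_fst).
Qed.

Lemma cond_density_ge0 z : 0 <= r z.
Proof. by rewrite /cond_density; case: ifP => // _; rewrite mulr_ge0 ?expR_ge0. Qed.

Lemma measurable_cond_density_section a : measurable_fun setT (fun w : RR => r (a, w)).
Proof. exact: (measurableT_comp measurable_cond_density (measurable_pair1 a)). Qed.

Let goodE (a : A) (h : RR -> \bar R) : good a -> measurable_fun setT h ->
  (forall w, 0 <= h w)%E ->
  (g1 a * \int[gauss]_w (h w * (r (a, w))%:E) = \int[gauss]_w (h w * (g (a, w))%:E))%E.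
Proof.
move=> ga mh h0; have /andP[g10 g1y] := ga.
have g1f : g1 a = (fine (g1 a))%:E by rewrite fineK // ge0_fin_numE // ltW.
have f0 : 0 < fine (g1 a) by rewrite -lte_fin -g1f.
have mh' : measurable_fun setT (fun w : RR => (h w * (g (a, w))%:E)%E).
  apply: emeasurable_funM => //.
  exact: (measurableT_comp mgE (measurable_pair1 a)).
have -> : (\int[gauss]_w (h w * (r (a, w))%:E) =
    \int[gauss]_w ((expR (- ln (fine (g1 a))))%:E * (h w * (g (a, w))%:E)))%E.
  apply: eq_integral => w _; rewrite /cond_density /= ga EFinM muleA.
  by rewrite muleC.
rewrite ge0_integralZl //; last by move=> w _; rewrite mule_ge0 ?lee_fin.
rewrite muleA {1}g1f -EFinM expRN lnK ?posrE // divff ?gt_eqF // mul1e //.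
Qed.

Lemma integral_cond_density a : (\int[gauss]_w (r (a, w))%:E = 1)%E.
Proof.
have [ga|ga] := boolP (good a); last first.
  rewrite (eq_integral (cst 1%E)); last by move=> w _; rewrite /cond_density /= (negbTE ga).
  by rewrite integral_cst // mul1e; exact: probability_setT.
have := goodE ga (measurable_cst 1%E) (fun=> lee01).
under eq_integral do rewrite mul1e.
under [RHS]eq_integral do rewrite mul1e.
have /andP[g10 g1y] := ga; rewrite -/(g1 a).
have g1f : g1 a = (fine (g1 a))%:E by rewrite fineK // ge0_fin_numE // ltW.
have f0 : fine (g1 a) != 0 by rewrite gt_eqF // -lte_fin -g1f.
have r0 : (0 <= \int[gauss]_w (r (a, w))%:E)%E.
  by apply: integral_ge0 => w _; rewrite lee_fin cond_density_ge0.
case: (\int[gauss]_w (r (a, w))%:E)%E r0 => [x|//|//] _.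
  rewrite g1f -EFinM => -[] /eqP; rewrite -subr_eq0 -[X in _ - X]mulr1 -mulrBr mulf_eq0.
  by rewrite (negbTE f0) subr_eq0 => /eqP ->.
by rewrite g1f gt0_muley ?lte_fin // lt_neqAle eq_sym f0 fine_ge0 // ltW.
Qed.

(** A probability for every [a]: where the section of [g] has mass zero or infinity, [cond_density]
    is 1 and the law is [gauss]. *)
Definition cond_prob (a : A) : probability RR R :=
  density_prob (measurable_cond_density_section a) (fun w => cond_density_ge0 (a, w))
    (integral_cond_density a).

Lemma cond_probE a B : cond_prob a B = (\int[gauss]_(w in B) (r (a, w))%:E)%E.
Proof. by []. Qed.

Let m := law rho (@measurable_fst _ _ A RR).

Let mE (B : set A) : measurable B -> m B = (\int[alpha]_(a in B) g1 a)%E.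
Proof.
move=> mB; rewrite /m lawE rhoE; last first.
  by rewrite -[X in measurable X]setTI; exact: measurable_fst.
rewrite integral_mkcond fubini_tonelli1 /=.
- rewrite [RHS]integral_mkcond; apply: eq_integral => a _; rewrite /fubini_F patchE.
  case: ifPn => aB.
    by apply: eq_integral => w _; rewrite patchE ifT // inE; rewrite inE in aB.
  rewrite integral0_eq // => w _; rewrite patchE ifF //; apply/negbTE.
  by move: aB; rewrite !notin_setE.
- apply/(measurable_restrictT _ _).1.
    by rewrite -[X in measurable X]setTI; exact: measurable_fst.
  exact: measurable_funTS.
- by move=> z; apply: erestrict_ge0 => ?; rewrite lee_fin.
Qed.

Let g1_int : (\int[alpha]_a g1 a = 1)%E.
Proof. by rewrite -mE // probability_setT. Qed.

Let g1_ge0 a : (0 <= g1 a)%E.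
Proof. by apply: integral_ge0 => w _; rewrite lee_fin. Qed.

Let g1_fin : {ae alpha, forall a, g1 a \is a fin_num}.
Proof.
have ig1 : alpha.-integrable setT g1.
  apply/integrableP; split => //.
  by under eq_integral do rewrite gee0_abs //; rewrite g1_int ltry.
by have := integrable_ae measurableT ig1; apply: filterS => a; apply.
Qed.

Let f1 a := fine (g1 a).

Let mf1 : measurable_fun setT f1.
Proof. exact: measurableT_comp. Qed.

Let f1_ge0 a : 0 <= f1 a.
Proof. exact: fine_ge0. Qed.

Let mE1 (B : set A) : measurable B -> m B = (\int[alpha]_(a in B) (f1 a)%:E)%E.
Proof.
move=> mB; rewrite mE //; apply: ge0_ae_eq_integral => //.
- exact: measurable_funTS.
- by apply: measurable_funTS; exact/measurable_EFinP.
- by move=> a _; rewrite lee_fin.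
- by apply: filterS g1_fin => a ga _; rewrite /f1 fineK.
Qed.

Let cond_integralE a (h : RR -> \bar R) : measurable_fun setT h -> (forall w, 0 <= h w)%E ->
  (\int[cond_prob a]_w h w = \int[gauss]_w (h w * (r (a, w))%:E))%E.
Proof.
move=> mh h0; apply: (ge0_integral_density (measurable_cond_density_section a)) => //.
by move=> w; exact: cond_density_ge0.
Qed.

Let msection (h : A * RR -> \bar R) a : measurable_fun setT h ->
  measurable_fun setT (fun w : RR => h (a, w)).
Proof. by move=> mh; exact: (measurableT_comp mh (measurable_pair1 a)). Qed.

Let mcond_integral (h : A * RR -> \bar R) : measurable_fun setT h ->
  (forall z, 0 <= h z)%E -> measurable_fun setT (fun a => \int[cond_prob a]_w h (a, w))%E.
Proof.
move=> mh h0.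
have -> : (fun a => \int[cond_prob a]_w h (a, w))%E =
    (fun a => \int[gauss]_w (h (a, w) * (r (a, w))%:E))%E.
  by apply/funext => a; apply: (cond_integralE a (h := fun w => h (a, w))) => //; exact: (msection a mh).
apply: (@measurable_fun_fubini_tonelli_F _ _ A RR R gauss (fun z => h z * (r z)%:E)%E).
  apply: emeasurable_funM => //; apply/measurable_EFinP; exact: measurable_cond_density.
by move=> z; rewrite mule_ge0 ?lee_fin ?cond_density_ge0.
Qed.

(** Tonelli's theorem with the section mass [g1] factored out. Sections of infinite mass form an
    [alpha]-null set; on a section of mass zero [g] vanishes almost everywhere, and the default
    conditional law carries weight 0. *)
Lemma disintegration (h : A * RR -> \bar R) : measurable_fun setT h ->
  (forall z, 0 <= h z)%E ->
  (\int[rho]_z h z = \int[m]_a \int[cond_prob a]_w h (a, w))%E.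
Proof.
move=> mh h0.
have mhg : measurable_fun setT (fun z => h z * (g z)%:E)%E by exact: emeasurable_funM.
have hg0 z : (0 <= h z * (g z)%:E)%E by rewrite mule_ge0 ?lee_fin.
rewrite (ge0_integral_density mg g0 rhoE) // fubini_tonelli1 //.
rewrite (ge0_integral_density mf1 f1_ge0 mE1) //; first last.
- exact: (mcond_integral mh h0).
- by move=> a; exact: integral_ge0.
apply: ge0_ae_eq_integral => //.
- exact: (@measurable_fun_fubini_tonelli_F _ _ A RR R gauss).
- by apply: emeasurable_funM; [exact: (mcond_integral mh h0)|exact/measurable_EFinP].
- by move=> a _; exact: integral_ge0.
- by move=> a _; rewrite mule_ge0 ?lee_fin //; exact: integral_ge0.
apply: filterS g1_fin => a ga _; rewrite /fubini_F /f1 fineK // (cond_integralE a (msection a mh)) // muleC.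
have [gd|] := boolP (good a); first by rewrite goodE //; exact: msection.
rewrite negb_and -leNgt => /orP[ga0|]; last by rewrite ltey_eq ga.
have g1a : g1 a = 0%E by apply/eqP; rewrite eq_le ga0 g1_ge0.
rewrite g1a mul0e.
have mga : measurable_fun setT (fun w : RR => (g (a, w))%:E).
  exact: (measurableT_comp mgE (measurable_pair1 a)).
have : (\int[gauss]_w `|(g (a, w))%:E| = 0)%E.
  by under eq_integral do rewrite gee0_abs ?lee_fin //.
move=> /(ae_eq_integral_abs _ measurableT mga) ae0.
rewrite -[RHS](@integral0 _ RR R gauss setT).
apply: ge0_ae_eq_integral => //.
- by apply: emeasurable_funM => //; exact: msection.
- by apply: filterS ae0 => w /(_ I) /= -> _; rewrite mule0.
Qed.

Definition cond_gauss_map (z : A * RR) : R := gauss_map (cond_prob z.1) z.2.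

Lemma measurable_cond_gauss_map : measurable_fun setT cond_gauss_map.
Proof.
apply: (measurableT_comp measurable_PhiInv).
rewrite /cdfr; apply: measurableT_comp => //.
(* Writing the half-line as an indicator in [(z, v)] turns the distribution function into a partial
   integral of a jointly measurable function. *)
pose k (z : (A * RR) * RR) : \bar R := (\1_[set v : RR | (v <= z.1.2)%R] z.2 * r (z.1.1, z.2))%:E.
have -> : (fun z : A * RR => cond_prob z.1 `]-oo, z.2]%classic) =
    (fun z : A * RR => \int[gauss]_v k (z, v))%E.
  apply/funext => z; rewrite cond_probE integral_mkcond; apply: eq_integral => v _.
  by rewrite /k /= patchE indicE; case: ifPn => hv; rewrite ?mul1r ?mul0r.
apply: (@measurable_fun_fubini_tonelli_F _ _ (A * RR)%type RR R gauss k).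
  apply/measurable_EFinP; apply: measurable_funM.
    have -> : (fun x : (A * RR) * RR => \1_[set v : RR | v <= x.1.2] x.2) =
        \1_[set x : (A * RR) * RR | x.2 <= x.1.2] :> (_ -> R).
      by apply/funext => x; rewrite !indicE; congr (nat_of_bool _)%:R; apply/idP/idP; rewrite !inE.
    apply: measurable_indic; rewrite -[X in measurable X]setTI.
    by apply: measurable_fun_le => //; apply: measurableT_comp.
  apply: (measurableT_comp measurable_cond_density).
  by apply: measurable_fun_pair => //; apply: measurableT_comp.
by move=> z; rewrite lee_fin mulr_ge0 ?cond_density_ge0.
Qed.

(** The image law is [gauss] for every value of the past, so the new variable is independent of the
    past. *)
Lemma cond_gauss_map_law (B : set A) (C : set RR) : measurable B -> measurable C ->
  rho ((fst @^-1` B) `&` (cond_gauss_map @^-1` C)) = (rho (fst @^-1` B) * gauss C)%E.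
Proof.
move=> mB mC.
have mB' : measurable (fst @^-1` B : set (A * RR)).
  by rewrite -[X in measurable X]setTI; exact: measurable_fst.
have mC' : measurable (cond_gauss_map @^-1` C).
  by rewrite -[X in measurable X]setTI; exact: measurable_cond_gauss_map.
set S := _ `&` _; have mS : measurable S by exact: measurableI.
have <- : (\int[rho]_z (\1_S z)%:E = rho S)%E by rewrite integral_indic // setIT.
rewrite disintegration //; last by apply/measurable_EFinP; exact: measurable_indic.
have -> : rho (fst @^-1` B) = (\int[m]_a (\1_B a)%:E)%E by rewrite integral_indic // setIT.
rewrite muleC -ge0_integralZl //; last by apply/measurable_EFinP; exact: measurable_indic.
apply: eq_integral => a _.
have mG : measurable (gauss_map (cond_prob a) @^-1` C).
  rewrite -[X in measurable X]setTI.
  apply: (measurable_gauss_map (r := fun w => r (a, w))) => //.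
  exact: measurable_cond_density_section.
rewrite -(@gauss_map_law R (cond_prob a) (fun w => r (a, w))) //; last first.
  exact: measurable_cond_density_section.
rewrite -[_ @^-1` C]setIT -integral_indic //.
rewrite muleC -ge0_integralZl //; last by apply/measurable_EFinP; exact: measurable_indic.
apply: eq_integral => w _; rewrite -EFinM !indicE -natrM; congr (_%:R%:E).
have [aB|aB] := boolP (a \in B); have [wC|wC] := boolP (w \in _ @^-1` C).
- by rewrite (_ : _ \in S) //; apply/mem_set; split; [exact: set_mem aB|exact: set_mem wC].
- by rewrite (_ : (_ \in S) = false) //; apply/negP => /set_mem[_ h]; case/negP: wC; exact/mem_set.
- by rewrite (_ : (_ \in S) = false) //; apply/negP => /set_mem[h _]; case/negP: aB; exact/mem_set.
- by rewrite (_ : (_ \in S) = false) //; apply/negP => /set_mem[h _]; case/negP: aB; exact/mem_set.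
Qed.

(** Since [ln 0] is 0, the logarithm of a product of densities splits into a sum only where the
    factors are positive; the other points are discarded through this fact. *)
Lemma cond_density_gt0 : rho [set z | r z = 0] = 0%E.
Proof.
have mS : measurable [set z | r z = 0].
  rewrite -[X in measurable X]setTI; exact: (measurable_cond_density _ (measurable_set1 0)).
rewrite -[[set _ | _]]setIT -integral_indic // disintegration //; last first.
  by apply/measurable_EFinP; exact: measurable_indic.
rewrite integral0_eq // => a _.
rewrite cond_integralE //; last first.
  by apply: (msection (h := fun z => (\1_[set z | r z = 0] z)%:E)); exact/measurable_EFinP/measurable_indic.
rewrite integral0_eq // => w _; rewrite indicE.
have [|] := boolP ((a, w) \in [set z | r z = 0]); last by rewrite mul0e.
by rewrite inE /= => ->; rewrite mule0.
Qed.

(** From [ln (1/x) <= 1/x - 1]. Integrated against the reference measure it bounds the negative part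
    of each entropy by 1, so that no difference of infinities arises. *)
Lemma funrneg_ln_mul_le1 (x : R) : 0 <= x -> Num.max (- ln x) 0 * x <= 1.
Proof.
move=> x0; have [|h] := leP (- ln x) 0; first by rewrite mul0r.
have {}x0 : 0 < x.
  by move: x0; rewrite le_eqVlt => /predU1P[x0|//]; move: h; rewrite -x0 ln0 // oppr0 ltxx.
rewrite -ler_pdivlMr // mul1r -lnV ?posrE //.
have : ln x^-1 <= x^-1 - 1 by rewrite lerBrDl -[in leRHS](@lnK _ x^-1) ?posrE ?invr_gt0 // expR_ge1Dx.
by move=> /le_trans; apply; rewrite gerBl.
Qed.

Local Notation lnr := (fun z => ln (r z)).

Let mlnr : measurable_fun setT lnr.
Proof. exact: (measurableT_comp (@measurable_ln R) measurable_cond_density). Qed.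

Let mn : measurable_fun setT (EFin \o lnr ^\-).
Proof. by apply/measurable_EFinP; exact: measurable_funrneg. Qed.

Let mp : measurable_fun setT (EFin \o lnr ^\+).
Proof. by apply/measurable_EFinP; exact: measurable_funrpos. Qed.

Let n0 z : (0 <= (lnr ^\- z)%:E)%E.
Proof. by rewrite lee_fin funrneg_ge0. Qed.

Let p0 z : (0 <= (lnr ^\+ z)%:E)%E.
Proof. by rewrite lee_fin funrpos_ge0. Qed.

Lemma cond_entropy_neg_section a : (\int[cond_prob a]_w (lnr ^\- (a, w))%:E <= 1)%E.
Proof.
rewrite (cond_integralE a (msection a mn) (fun w => n0 (a, w))).
have <- : (\int[gauss]_w 1 = 1)%E by rewrite integral_cst // mul1e; exact: probability_setT.
apply: ge0_le_integral => //.
- by move=> w _; rewrite mule_ge0 ?lee_fin ?cond_density_ge0 ?funrneg_ge0.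
- apply: emeasurable_funM; first exact: (msection a mn).
  by apply/measurable_EFinP; exact: measurable_cond_density_section.
move=> w _; rewrite -EFinM lee_fin; exact: funrneg_ln_mul_le1 (cond_density_ge0 _).
Qed.

Lemma cond_entropy_neg_le1 : (\int[rho]_z (lnr ^\- z)%:E <= 1)%E.
Proof.
rewrite disintegration //.
have <- : (\int[m]_a 1 = 1)%E by rewrite integral_cst // mul1e; exact: probability_setT.
apply: ge0_le_integral => //.
- by move=> a _; exact: integral_ge0.
- exact: (mcond_integral mn n0).
- by move=> a _; exact: cond_entropy_neg_section.
Qed.

(** If the positive part of the logarithm is not integrable the right side is infinite; otherwise
    [talagrand_1d] applies. With the negative part on the left the inequality makes sense in both
    cases and can be integrated over the past. *)
Lemma cond_talagrand_section a :
  (\int[cond_prob a]_w ((cond_gauss_map (a, w) - w) ^+ 2)%:E +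
   2%:E * \int[cond_prob a]_w (lnr ^\- (a, w))%:E
   <= 2%:E * \int[cond_prob a]_w (lnr ^\+ (a, w))%:E)%E.
Proof.
set N := (\int[_]_w (lnr ^\- _)%:E)%E; set P := (\int[_]_w (lnr ^\+ _)%:E)%E.
have N1 : (N <= 1)%E by exact: cond_entropy_neg_section.
have N0 : (0 <= N)%E by exact: integral_ge0.
have P0 : (0 <= P)%E by exact: integral_ge0.
have Nf : N \is a fin_num by rewrite ge0_fin_numE // (le_lt_trans N1) // ltry.
have [->|Py] := eqVneq P +oo%E; first by rewrite gt0_muley ?leey // lte_fin.
have Pf : P \is a fin_num by rewrite ge0_fin_numE // ltey.
pose f (w : RR) := ln (r (a, w)).
have mf : measurable_fun setT f.
  exact: (measurableT_comp (@measurable_ln R) (measurable_cond_density_section a)).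
have fi : (cond_prob a).-integrable setT (EFin \o f).
  apply/integrableP; split; first exact/measurable_EFinP.
  rewrite (eq_integral (fun w => (lnr ^\+ (a, w))%:E + (lnr ^\- (a, w))%:E)%E); last first.
    move=> w _; rewrite -EFinD /= /f /funrpos /funrneg; congr EFin.
    set x := ln _; case hx : (0 <= x); first by rewrite ger0_norm // (max_l hx) max_r ?oppr_le0 ?addr0.
    have {}hx : x < 0 by rewrite ltNge hx.
    by rewrite ltr0_norm // (max_r (ltW hx)) max_l ?oppr_ge0 ?ltW // add0r.
  have -> : (\int[cond_prob a]_w ((lnr ^\+ (a, w))%:E + (lnr ^\- (a, w))%:E) = P + N)%E.
    apply: (@ge0_integralD _ _ _ (cond_prob a) setT _ (fun w => (lnr ^\+ (a, w))%:E) (fun w => (lnr ^\- (a, w))%:E)).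
    - exact: measurableT.
    - by move=> w _; exact: p0.
    - exact: (msection a mp).
    - by move=> w _; exact: n0.
    - exact: (msection a mn).
  by rewrite -(fineK Nf) -(fineK Pf) -EFinD ltry.
have := talagrand_1d (measurable_cond_density_section a)
  (fun w => cond_density_ge0 (a, w)) (fun B _ => cond_probE a B) fi.
have -> : \int[cond_prob a]_w ln (r (a, w)) = fine P - fine N.
  rewrite /Rintegral integralE -fineB //; congr (fine (_ - _)).
    by apply: eq_integral => w _; rewrite funeposE /funrpos /= EFin_max.
  by apply: eq_integral => w _; rewrite funenegE /funrneg /= EFin_max.
move=> h; apply: (le_trans (leeD2r _ h)).
rewrite -(fineK Nf) -(fineK Pf) -!EFinM -EFinD lee_fin; lra.
Qed.

Lemma cond_talagrand :
  (\int[rho]_z ((cond_gauss_map z - z.2) ^+ 2)%:E + 2%:E * \int[rho]_z (lnr ^\- z)%:E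
   <= 2%:E * \int[rho]_z (lnr ^\+ z)%:E)%E.
Proof.
have mq : measurable_fun setT (fun z => ((cond_gauss_map z - z.2) ^+ 2)%:E).
  apply/measurable_EFinP; apply: measurable_funX; apply: measurable_funB.
    exact: measurable_cond_gauss_map.
  exact: measurable_snd.
have q0 z : (0 <= ((cond_gauss_map z - z.2) ^+ 2)%:E)%E by rewrite lee_fin sqr_ge0.
rewrite !disintegration // -!ge0_integralZl //; first last.
- by move=> a _; exact: integral_ge0.
- exact: (mcond_integral mn n0).
- by move=> a _; exact: integral_ge0.
- exact: (mcond_integral mp p0).
rewrite -ge0_integralD //; first last.
- by apply: measurable_funeM; exact: (mcond_integral mn n0).
- by move=> a _; rewrite mule_ge0 //; exact: integral_ge0.
- exact: (mcond_integral mq q0).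
- by move=> a _; exact: integral_ge0.
apply: ge0_le_integral => //.
- by move=> a _; rewrite adde_ge0 ?mule_ge0 //; exact: integral_ge0.
- apply: emeasurable_funD; first exact: (mcond_integral mq q0).
  by apply: measurable_funeM; exact: (mcond_integral mn n0).
- by apply: measurable_funeM; exact: (mcond_integral mp p0).
- by move=> a _; exact: cond_talagrand_section.
Qed.

End conditional_density.

(** * The Knothe-Rosenblatt map *)

Section cylinders.
Context {E : Type} {R : realType}.
Local Notation RR := (measurableTypeR R).
Implicit Types (xi : nat -> E -> RR) (B : nat -> set RR).

Definition cyl xi n B : set E := [set y | forall i, (i < n)%N -> B i (xi i y)].

Definition cyls xi n : set (set E) :=
  [set C | exists B, (forall i, measurable (B i)) /\ C = cyl xi n B].

Lemma cylI xi n B B' : cyl xi n B `&` cyl xi n B' = cyl xi n (fun i => B i `&` B' i).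
Proof.
apply/seteqP; split => y /=; first by move=> [h h'] i ilt; split; [exact: h|exact: h'].
by move=> h; split=> i /h[].
Qed.

Lemma setI_closed_cyls xi n : setI_closed (cyls xi n).
Proof.
move=> _ _ [B [mB ->]] [B' [mB' ->]]; rewrite cylI; exists (fun i => B i `&` B' i).
by split => // i; exact: measurableI.
Qed.

Lemma cylsT xi n : cyls xi n setT.
Proof. by exists (fun=> setT); split => //; apply/seteqP; split. Qed.

Lemma cyl0 xi B : cyl xi 0 B = setT.
Proof. by apply/seteqP; split. Qed.

Lemma cylS xi n B : cyl xi n.+1 B = cyl xi n B `&` xi n @^-1` B n.
Proof.
apply/seteqP; split => y /=.
  by move=> h; split=> [i ilt|]; apply: h => //; exact: ltn_trans ilt _.
by move=> [h hn] i; rewrite ltnS leq_eqVlt => /predU1P[->//|/h].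
Qed.

Lemma cyl_widen xi n m B : (n <= m)%N ->
  cyl xi n B = cyl xi m (fun i => if (i < n)%N then B i else setT).
Proof.
move=> nm; apply/seteqP; split => y /= h i ilt; first by case: ifPn => // /h.
by have := h i (leq_trans ilt nm); rewrite ilt.
Qed.

Lemma eq_cyl xi n B B' : (forall i, (i < n)%N -> B i = B' i) -> cyl xi n B = cyl xi n B'.
Proof.
by move=> h; apply/seteqP; split => y /= hy i ilt; [rewrite -h|rewrite h] => //; exact: hy.
Qed.

End cylinders.

Section coordinates.
Context {R : realType}.
Local Notation RR := (measurableTypeR R).

Definition cylG (E : Type) (z : nat -> E -> RR) : set (set E) := \bigcup_n (cyls z n).

Lemma setI_closed_cylG (E : Type) (z : nat -> E -> RR) : setI_closed (cylG z).
Proof.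
move=> A B [n _ [A' [mA ->]]] [m _ [B' [mB ->]]].
rewrite (cyl_widen z A' (leq_maxl n m)) (cyl_widen z B' (leq_maxr n m)).
exists (maxn n m) => //; rewrite cylI; eexists; split; last reflexivity.
by move=> i; apply: measurableI; case: ifP.
Qed.

Lemma cylGT (E : Type) (z : nat -> E -> RR) : cylG z setT.
Proof. by exists 0%N => //; exact: cylsT. Qed.

Lemma measurable_cylG (E : pointedType) (z : nat -> E -> RR) k (B : set RR) : measurable B ->
  measurable (z k @^-1` B : set (g_sigma_algebraType (cylG z))).
Proof.
move=> mB; apply: sub_sigma_algebra; exists k.+1 => //.
exists (fun i => if i == k then B else setT); split; first by move=> i; case: ifP.
apply/seteqP; split => y /=; first by move=> h i ilt; case: eqP => // ->.
by move=> h; have := h k (ltnSn k); rewrite eqxx.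
Qed.

End coordinates.

Lemma prob_eq_generated d (T : measurableType d) (R : realType) (G : set (set T))
  (m1 m2 : {measure set T -> \bar R}) : measurable = <<s G >> -> setI_closed G ->
  G setT -> (m1 setT < +oo)%E -> (forall A, G A -> m1 A = m2 A) ->
  forall A, measurable A -> m1 A = m2 A.
Proof.
move=> mG GI GT moo h; apply: (measure_unique G (fun=> setT)) => //.
by rewrite bigcup_const.
Qed.

Section std_law.
Context {R : realType}.
Local Notation RR := (measurableTypeR R).

(** The Dirac mass is the law of the null coordinates that Gram-Schmidt produces when an evaluation
    depends linearly on earlier ones. *)
Definition std_law (s : bool) (B : set RR) : \bar R := if s then gauss B else \d_(0 : RR) B.

Lemma std_law_ge0 s B : (0 <= std_law s B)%E.
Proof. by rewrite /std_law; case: s. Qed.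

End std_law.

Lemma measurable_fun_lne d (T : measurableType d) (R : realType) (f : T -> \bar R) :
  measurable_fun setT f -> measurable_fun setT (fun x => lne (f x)).
Proof.
move=> mf.
have -> : (fun x => lne (f x)) = (fun x => if (+oo <= f x)%E then +oo%E else
    if (f x <= 0)%E then -oo%E else (ln (fine (f x)))%:E).
  by apply/funext => x; case: (f x) => [r| |] //=; rewrite ?leye_eq ?lee_fin ?leNye.
apply: measurable_fun_ifT => //.
  exact: (@measurable_fun_lee _ _ _ setT (cst +oo%E) f).
apply: measurable_fun_ifT => //.
  exact: (@measurable_fun_lee _ _ _ setT f (cst 0%E)).
apply/measurable_EFinP; apply: (measurableT_comp (@measurable_ln R)).
exact: measurableT_comp.
Qed.

Lemma measurable_cyl d (E : measurableType d) (R : realType)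
  (G : nat -> E -> measurableTypeR R) n B :
  (forall k, (k < n)%N -> measurable_fun setT (G k)) ->
  (forall k, measurable (B k)) -> measurable (cyl G n B).
Proof.
move=> mG mB; elim: n => [|n ih] in mG *; first by rewrite cyl0.
rewrite cylS; apply: measurableI => //; last by rewrite -[X in measurable X]setTI; exact: mG.
by apply: ih => k kn; apply: mG; exact: ltn_trans kn _.
Qed.

(** * Relative entropy and Gibbs' inequality *)

Section entropy.
Context d {E : measurableType d} {R : realType}.

(** Exchanges the extended-valued derivative of the definition for a real density. The two agree
    [mu]-almost everywhere, hence [nu]-almost everywhere by absolute continuity. *)
Lemma relative_entropyE (nu mu : probability E R) : nu `<< mu -> exists f : E -> R,
  [/\ measurable_fun setT f, forall x, 0 <= f x,
      forall A, measurable A -> nu A = (\int[mu]_(x in A) (f x)%:E)%E &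
      relative_entropy nu mu = (\int[nu]_x (ln (f x))%:E)%E].
Proof.
move=> numu; pose F := Radon_Nikodym_SigmaFinite.f nu mu.
have Ff x : (F x = (fine (F x))%:E)%E by rewrite fineK // Radon_Nikodym_SigmaFinite.f_fin_num.
have mF : measurable_fun setT F.
  exact: measurable_int (Radon_Nikodym_SigmaFinite.f_integrable numu).
have mf : measurable_fun setT (fine \o F) by exact: measurableT_comp.
have f0 x : 0 <= fine (F x) by rewrite fine_ge0 // Radon_Nikodym_SigmaFinite.f_ge0.
have nuE A : measurable A -> nu A = (\int[mu]_(x in A) (fine (F x))%:E)%E.
  move=> mA; rewrite (Radon_Nikodym_SigmaFinite.f_integral numu) //.
  by apply: eq_integral => x _; rewrite -Ff.
exists (fine \o F); split => //.
rewrite /relative_entropy; case: pselect => // h.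
apply: ae_eq_integral => //.
- apply: measurable_fun_lne.
  exact/measurable_int/Radon_Nikodym_integrable.
- by apply/measurable_EFinP; exact: (measurableT_comp (@measurable_ln R)).
have h1 : ae_eq nu setT F (Radon_Nikodym (charge_of_finite_measure nu) mu).
  have [A [mA A0 hA]] := ae_eq_Radon_Nikodym_SigmaFinite h measurableT.
  by exists A; split => //; move/null_content_dominatesP : h; exact.
have mF0 : measurable [set x | F x = 0%E].
  by rewrite -[X in measurable X]setTI; exact: (mF measurableT _ (emeasurable_set1 0%E)).
(* On the zero set of the density [lne] is [-oo] and [ln] is 0, but that set has no [nu]-mass. *)
have h2 : {ae nu, forall x, F x != 0%E}.
  exists [set x | F x = 0%E]; split.
  - exact: mF0.
  - rewrite nuE //.
    by apply: integral0_eq => x /= ->.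
  - by move=> x /= /negP; rewrite negbK => /eqP.
apply: filterS2 h1 h2 => x h1 h2 _; rewrite -h1 // Ff /=.
rewrite leNgt lt_neqAle f0 andbT; case: eqP => //= h3.
by case/eqP: h2; rewrite Ff -h3.
Qed.

Lemma relative_entropy_neg (nu mu : probability E R) (f : E -> R) :
  measurable_fun setT f -> (forall x, 0 <= f x) ->
  (forall A, measurable A -> nu A = (\int[mu]_(x in A) (f x)%:E)%E) ->
  (\int[nu]_x ((fun y => ln (f y)) ^\- x)%:E <= 1)%E.
Proof.
move=> mf f0 nuE.
have mn : measurable_fun setT (EFin \o (fun y => ln (f y)) ^\-).
  apply/measurable_EFinP; apply: measurable_funrneg.
  exact: (measurableT_comp (@measurable_ln R) mf).
rewrite (ge0_integral_density mf f0 nuE) //; last by move=> x; rewrite lee_fin funrneg_ge0.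
have <- : (\int[mu]_w 1 = 1)%E by rewrite integral_cst // mul1e; exact: probability_setT.
apply: ge0_le_integral => //.
- by move=> x _; rewrite mule_ge0 ?lee_fin ?funrneg_ge0.
- by apply: emeasurable_funM => //; exact/measurable_EFinP.
- by move=> x _; rewrite -EFinM lee_fin; exact: funrneg_ln_mul_le1.
Qed.

Lemma ln_prod (x : nat -> R) n : (forall i, (i < n)%N -> 0 < x i) ->
  ln (\prod_(i < n) x i) = \sum_(i < n) ln (x i).
Proof.
elim: n => [|n ih] x0; first by rewrite !big_ord0 ln1.
have x0' i : (i < n)%N -> 0 < x i by move=> ilt; apply: x0; exact: ltn_trans ilt _.
rewrite !big_ord_recr /= lnM ?ih ?posrE ?x0 //.
by apply: prodr_gt0 => i _; exact: x0'.
Qed.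

(** A one-sided chain rule: with [Q] the product of the [r i] and [f] the density of [nu], the ratio
    [h = Q / f] has [nu]-integral at most 1, and integrating [ln h <= h - 1] bounds the integral of
    [ln Q] by the entropy. Positive and negative parts sit on separate sides because the positive
    ones may be infinite. *)
Lemma gibbs (nu mu : probability E R) (r : nat -> E -> R) n : nu `<< mu ->
  (forall k, measurable_fun setT (r k)) -> (forall k y, 0 <= r k y) ->
  (forall k, nu [set y | r k y = 0] = 0%E) ->
  (forall k, \int[nu]_y ((fun y => ln (r k y)) ^\- y)%:E <= 1)%E ->
  (\int[mu]_y (\prod_(i < n) r i y)%:E <= 1)%E ->
  (\sum_(i < n) \int[nu]_y ((fun y => ln (r i y)) ^\+ y)%:E <=
   relative_entropy nu mu + \sum_(i < n) \int[nu]_y ((fun y => ln (r i y)) ^\- y)%:E)%E.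
Proof.
move=> numu mr r0 rz rn rint.
have [f [mf f0 nuE ->]] := relative_entropyE numu.
have fneg := relative_entropy_neg mf f0 nuE.
pose Q y := \prod_(i < n) r i y.
have Q0 y : 0 <= Q y by rewrite prodr_ge0.
have mQ : measurable_fun setT Q by apply: measurable_prod => i _; exact: mr.
have mlnf : measurable_fun setT (fun y => ln (f y)).
  exact: (measurableT_comp (@measurable_ln R) mf).
have mlnr k : measurable_fun setT (fun y => ln (r k y)).
  exact: (measurableT_comp (@measurable_ln R) (mr k)).
(* [expR (- ln (f y))] is the inverse of [f y] where [f] is positive, and 1 elsewhere. *)
pose h y := Q y * expR (- ln (f y)).
have h0 y : 0 <= h y by rewrite mulr_ge0 ?expR_ge0.
have mh : measurable_fun setT h.
  by apply: measurable_funM => //; apply: measurableT_comp => //; exact: measurableT_comp.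
have hint : (\int[nu]_y (h y)%:E <= 1)%E.
  apply: le_trans rint.
  rewrite (ge0_integral_density mf f0 nuE); first last.
  - exact/measurable_EFinP.
  - exact: measurableT.
  - by move=> y; rewrite lee_fin.
  apply: ge0_le_integral => //.
  - by move=> y _; rewrite mule_ge0 ?lee_fin.
  - by apply: emeasurable_funM; exact/measurable_EFinP.
  - exact/measurable_EFinP.
  move=> y _; rewrite -EFinM lee_fin /h -mulrA ler_piMr //.
  have := f0 y; rewrite le_eqVlt => /predU1P[<-|fy]; first by rewrite mulr0.
  by rewrite expRN lnK ?posrE // mulVf // gt_eqF.
pose lp k := (fun y => ln (r k y)) ^\+; pose ln_ k := (fun y => ln (r k y)) ^\-.
pose fp := (fun y => ln (f y)) ^\+; pose fn := (fun y => ln (f y)) ^\-.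
(* This is [ln h <= h - 1] with every negative part moved across. *)
have pw y : f y != 0 -> (forall i, (i < n)%N -> r i y != 0) ->
    (\sum_(i < n) lp i y) + fn y + 1 <= fp y + h y + \sum_(i < n) ln_ i y.
  move=> fy ry.
  have rpn (x : R) : Num.max x 0 - Num.max (- x) 0 = x.
    by case: (leP x 0) => hx; case: (leP (- x) 0) => hx'; lra.
  have -> : \sum_(i < n) lp i y = \sum_(i < n) ln_ i y + ln (Q y).
    have -> : ln (Q y) = \sum_(i < n) ln (r i y).
      by apply: (@ln_prod (fun i => r i y)) => i ilt; rewrite lt_neqAle eq_sym ry ?r0.
    rewrite -big_split /=; apply: eq_bigr => i _; rewrite /lp /ln_ /funrpos /funrneg.
    by have := rpn (ln (r i y)); lra.
  have Qy : 0 < Q y.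
    by apply: prodr_gt0 => i _; rewrite lt_neqAle eq_sym ry ?r0.
  have {}fy : 0 < f y by rewrite lt_neqAle eq_sym fy f0.
  have := rpn (ln (f y)); rewrite -/(fp y) -/(fn y) => fpn.
  have : ln (h y) <= h y - 1.
    by rewrite lerBrDl -[in leRHS](@lnK _ (h y)) ?expR_ge1Dx // posrE mulr_gt0 ?expR_gt0.
  rewrite {1}/h lnM ?posrE ?expR_gt0 // expRK.
  have : fp y - fn y = ln (f y) by [].
  lra.
have lp0 k y : (0 <= (lp k y)%:E)%E by rewrite lee_fin /lp funrpos_ge0.
have ln0' k y : (0 <= (ln_ k y)%:E)%E by rewrite lee_fin /ln_ funrneg_ge0.
have fp0 y : (0 <= (fp y)%:E)%E by rewrite lee_fin /fp funrpos_ge0.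
have fn0 y : (0 <= (fn y)%:E)%E by rewrite lee_fin /fn funrneg_ge0.
have mlp k : measurable_fun setT (EFin \o lp k).
  by apply/measurable_EFinP; exact: measurable_funrpos.
have mln k : measurable_fun setT (EFin \o ln_ k).
  by apply/measurable_EFinP; exact: measurable_funrneg.
have mfp : measurable_fun setT (EFin \o fp) by apply/measurable_EFinP; exact: measurable_funrpos.
have mfn : measurable_fun setT (EFin \o fn) by apply/measurable_EFinP; exact: measurable_funrneg.
have I1 : (\int[nu]_y (\sum_(i < n) lp i y + fn y + 1)%:E =
   \sum_(i < n) \int[nu]_y (lp i y)%:E + \int[nu]_y (fn y)%:E + 1)%E.
  under eq_integral do rewrite !EFinD -sumEFin.
  rewrite ge0_integralD //.
  - rewrite ge0_integralD //; last by apply: emeasurable_sum => i; exact: mlp.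
      rewrite ge0_integral_sum //; last by move=> i; exact: mlp.
      by congr (_ + _)%E; rewrite integral_cst // mul1e; exact: probability_setT.
    by move=> y _; exact: sume_ge0.
  - by move=> y _; rewrite adde_ge0 //; exact: sume_ge0.
  - by apply: emeasurable_funD => //; apply: emeasurable_sum => i; exact: mlp.
have I2 : (\int[nu]_y (fp y + h y + \sum_(i < n) ln_ i y)%:E =
   \int[nu]_y (fp y)%:E + \int[nu]_y (h y)%:E + \sum_(i < n) \int[nu]_y (ln_ i y)%:E)%E.
  under eq_integral do rewrite !EFinD -sumEFin.
  have mhE : measurable_fun setT (EFin \o h) by exact/measurable_EFinP.
  have h0E y : (0 <= (h y)%:E)%E by rewrite lee_fin.
  rewrite ge0_integralD //.
  - by rewrite ge0_integralD // ge0_integral_sum // => i; exact: mln.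
  - by move=> y _; rewrite adde_ge0.
  - by apply: emeasurable_funD.
  - by move=> y _; exact: sume_ge0.
  - by apply: emeasurable_sum => i; exact: mln.
have : (\int[nu]_y (\sum_(i < n) lp i y + fn y + 1)%:E <=
    \int[nu]_y (fp y + h y + \sum_(i < n) ln_ i y)%:E)%E.
  apply: ae_ge0_le_integral => //.
  - move=> y _; rewrite lee_fin !addr_ge0 ?sumr_ge0 // => [i _|]; first by rewrite -lee_fin.
    by rewrite -lee_fin.
  - apply/measurable_EFinP; apply: measurable_funD => //; apply: measurable_funD.
      by apply: measurable_sum => i; exact/measurable_EFinP.
    exact/measurable_EFinP.
  - move=> y _; rewrite lee_fin !addr_ge0 ?sumr_ge0 // => [|i _]; last by rewrite -lee_fin.
    by rewrite -lee_fin.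
  - apply/measurable_EFinP; apply: measurable_funD => //.
      by apply: measurable_funD => //; exact/measurable_EFinP.
    by apply: measurable_sum => i; exact/measurable_EFinP.
  have aez (g : E -> R) : measurable_fun setT g -> nu [set y | g y = 0] = 0%E ->
      {ae nu, forall y, g y != 0}.
    move=> mg g0; exists [set y | g y = 0]; split => //.
      by rewrite -[X in measurable X]setTI; exact: (mg measurableT _ (measurable_set1 0)).
    by move=> y /= /negP; rewrite negbK => /eqP.
  have aer : {ae nu, forall y, forall i, (i < n)%N -> r i y != 0}.
    by apply/ae_foralln => k; apply: filterS (aez _ (mr k) (rz k)) => y h1 _.
  have aef : {ae nu, forall y, f y != 0}.
    apply: aez => //; rewrite nuE.
      by apply: integral0_eq => x /= ->.
    by rewrite -[X in measurable X]setTI; exact: (mf measurableT _ (measurable_set1 0)).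
  by apply: filterS2 aer aef => y h1 h2 _; rewrite lee_fin; exact: pw.
rewrite I1 I2 => LE.
have -> : (\int[nu]_x (ln (f x))%:E = \int[nu]_y (fp y)%:E - \int[nu]_y (fn y)%:E)%E.
  rewrite integralE; congr (_ - _)%E.
    by apply: eq_integral => w _; rewrite funeposE /fp /funrpos /= EFin_max.
  by apply: eq_integral => w _; rewrite funenegE /fn /funrneg /= EFin_max.
have FN : (\int[nu]_y (fn y)%:E <= 1)%E by [].
move: LE; rewrite -/(lp _); set P := (\sum_(i < n) _)%E; set N := (\sum_(i < n) _)%E.
have P0 : (0 <= P)%E by apply: sume_ge0 => i _; exact: integral_ge0.
have N0 : (0 <= N)%E by apply: sume_ge0 => i _; exact: integral_ge0.
have Nf : N \is a fin_num.
  rewrite ge0_fin_numE // /N.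
  by apply: lte_sum_pinfty => i _; exact: le_lt_trans (rn i) (ltry _).
have FP0 : (0 <= \int[nu]_y (fp y)%:E)%E by exact: integral_ge0.
have FN0 : (0 <= \int[nu]_y (fn y)%:E)%E by exact: integral_ge0.
have H0 : (0 <= \int[nu]_y (h y)%:E)%E by apply: integral_ge0 => y _; rewrite lee_fin.
have FNf : (\int[nu]_y (fn y)%:E)%E \is a fin_num by rewrite ge0_fin_numE // (le_lt_trans FN) // ltry.
have Hf : (\int[nu]_y (h y)%:E)%E \is a fin_num by rewrite ge0_fin_numE // (le_lt_trans hint) // ltry.
move: hint; rewrite -(fineK Nf) -(fineK FNf) -(fineK Hf).
case: (\int[nu]_y (fp y)%:E)%E FP0 => [a _||//]; last by move=> *; rewrite /= leey.
by case: P P0 => [p _||] //; rewrite ?lee_fin; lra.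
Qed.

End entropy.

(** Hides the construction behind the properties that the induction consumes; the first factor is
    going to be the past of the coordinates. *)
Lemma conditional_transport d (A : measurableType d) (R : realType)
  (alpha : probability A R) (rho : probability (A * measurableTypeR R)%type R) :
  rho `<< (alpha \x gauss)%E -> exists (G r : A * measurableTypeR R -> R),
  [/\ measurable_fun setT G,
      measurable_fun setT r /\ (forall z, 0 <= r z),
      forall B C, measurable B -> measurable C ->
        rho ((fst @^-1` B) `&` (G @^-1` C)) = (rho (fst @^-1` B) * gauss C)%E,
      forall a, (\int[gauss]_w (r (a, w))%:E = 1)%E &
      [/\ rho [set z | r z = 0] = 0%E,
          (\int[rho]_z ((fun y => ln (r y)) ^\- z)%:E <= 1)%E &
          (\int[rho]_z ((G z - z.2) ^+ 2)%:E
            + 2%:E * \int[rho]_z ((fun y => ln (r y)) ^\- z)%:E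
          <= 2%:E * \int[rho]_z ((fun y => ln (r y)) ^\+ z)%:E)%E]].
Proof.
move=> rhodom; have [g [mg g0 rhoE]] := density_exists rhodom.
exists (cond_gauss_map mg g0), (cond_density g); split.
- exact: measurable_cond_gauss_map.
- by split; [exact: measurable_cond_density|exact: cond_density_ge0].
- exact: cond_gauss_map_law rhoE.
- exact: integral_cond_density.
- split; [exact: cond_density_gt0 rhoE|exact: cond_entropy_neg_le1 rhoE|].
  exact: cond_talagrand rhoE.
Qed.

Section rosenblatt.
Context d {E : measurableType d} {R : realType}.
Local Notation RR := (measurableTypeR R).
Variables (mu nu : probability E R) (sg : nat -> bool) (xi : nat -> E -> RR).
Hypotheses (numu : nu `<< mu) (mxi : forall k, measurable_fun setT (xi k)).
Hypothesis xi0 : forall k, ~~ sg k -> xi k = cst 0.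

Definition std_family (P : probability E R) (G : nat -> E -> RR) : Prop :=
  forall n (B : nat -> set RR), (forall k, measurable (B k)) ->
    P (cyl G n B) = (\prod_(i < n) std_law (sg i) (B i))%E.

Hypothesis ind : std_family mu xi.

(* the past of [xi] before time [n], as a measurable type carried by [E] *)
Local Notation past n := (g_sigma_algebraType (cyls xi n)).

Let idp n (y : E) : past n := y.

Let measurable_idp n : measurable_fun setT (idp n).
Proof.
apply: (@measurability _ _ _ (past n) setT (idp n) (cyls xi n)) => // _ [_ [B [mB ->]] <-].
by rewrite setTI; exact: measurable_cyl.
Qed.

Let measurable_past n m : (n <= m)%N -> measurable_fun (setT : set (past m)) (idp n).
Proof.
move=> nm; apply: (@measurability _ _ (past m) (past n) setT (idp n) (cyls xi n)) => // _ [_ [B [mB ->]] <-].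
rewrite setTI; apply: sub_sigma_algebra.
rewrite (cyl_widen _ _ nm); eexists; split; last reflexivity.
by move=> i /=; case: ifP.
Qed.

Let measurable_xi_past n m : (n < m)%N ->
  measurable_fun (setT : set (past m)) (xi n).
Proof.
move=> nm _ B mB; rewrite setTI; apply: sub_sigma_algebra.
exists (fun i => if i == n then B else setT); split; first by move=> i; case: ifP.
apply/seteqP; split => y /=; first by move=> h i ilt; case: eqP => // ->.
by move=> h; have := h n nm; rewrite eqxx.
Qed.

Let joint n (y : E) : past n * RR := (idp n y, xi n y).

Let mjoint n : measurable_fun setT (joint n).
Proof. exact: (measurable_fun_pair (@measurable_idp n) (mxi n)). Qed.

Let mjoint_past n m : (n < m)%N -> measurable_fun (setT : set (past m)) (joint n).
Proof.
by move=> nm; apply: measurable_fun_pair; [apply: measurable_past; exact: ltnW|exact: measurable_xi_past].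
Qed.

Let alpha n := law mu (@measurable_idp n).

(** Both sides are finite measures in [A] that agree on the cylinders of the past, a generating
    pi-system. *)
Let indep n (A : set (past n)) (B : set RR) : measurable A -> measurable B ->
  mu (A `&` xi n @^-1` B) = (mu A * std_law (sg n) B)%E.
Proof.
move=> mA mB.
have mXB : measurable (xi n @^-1` B) by rewrite -[X in measurable X]setTI; exact: mxi.
have fB : std_law (sg n) B = (fine (std_law (sg n) B))%:E.
  rewrite fineK // ge0_fin_numE ?std_law_ge0 // /std_law; case: (sg n).
    exact: (le_lt_trans (probability_le1 _ mB) (ltry _)).
  by rewrite diracE ltry.
have c0 : 0 <= fine (std_law (sg n) B) by rewrite fine_ge0 ?std_law_ge0.
pose c := NngNum c0.
rewrite muleC fB.
pose m1 : {measure set (past n) -> \bar R} := pushforward (mrestr mu mXB) (idp n).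
pose m2 : {measure set (past n) -> \bar R} := mscale c (alpha n).
apply: (@prob_eq_generated _ (past n) _ (cyls xi n) (m1 (@measurable_idp n)) m2) => //.
- exact: setI_closed_cyls.
- exact: cylsT.
- have : (mu (setT `&` xi n @^-1` B) <= 1)%E by apply: probability_le1; exact: measurableI.
  by move/le_lt_trans; apply; exact: ltry.
move=> _ [B' [mB' ->]].
rewrite -[m1 _ _]/(mu (cyl xi n B' `&` xi n @^-1` B)).
rewrite -[m2 _]/((fine (std_law (sg n) B))%:E * mu (cyl xi n B'))%E.
pose B2 i := if i == n then B else B' i.
have -> : cyl xi n B' `&` xi n @^-1` B = cyl xi n.+1 B2.
  rewrite cylS /B2 eqxx; congr (_ `&` _); apply: eq_cyl => i ilt.
  by rewrite ltn_eqF.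
have -> : cyl xi n B' = cyl xi n B2.
  by apply: eq_cyl => i ilt; rewrite /B2 ltn_eqF.
have mB2 k : measurable (B2 k) by rewrite /B2; case: ifP.
by rewrite !ind // big_ord_recr /= {2}/B2 eqxx -fB muleC.
Qed.

Let joint_law n : sg n -> forall C, measurable C ->
  law mu (@mjoint n) C = (alpha n \x gauss)%E C.
Proof.
move=> sn C mC; apply/esym.
apply: (@product_measure_unique _ _ _ _ _ (alpha n) (@gauss R) (law mu (@mjoint n))) => // A B mA mB.
have := indep mA mB; rewrite sn => h; exact: h.
Qed.

(** [GR.1] is the new standard coordinate and [GR.2] the conditional density under [nu] of [xi k]
    given the past, relative to its law under [mu]. Both depend on the coordinates up to [k] only,
    and this triangular structure lets the steps be composed. The fourth property says that the
    conditional density integrates to 1 given the past. For a null coordinate the choice is 0 with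
    density 1. *)
Lemma rosenblatt_step k : exists GR : (E -> R) * (E -> R),
  [/\ measurable_fun (setT : set (past k.+1)) (GR.1 : _ -> RR),
      measurable_fun (setT : set (past k.+1)) GR.2 /\ (forall y, 0 <= GR.2 y),
      forall (A : set (past k)) (C : set RR), measurable A -> measurable C ->
        nu (A `&` GR.1 @^-1` C) = (nu A * std_law (sg k) C)%E,
      forall Q : past k -> \bar R, measurable_fun setT Q -> (forall y, 0 <= Q y)%E ->
        (\int[mu]_y (Q y * (GR.2 y)%:E) = \int[mu]_y Q y)%E &
      [/\ nu [set y | GR.2 y = 0] = 0%E,
          (\int[nu]_y ((fun y => ln (GR.2 y)) ^\- y)%:E <= 1)%E &
          (\int[nu]_y ((GR.1 y - xi k y) ^+ 2)%:E
            + 2%:E * \int[nu]_y ((fun y => ln (GR.2 y)) ^\- y)%:E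
          <= 2%:E * \int[nu]_y ((fun y => ln (GR.2 y)) ^\+ y)%:E)%E]].
Proof.
have [sk|sk] := boolP (sg k); last first.
  exists (cst 0, cst 1); split => /=.
  - exact: measurable_cst.
  - by split => // y.
  - move=> A C mA mC; rewrite diracE.
    rewrite preimage_cst; case: ifPn => _; first by rewrite setIT mule1.
    by rewrite setI0 measure0 mule0.
  - by move=> Q mQ Q0; under eq_integral do rewrite mule1.
  - split.
    + by rewrite (_ : [set _ | _] = set0) ?measure0 // -subset0 => y /= /eqP; rewrite oner_eq0.
    + rewrite integral0_eq // => y _.
      by rewrite /funrneg /= ln1 oppr0 maxxx.
    + rewrite xi0 // integral0_eq ?add0e; last by move=> y _; rewrite subrr expr0n.
      by rewrite !integral0_eq // => y _; rewrite /funrneg /funrpos ln1 ?oppr0 maxxx.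
pose rho := law nu (@mjoint k).
have rhodom : rho `<< (alpha k \x gauss)%E.
  apply/null_content_dominatesP => C mC C0.
  move/null_content_dominatesP : numu; apply.
    by rewrite -[X in measurable X]setTI; exact: mjoint.
  exact: (etrans (joint_law sk mC) C0).
have [G [r [mG [mr r0] GL r1 [rz rn rG]]]] := conditional_transport rhodom.
exists (fun y => G (joint k y), fun y => r (joint k y)); split.
- by apply: measurableT_comp => //; exact: mjoint_past.
- by split => /= [|y]; [apply: measurableT_comp => //; exact: mjoint_past|exact: r0].
- by move=> A C mA mC; exact: (GL A C mA mC).
- move=> Q mQ Q0 /=.
  have mQr : measurable_fun setT (fun z : past k * RR => (Q z.1 * (r z)%:E)%E).
    apply: emeasurable_funM; last exact/measurable_EFinP.
    by apply: measurableT_comp => //; exact: measurable_fst.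
  have Qr0 (z : past k * RR) : (0 <= Q z.1 * (r z)%:E)%E by rewrite mule_ge0 // lee_fin.
  rewrite -[LHS](ge0_integral_law mu (@mjoint k) mQr Qr0).
  rewrite (eq_measure_integral (alpha k \x gauss)%E); last by move=> C mC _; exact: joint_law.
  rewrite fubini_tonelli1 // -[RHS](ge0_integral_law mu (@measurable_idp k) mQ Q0).
  apply: eq_integral => a _; rewrite /fubini_F /= ge0_integralZl //.
  + by rewrite r1 mule1.
  + by apply/measurable_EFinP; exact: (measurableT_comp mr (measurable_pair1 a)).
  + by move=> w _; rewrite lee_fin.
have nint (h : past k * RR -> \bar R) : measurable_fun setT h -> (forall z, 0 <= h z)%E ->
  (\int[rho]_z h z = \int[nu]_y h (joint k y))%E.
  by move=> mh h0; exact: ge0_integral_law.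
have mln : measurable_fun setT (fun z => ln (r z)).
  exact: (measurableT_comp (@measurable_ln R) mr).
split => /=.
- exact: rz.
- move: rn; rewrite nint //; last first.
    by move=> z; rewrite lee_fin funrneg_ge0.
  by apply/measurable_EFinP; exact: measurable_funrneg.
- move: rG; rewrite !nint //.
  + by apply/measurable_EFinP; exact: measurable_funrpos.
  + by move=> z; rewrite lee_fin funrpos_ge0.
  + by apply/measurable_EFinP; exact: measurable_funrneg.
  + by move=> z; rewrite lee_fin funrneg_ge0.
  + by apply/measurable_EFinP; apply: measurable_funX; exact: measurable_funB.
  + by move=> z; rewrite lee_fin sqr_ge0.
Qed.

(** Adaptedness turns one-step independence into the joint law by induction. The conditional
    Talagrand bounds add up to twice the conditional entropies, which [gibbs] compares with the full
    one; the negative parts are finite and cancel. *)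
Theorem rosenblatt : exists G : nat -> E -> RR,
  [/\ forall k, measurable_fun setT (G k), std_family nu G &
      forall n, (\sum_(i < n) \int[nu]_y ((G i y - xi i y) ^+ 2)%:E
        <= 2%:E * relative_entropy nu mu)%E].
Proof.
have [GR hGR] := choice rosenblatt_step.
pose G k := (GR k).1; pose r k := (GR k).2.
have mGp i n : (i < n)%N -> measurable_fun (setT : set (past n)) (G i : _ -> RR).
  move=> ilt; have [h _ _ _ _] := hGR i.
  by have := measurableT_comp h (measurable_past ilt); exact.
have mrp i n : (i < n)%N -> measurable_fun (setT : set (past n)) (r i).
  move=> ilt; have [_ [h _] _ _ _] := hGR i.
  by have := measurableT_comp h (measurable_past ilt); exact.
have mG k : measurable_fun setT (G k).
  by have := measurableT_comp (mGp k k.+1 (ltnSn k)) (@measurable_idp k.+1); exact.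
have mr k : measurable_fun setT (r k).
  by have := measurableT_comp (mrp k k.+1 (ltnSn k)) (@measurable_idp k.+1); exact.
have r0 k y : 0 <= r k y by have [_ [_ h] _ _ _] := hGR k; exact: h.
exists G; split => //.
  elim=> [|n ih] B mB; first by rewrite cyl0 big_ord0 probability_setT.
  rewrite cylS big_ord_recr /= -ih //; have [_ _ h _ _] := hGR n.
  apply: (h (cyl G n B)) => //.
  by apply: (@measurable_cyl _ (past n)) => // k kn; exact: mGp.
move=> n.
(* The product of the conditional densities has [mu]-integral 1: the last factor is integrated out
   first. *)
have Qint : (\int[mu]_y (\prod_(i < n) r i y)%:E <= 1)%E.
  suff -> : (\int[mu]_y (\prod_(i < n) r i y)%:E = 1)%E by [].
  elim: n => [|n ih].
    under eq_integral do rewrite big_ord0.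
    by rewrite integral_cst // mul1e; exact: probability_setT.
  rewrite -ih; under eq_integral do rewrite big_ord_recr EFinM.
  have [_ _ _ h _] := hGR n.
  apply: (h (fun y => (\prod_(i < n) r i y)%:E)).
    apply/measurable_EFinP; apply: measurable_prod => i _.
    by apply: mrp; exact: ltn_ord.
  by move=> y; rewrite lee_fin prodr_ge0.
have hz k : nu [set y | r k y = 0] = 0%E by have [_ _ _ _ []] := hGR k.
have hn k : (\int[nu]_y ((fun y => ln (r k y)) ^\- y)%:E <= 1)%E.
  by have [_ _ _ _ []] := hGR k.
have := gibbs numu mr r0 hz hn Qint.
set P := (\sum_(i < n) _)%E; set N := (\sum_(i < n) _)%E; set S := (\sum_(i < n) _)%E.
move=> hP.
have N0 : (0 <= N)%E.
  by apply: sume_ge0 => i _; apply: integral_ge0 => y _; rewrite lee_fin funrneg_ge0.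
have Nf : N \is a fin_num.
  rewrite ge0_fin_numE // /N.
  by apply: lte_sum_pinfty => i _; exact: le_lt_trans (hn i) (ltry _).
have : (S + 2%:E * N <= 2%:E * P)%E.
  rewrite /S /N /P !ge0_sume_distrr; first last.
  - by move=> i _; apply: integral_ge0 => y _; rewrite lee_fin funrneg_ge0.
  - by move=> i _; apply: integral_ge0 => y _; rewrite lee_fin funrpos_ge0.
  rewrite -big_split /=; apply: lee_sum => i _.
  by have [_ _ _ _ []] := hGR i.
have h2 : (2%:E * P <= 2%:E * (relative_entropy nu mu + N))%E by rewrite lee_wpmul2l // lee_fin.
move=> h; have {}h := le_trans h h2.
have [->|Hoo] := eqVneq (relative_entropy nu mu) +oo%E; first by rewrite gt0_muley ?leey // lte_fin.
have S0 : (0 <= S)%E.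
  by apply: sume_ge0 => i _; apply: integral_ge0 => y _; rewrite lee_fin sqr_ge0.
move: h S0; rewrite -(fineK Nf).
case: (relative_entropy nu mu) Hoo => [a _|//|_]; last by rewrite addNye gt0_muleNy ?lte_fin //; case: S.
by case: S => [b||] //=; rewrite ?lee_fin; lra.
Qed.

End rosenblatt.

(** * Characteristic functions and independence *)

Lemma indic01 (T : Type) (R : realType) (A : set T) x : 0 <= (\1_A x : R) <= 1.
Proof. by rewrite indicE ler0n lern1 leq_b1. Qed.

Section bounded.
Context d {T : measurableType d} {R : realType}.

Lemma prob_bounded_integrable (P : probability T R) (f : T -> R) (M : R) :
  measurable_fun setT f -> (forall x, `|f x| <= M) -> P.-integrable setT (EFin \o f).
Proof.
move=> mf fM; apply: measurable_bounded_integrable => //.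
  by rewrite (le_lt_trans (probability_le1 P measurableT)) // ltry.
exists M; split; first exact: num_real.
by move=> N MN x _ /=; rewrite (le_trans (fM x)) // ltW.
Qed.

Lemma Rintegral_EFin (P : {measure set T -> \bar R}) (f : T -> R) :
  P.-integrable setT (EFin \o f) -> (\int[P]_x (f x)%:E)%E = (\int[P]_x f x)%:E.
Proof. by move=> fi; rewrite /Rintegral fineK //; exact: integrable_fin_num. Qed.

End bounded.

Lemma Rintegral_Fubini d1 d2 (T1 : measurableType d1) (T2 : measurableType d2) (R : realType)
  (P1 : probability T1 R) (P2 : probability T2 R) (f : T1 * T2 -> R) (M : R) :
  measurable_fun setT f -> (forall z, `|f z| <= M) ->
  \int[P1]_x \int[P2]_y f (x, y) = \int[P2]_y \int[P1]_x f (x, y).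
Proof.
move=> mf fM.
have i2 x : P2.-integrable setT (EFin \o (fun y => f (x, y))).
  apply: (@prob_bounded_integrable _ _ _ _ _ M) => //.
  exact: (measurableT_comp mf (measurable_pair1 x)).
have i1 y : P1.-integrable setT (EFin \o (fun x => f (x, y))).
  apply: (@prob_bounded_integrable _ _ _ _ _ M) => //.
  exact: (measurableT_comp mf (measurable_pair2 y)).
have ip : (P1 \x P2)%E.-integrable setT (EFin \o f).
  apply: (measurable_bounded_integrable (mu := (P1 \x P2)%E)) => //.
    have -> : [set: T1 * T2] = setT `*` setT by apply/seteqP; split.
    apply: (@le_lt_trans _ _ 1%E); last exact: ltry.
    have := @product_measure1E _ _ _ _ _ P1 P2 setT setT measurableT measurableT.
    move=> h; rewrite le_eqVlt; apply/orP; left; apply/eqP; refine (etrans h _).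
    exact: (etrans (f_equal2 mule (probability_setT P1) (probability_setT P2)) (mule1 _)).
  exists M; split; first exact: num_real.
  by move=> N MN x _ /=; rewrite (le_trans (fM x)) // ltW.
have := Fubini ip => h.
rewrite /Rintegral; congr fine.
under eq_integral do rewrite -/(Rintegral _ _ _) -Rintegral_EFin //.
by under [RHS]eq_integral do rewrite -/(Rintegral _ _ _) -Rintegral_EFin //.
Qed.

Section normal_probability.
Context {R : realType}.
Local Notation RR := (measurableTypeR R).

Lemma Rintegral_normal_prob (m s : R) (f : RR -> R) : s != 0 -> measurable_fun setT f ->
  (normal_prob m s : probability RR R).-integrable setT (EFin \o f) ->
  \int[(normal_prob m s : probability RR R)]_x f x = \int[lebesgue_measure]_x (f x * normal_pdf m s x).
Proof.
move=> s0 mf fi; apply: Rintegral_density => //.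
- exact: measurable_normal_pdf.
- by move=> x; exact: normal_pdf_ge0.
Qed.

Lemma normal_prob_cos (m s t c : R) : s != 0 ->
  \int[(normal_prob m s : probability RR R)]_x cos (t * (x - m) + c) =
  expR (- (s ^+ 2 * t ^+ 2) / 2) * cos c.
Proof.
move=> s0; rewrite -(@normal_cos _ m s) //.
have mc : measurable_fun setT (fun x : RR => cos (t * (x - m) + c)).
  by apply: continuous_measurable_fun => x; exact: is_derive_continuous.
rewrite Rintegral_normal_prob //.
apply: (@prob_bounded_integrable _ _ _ _ _ 1) => //.
by move=> x; rewrite ler_norml cos_geN1 cos_le1.
Qed.

(** Chebyshev's inequality, with the variance from [normal_variance]. *)
Lemma normal_prob_tail (m s dl : R) (A : set RR) : s != 0 -> 0 < dl -> measurable A ->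
  (forall y, A y -> dl <= `|y - m|) ->
  fine ((normal_prob m s : probability RR R) A) <= s ^+ 2 / dl ^+ 2.
Proof.
move=> s0 d0 mA Adl.
have mq : measurable_fun setT (fun x : RR => (x - m) ^+ 2 / dl ^+ 2).
  by apply: measurable_funM => //; apply: measurable_funX; exact: measurable_funB.
have qi : (normal_prob m s : probability RR R).-integrable setT
    (EFin \o (fun x : RR => (x - m) ^+ 2 / dl ^+ 2)).
  apply/(integral_density (mu := lebesgue_measure) (g := normal_pdf m s)) => //.
  - exact: measurable_normal_pdf.
  - by move=> x; exact: normal_pdf_ge0.
  apply: (@integrable_mul_normal_pdf _ m s s0 (fun x => (x - m) ^+ 2 / dl ^+ 2) (dl ^+ 2)^-1) => //.
  move=> x; rewrite ger0_norm ?divr_ge0 ?sqr_ge0 // mulrC ler_pM2l ?invr_gt0 ?exprn_gt0 //.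
  by rewrite lerDr.
have -> : s ^+ 2 / dl ^+ 2 = \int[(normal_prob m s : probability RR R)]_x ((x - m) ^+ 2 / dl ^+ 2).
  rewrite Rintegral_normal_prob // -(@normal_variance _ m s) //.
  under [RHS]eq_Rintegral do rewrite mulrAC.
  rewrite RintegralZr //.
  apply: (@integrable_mul_normal_pdf _ m s s0 (fun x => (x - m) ^+ 2) 1) => //.
  + by apply: measurable_funX; exact: measurable_funB.
  + by move=> x; rewrite mul1r ger0_norm ?sqr_ge0 // lerDr.
have -> : fine ((normal_prob m s : probability RR R) A) =
    \int[(normal_prob m s : probability RR R)]_x \1_A x.
  by rewrite /Rintegral integral_indic // setIT.
apply: le_Rintegral => //.
  apply: (@prob_bounded_integrable _ _ _ _ _ 1).
    exact: measurable_indic.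
  by move=> x; rewrite indicE; case: (_ \in _); rewrite ?normr1 ?normr0.
move=> x _; rewrite indicE; have [|_] := boolP (x \in A); last by rewrite divr_ge0 ?sqr_ge0.
rewrite inE => /Adl h; rewrite ler_pdivlMr ?exprn_gt0 // mul1r -[leRHS]real_normK ?num_real //.
by rewrite lerXn2r // nnegrE // ltW.
Qed.

End normal_probability.

Lemma measurable_fun_cos d (T : measurableType d) (R : realType) (f : T -> R) :
  measurable_fun setT f -> measurable_fun setT (fun x => cos (f x)).
Proof.
apply: (measurableT_comp (continuous_measurable_fun _)).
exact: continuous_cos.
Qed.

(** * Cosine transforms determine laws *)

Section cos_unique.
Context {R : realType}.
Local Notation RR := (measurableTypeR R).
Variables m1 m2 : probability RR R.
Hypothesis m12 : forall t c, \int[m1]_x cos (t * x + c) = \int[m2]_x cos (t * x + c).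

(** The Gaussian kernel is the cosine transform of a Gaussian of deviation [s^-1]; after exchanging
    the integrals, [m] enters only through its own cosine transform. *)
Let normal_fun_cos (m : probability RR R) s y : s != 0 ->
  \int[m]_x normal_fun x s y =
  \int[(normal_prob 0 s^-1 : probability RR R)]_t \int[m]_x cos (t * x + (- t * y)).
Proof.
move=> s0.
rewrite -(@Rintegral_Fubini _ _ _ _ _ m (normal_prob 0 s^-1 : probability RR R)
  (fun z => cos (z.2 * z.1 + (- z.2 * y))) 1); last by move=> z; rewrite cos_max.
  apply: eq_Rintegral => x _.
  have := @normal_prob_cos _ 0 s^-1 (x - y) 0; rewrite invr_eq0 s0 cos0 mulr1 => /(_ isT) h.
  rewrite /normal_fun -[LHS](_ : expR (- (s^-1 ^+ 2 * (x - y) ^+ 2) / 2) = _).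
    by rewrite -h; apply: eq_Rintegral => t _; congr cos; rewrite /=; ring.
  by congr expR; field.
apply: measurable_fun_cos; apply: measurable_funD; first exact: measurable_funM.
by apply: measurable_funM => //; apply: measurableT_comp.
Qed.

Lemma smoothed_eq s y : s != 0 -> \int[m1]_x normal_pdf x s y = \int[m2]_x normal_pdf x s y.
Proof.
move=> s0.
have E (m : probability RR R) : \int[m]_x normal_pdf x s y =
    normal_peak s * \int[m]_x normal_fun x s y.
  under eq_Rintegral do rewrite normal_pdfE //.
  rewrite RintegralZl //; apply: (@prob_bounded_integrable _ _ _ _ _ 1).
    have -> : (fun x : RR => normal_fun x s y) = normal_fun y s.
      by apply/funext => x; rewrite /normal_fun; rewrite -sqrrN opprB.
    exact: measurable_normal_fun.
  move=> x; rewrite ger0_norm ?expR_ge0 // -expR0 ler_expR mulNr oppr_le0.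
  by rewrite divr_ge0 ?sqr_ge0 // mulrn_wge0 ?sqr_ge0.
rewrite !E !normal_fun_cos //; congr (_ * _); apply: eq_Rintegral => t _.
exact: m12.
Qed.

Let measurable_pdf2 s : s != 0 ->
  measurable_fun setT (fun z : RR * RR => (normal_pdf z.1 s z.2)%:E).
Proof.
move=> s0.
  apply/measurable_EFinP.
  have -> : (fun z : RR * RR => normal_pdf z.1 s z.2) =
      (fun z => normal_peak s * expR (- (z.2 - z.1) ^+ 2 / (s ^+ 2 *+ 2))).
    by apply/funext => z; rewrite normal_pdfE.
  apply: measurable_funM => //; apply: measurableT_comp => //.
  apply: measurable_funM => //; apply: measurableT_comp => //.
  by apply: measurable_funX; exact: measurable_funB.
Qed.

Let measurable_indic_pdf s (A : set RR) : s != 0 -> measurable A ->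
  measurable_fun setT (fun z : RR * RR => ((\1_A z.2)%:E * (normal_pdf z.1 s z.2)%:E)%E).
Proof.
move=> s0 mA; apply: emeasurable_funM; last exact: measurable_pdf2.
apply/measurable_EFinP.
exact: (measurableT_comp (measurable_indic mA : measurable_fun setT (\1_A : RR -> R)) measurable_snd).
Qed.

Let normal_prob_indic x s (A : set RR) : measurable A ->
  (normal_prob x s : probability RR R) A =
  (\int[lebesgue_measure]_y ((\1_A y)%:E * (normal_pdf x s y)%:E))%E.
Proof.
move=> mA; rewrite /= /normal_prob integral_mkcond.
by apply: eq_integral => y _; rewrite patchE indicE; case: (y \in A); rewrite ?mul1e ?mul0e.
Qed.

Let measurable_normal_prob s (A : set RR) : s != 0 -> measurable A ->
  measurable_fun setT (fun x : RR => (normal_prob x s : probability RR R) A).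
Proof.
move=> s0 mA; under eq_fun do rewrite normal_prob_indic //.
apply: (@measurable_fun_fubini_tonelli_F _ _ RR RR R lebesgue_measure
  (fun z => (\1_A z.2)%:E * (normal_pdf z.1 s z.2)%:E)%E); first exact: measurable_indic_pdf.
by move=> z; rewrite mule_ge0 // lee_fin ?normal_pdf_ge0 // indicE.
Qed.

Lemma smoothed_eq_prob s (A : set RR) : s != 0 -> measurable A ->
  (\int[m1]_x (normal_prob x s : probability RR R) A = \int[m2]_x (normal_prob x s : probability RR R) A)%E.
Proof.
move=> s0 mA.
have mApdf := measurable_indic_pdf s0 mA.
have E (m : probability RR R) :
   (\int[m]_x (normal_prob x s : probability RR R) A = \int[lebesgue_measure]_(y in A) (\int[m]_x normal_pdf x s y)%:E)%E.
  rewrite [RHS]integral_mkcond.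
  transitivity (\int[m]_x \int[lebesgue_measure]_y ((\1_A y)%:E * (normal_pdf x s y)%:E))%E.
    by apply: eq_integral => x _; rewrite normal_prob_indic.
  rewrite (@fubini_tonelli _ _ RR RR R m lebesgue_measure (fun z => (\1_A z.2)%:E * (normal_pdf z.1 s z.2)%:E)%E).
  - apply: eq_integral => y _ /=; rewrite patchE indicE; case: (y \in A); last first.
      by under eq_integral do rewrite mul0e; rewrite integral0.
    under eq_integral do rewrite mul1e; rewrite Rintegral_EFin //.
    apply: (@prob_bounded_integrable _ _ _ _ _ (normal_peak s)).
      by have := measurableT_comp (measurable_pdf2 s0) (measurable_pair2 y); move/measurable_EFinP.
    move=> x; rewrite ger0_norm ?normal_pdf_ge0 // normal_pdfE // ler_piMr ?normal_peak_ge0 //.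
    rewrite -expR0 ler_expR mulNr oppr_le0.
    by rewrite divr_ge0 ?sqr_ge0 // mulrn_wge0 ?sqr_ge0.
  - exact: mApdf.
  - by move=> z; rewrite mule_ge0 // lee_fin ?normal_pdf_ge0 // indicE.
by rewrite !E; apply: eq_integral => y _; rewrite smoothed_eq.
Qed.

(** The noise has deviation [dl^2] and the threshold is raised by [dl], where [dl = 1/(n+1)]. By
    Chebyshev the mass is at most [dl^2] when [x <= a], the point [x = a] being covered thanks to
    the raised threshold, and tends to 1 when [x > a]. *)
Lemma normal_tail_cvg (a x : R) :
  ((normal_prob x (n.+1%:R^-1 ^+ 2) : probability RR R) `](a + n.+1%:R^-1)%R, +oo[%classic
     @[n --> \oo] --> (\1_(`]a, +oo[%classic : set RR) x)%:E)%E.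
Proof.
pose dl n : R := n.+1%:R^-1; pose I n : set RR := `](a + dl n), +oo[%classic.
have dl0 n : 0 < dl n by rewrite invr_gt0.
have dl1 n : dl n <= 1 by rewrite invf_le1 // ler1n.
have dlc : dl @ \oo --> (0 : R) by exact: cvg_harmonic.
have mI n : measurable (I n) by exact: measurable_itv.
have s0 n : dl n ^+ 2 != 0 by rewrite expf_neq0 // gt_eqF.
pose N n : probability RR R := normal_prob x (dl n ^+ 2).
have Nf n : N n (I n) = (fine (N n (I n)))%:E by rewrite fineK // fin_num_measure.
have Nge n : 0 <= fine (N n (I n)) by rewrite fine_ge0.
rewrite (_ : (fun n => _) = (fun n => (fine (N n (I n)))%:E)); last exact/funext.
apply: cvg_EFin; first by near=> n.
rewrite indicE; have [xa|xa] := boolP (x \in `]a, +oo[%classic); last first.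
  have {}xa : x <= a by move: xa; rewrite notin_setE /= in_itv /= andbT => /negP; rewrite -leNgt.
  apply: (@squeeze_cvgr _ _ _ _ (cst 0) dl) => //; last exact: cvg_cst.
  apply: nearW => n; apply/andP; split; first exact: Nge.
  apply: le_trans (normal_prob_tail (s0 n) (dl0 n) (mI n) _) _.
    move=> y; rewrite /I /= in_itv /= andbT => h; rewrite ler_normr; apply/orP; left; lra.
  rewrite -[_ / _](_ : dl n ^+ 2 = _); last by field; rewrite gt_eqF.
  by rewrite expr2 ler_piMr // ltW.
have {}xa : a < x by move: xa; rewrite inE /= in_itv /= andbT.
pose e := (x - a) / 2; have e0 : 0 < e by rewrite /e; lra.
have H : \forall n \near \oo, 1 - dl n / e ^+ 2 <= fine (N n (I n)).
  near=> n; have dle : dl n < e.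
    by near: n; have := cvgr_lt _ dlc _ e0; exact.
  have -> : fine (N n (I n)) = 1 - fine (N n (~` I n)).
    by have := probability_setC (N n) (mI n); rewrite Nf -EFinB => ->; rewrite /= subKr.
  rewrite lerD2l lerN2; apply: le_trans (normal_prob_tail (s0 n) e0 (measurableC (mI n)) _) _.
    move=> y; rewrite /I /= in_itv /= andbT => /negP; rewrite -leNgt => h.
    rewrite ler_normr; apply/orP; right; move: dle; rewrite /e; set z := dl n in h *; lra.
  rewrite ler_pM2r ?invr_gt0 ?exprn_gt0 // -exprM.
  by rewrite exprS ler_piMr ?exprn_ile1 // ltW.
apply: (@squeeze_cvgr _ _ _ _ (fun n => 1 - dl n / e ^+ 2) (cst 1)) => //.
- near=> n; apply/andP; split; first by near: n.
  by rewrite -lee_fin -Nf probability_le1.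
- rewrite -[X in _ --> X](_ : 1 - 0 / e ^+ 2 = _); last by rewrite mul0r subr0.
  by apply: cvgB; [exact: cvg_cst|exact: cvgMl].
- exact: cvg_cst.
Unshelve. all: by end_near.
Qed.

(** Smoothing both laws by Gaussian noise makes them agree, by [smoothed_eq_prob]; the noise is then
    sent to zero. *)
Lemma cos_unique (A : set RR) : measurable A -> m1 A = m2 A.
Proof.
have oy (m : probability RR R) (a : R) :
  (\int[m]_x (normal_prob x (n.+1%:R^-1 ^+ 2) : probability RR R) `](a + n.+1%:R^-1)%R, +oo[%classic
   @[n --> \oo] --> m `]a, +oo[%classic)%E.
  have h (n : nat) : (n.+1%:R^-1 ^+ 2 : R) != 0 by rewrite expf_neq0 // invr_neq0 // pnatr_eq0.
  have -> : m `]a, +oo[%classic = (\int[m]_x (\1_(`]a, +oo[%classic : set RR) x)%:E)%E.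
    by rewrite integral_indic // setIT.
  apply: (@dominated_cvg _ _ _ m setT _ _ _ (cst 1%E)) => //.
  - by move=> n; exact: measurable_normal_prob.
  - by move=> x _; exact: normal_tail_cvg.
  - by apply: (@prob_bounded_integrable _ _ _ m (cst 1) 1) => // x; rewrite normr1.
  - by move=> n x _; rewrite gee0_abs // probability_le1.
apply: measure_eq_oy => [x|x]; last first.
  apply: le_lt_trans (probability_le1 _ _) (ltry _) => //.
apply: (@cvg_unique _ _ _ _ _ _ (oy m1 x)) => //.
have := oy m2 x; rewrite (_ : (fun n => _) = (fun n => (\int[m1]_x0 (normal_prob x0 (n.+1%:R^-1 ^+ 2) : probability RR R) `](x + n.+1%:R^-1)%R, +oo[%classic)%E)); first exact.
by apply/funext => n; rewrite smoothed_eq_prob.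
Qed.

End cos_unique.

Section independence.
Context d {E : measurableType d} {R : realType} (P : probability E R).
Local Notation RR := (measurableTypeR R).

(** Normalised, [W] is a density under which [Z] has the cosine transform of [gauss], so
    [cos_unique] applies. A weight of integral zero cannot be normalised, but then both sides
    vanish. *)
Lemma weighted_gauss_law (W : E -> R) (M : R) (Z : E -> RR) :
  measurable_fun setT W -> (forall x, 0 <= W x <= M) -> measurable_fun setT Z ->
  (forall t c, \int[P]_x (W x * cos (t * Z x + c)) =
     \int[P]_x W x * expR (- t ^+ 2 / 2) * cos c) ->
  forall B, measurable B ->
    \int[P]_x (W x * \1_B (Z x)) = \int[P]_x W x * fine (gauss B).
Proof.
move=> mW W0M mZ hcos B mB.
have W0 x : 0 <= W x by case/andP : (W0M x).
have WM x : `|W x| <= M by rewrite ger0_norm //; case/andP : (W0M x).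
have Wi : P.-integrable setT (EFin \o W) by exact: prob_bounded_integrable WM.
set w := \int[P]_x W x.
have w0 : 0 <= w by apply: Rintegral_ge0.
have mBZ : measurable_fun setT (fun x => \1_B (Z x) : R).
  exact: (measurableT_comp (measurable_indic mB : measurable_fun setT (\1_B : RR -> R)) mZ).
have b01 x : 0 <= (\1_B (Z x) : R) <= 1 by exact: indic01.
have WBi : P.-integrable setT (EFin \o (fun x => W x * \1_B (Z x))).
  apply: (@prob_bounded_integrable _ _ _ P _ M); first exact: measurable_funM.
  move=> x; rewrite normrM (le_trans _ (WM x)) // ler_piMr //.
  by rewrite ger0_norm; case/andP: (b01 x).
have [w00|wn0] := eqVneq w 0.
  rewrite w00 mul0r; apply/eqP; rewrite eq_le -{1}w00; apply/andP; split.
    apply: le_Rintegral => // x _; rewrite ler_piMr //; by case/andP: (b01 x).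
  by apply: Rintegral_ge0 => x _; rewrite mulr_ge0 //; case/andP: (b01 x).
have {}w0 : 0 < w by rewrite lt_neqAle eq_sym wn0.
pose g x := W x / w.
have mg : measurable_fun setT g by exact: measurable_funM.
have g0 x : 0 <= g x by rewrite divr_ge0 // ltW.
have gi : P.-integrable setT (EFin \o g).
  rewrite (_ : g = fun x => w^-1 * W x); first exact: integrableZlR.
  by apply/funext => x; rewrite /g mulrC.
have g1 : (\int[P]_x (g x)%:E = 1)%E.
  rewrite Rintegral_EFin //; congr EFin.
  by rewrite /g RintegralZr // divff.
pose Q := density_prob mg g0 g1.
have QE (A : set E) : measurable A -> Q A = (\int[P]_(x in A) (g x)%:E)%E by [].
have Qint (f : E -> R) : measurable_fun setT f -> (forall x, `|f x| <= 1) ->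
    \int[Q]_x f x = (\int[P]_x (W x * f x)) / w.
  move=> mf f1; rewrite (Rintegral_density mg g0 QE) //; last exact: prob_bounded_integrable f1.
  rewrite -RintegralZr //.
    by apply: eq_Rintegral => x _; rewrite /g mulrA [f x * _]mulrC.
  apply: (@prob_bounded_integrable _ _ _ P _ M); first exact: measurable_funM.
  by move=> x; rewrite normrM (le_trans _ (WM x)) // ler_piMr.
have cosE t c (m : probability RR R) : \int[m]_x cos (t * x + c) = \int[m]_x cos (t * (x - 0) + c).
  by apply: eq_Rintegral => x _; rewrite subr0.
have mcos t c : measurable_fun setT (fun x : RR => cos (t * x + c)).
  by apply: measurable_fun_cos; apply: measurable_funD => //; exact: measurable_funM.
have key t c : \int[law Q mZ]_x cos (t * x + c) = \int[gauss]_x cos (t * x + c).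
  rewrite [RHS]cosE [RHS](normal_prob_cos 0 t c (oner_neq0 _)) expr1n mul1r.
  rewrite Rintegral_law //; last first.
    apply: (@prob_bounded_integrable _ _ _ _ _ 1); last by move=> x; exact: cos_max.
    exact: (measurableT_comp (mcos t c) mZ).
  rewrite (Qint (fun x => cos (t * Z x + c))); first by rewrite hcos -/w -[w * _ * _]mulrA [w * _]mulrC mulfK.
    exact: (measurableT_comp (mcos t c) mZ).
  by move=> x; exact: cos_max.
have := cos_unique key mB => h.
have : fine (Q (Z @^-1` B)) = fine (gauss B) by congr fine.
have -> : fine (Q (Z @^-1` B)) = \int[Q]_x \1_B (Z x).
  rewrite /Rintegral; congr fine.
  rewrite -[Z @^-1` B]setIT -integral_indic //.
    by rewrite -[X in measurable X]setTI; exact: (mZ measurableT _ mB).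
rewrite Qint //; last by move=> x; rewrite ger0_norm; case/andP: (b01 x).
by move=> <-; rewrite mulrC divfK.
Qed.

Variables (sg : nat -> bool) (xi : nat -> E -> RR).
Hypothesis mxi : forall k, measurable_fun setT (xi k).
Hypothesis xi0 : forall k, ~~ sg k -> xi k = cst 0.
Hypothesis xicos : forall n (a : nat -> R) c,
  \int[P]_x cos (\sum_(j < n) a j * xi j x + c) =
  expR (- (\sum_(j < n) (sg j)%:R * a j ^+ 2) / 2) * cos c.

Let msum n (a : nat -> R) c : measurable_fun setT (fun x => \sum_(j < n) a j * xi j x + c).
Proof.
apply: measurable_funD => //; apply: measurable_sum => j.
by apply: measurable_funM => //; exact: mxi.
Qed.

Let dirac_sum n k (F : nat -> R) : (k < n)%N -> \sum_(j < n) (j == k :> nat)%:R * F j = F k.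
Proof.
move=> kn; rewrite (bigD1 (Ordinal kn)) //= eqxx mul1r big1 ?addr0 // => j jk.
by rewrite (_ : (j == k :> nat) = false) ?mul0r //; apply/negbTE.
Qed.

(** Induction on the number [k] of coordinates converted from cosines into indicators; the
    frequencies of converted coordinates are zero. With [k = n] and [a = 0] it becomes the product
    formula on cylinders. *)
Lemma std_family_cos n k (B : nat -> set RR) (a : nat -> R) c : (k <= n)%N ->
  (forall i, measurable (B i)) -> (forall i, (i < k)%N -> a i = 0) ->
  \int[P]_x (\1_(cyl xi k B) x * cos (\sum_(j < n) a j * xi j x + c)) =
  (\prod_(i < k) fine (std_law (sg i) (B i))) *
    (expR (- (\sum_(j < n) (sg j)%:R * a j ^+ 2) / 2) * cos c).
Proof.
move=> + mB; elim: k => [|k ih] in a c *.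
  move=> _ _; rewrite cyl0 big_ord0 mul1r -xicos.
  by apply: eq_Rintegral => x _; rewrite indicT mul1r.
move=> kn ak0.
have ak : a k = 0 by exact: ak0.
have mC : measurable (cyl xi k B) by apply: measurable_cyl => // i _; exact: mxi.
have i01 (A : set E) x : 0 <= (\1_A x : R) <= 1 by exact: indic01.
pose C x : R := \1_(cyl xi k B) x.
have mCC : measurable_fun setT C by exact: measurable_indic.
have indS x : \1_(cyl xi k.+1 B) x = C x * \1_(B k) (xi k x) :> R.
  by rewrite cylS indicI.
set p := \prod_(i < k) fine (std_law (sg i) (B i)) in ih.
rewrite big_ord_recr /= -/p.
have [sk|sk] := boolP (sg k); last first.
  rewrite (_ : fine (std_law false (B k)) = \1_(B k) 0); last by rewrite /std_law diracE indicE.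
  rewrite mulrAC -ih //; last 2 first.
  - exact: ltnW.
  - by move=> i ik; apply: ak0; exact: ltnW.
  rewrite -RintegralZr //.
    by apply: eq_Rintegral => x _; rewrite indS xi0 // mulrAC.
  apply: (@prob_bounded_integrable _ _ _ P _ 1).
    by apply: measurable_funM => //; exact: measurable_fun_cos.
  move=> x; rewrite normrM mulr_ile1 ?cos_max ?normr_ge0 //.
  by rewrite ger0_norm; case/andP: (i01 (cyl xi k B) x).
pose S x := \sum_(j < n) a j * xi j x.
pose I (b : nat -> R) c := \int[P]_x (C x * cos (\sum_(j < n) b j * xi j x + c)).
have IE (b : nat -> R) c' : (forall i, (i < k)%N -> b i = 0) -> I b c' =
    p * (expR (- (\sum_(j < n) (sg j)%:R * b j ^+ 2) / 2) * cos c').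
  by move=> hb; rewrite /I ih // ltnW.
pose A := \sum_(j < n) (sg j)%:R * a j ^+ 2.
(* The frequencies [a], kept or erased according to [s], with [t] added at coordinate [k]. *)
pose aa (s : bool) t j : R := s%:R * a j + t * (j == k)%:R.
have aaS s t x : \sum_(j < n) aa s t j * xi j x = s%:R * S x + t * xi k x.
  rewrite /aa /S mulr_sumr -[in RHS](@dirac_sum n k (fun j => xi j x)) // mulr_sumr -big_split /=.
  by apply: eq_bigr => j _; ring.
have aaA s t : \sum_(j < n) (sg j)%:R * aa s t j ^+ 2 = s%:R * A + t ^+ 2.
  rewrite /aa /A mulr_sumr -[in RHS](@dirac_sum n k (fun=> t ^+ 2)) // -big_split /=.
  apply: eq_bigr => j _; have [->|_] := eqVneq (j : nat) k; last by case: s; rewrite /= ?mulr1n ?mulr0n; ring.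
  by rewrite ak sk /= ?mulr1n; ring.
have aa0 s t i : (i < k)%N -> aa s t i = 0.
  move=> ik; rewrite /aa ak0 ?mulr0 ?add0r; last exact: ltn_trans ik _.
  by rewrite (ltn_eqF ik) mulr0.
have mS : measurable_fun setT S.
  by have := msum n a 0; under eq_fun do rewrite addr0.
have mcosl t u c' : measurable_fun setT (fun x => cos (t * S x + u * xi k x + c')).
  apply: measurable_fun_cos; apply: measurable_funD => //.
  by apply: measurable_funD; apply: measurable_funM => //; exact: mxi.
have Ci t u c' : P.-integrable setT (EFin \o (fun x => C x * cos (t * S x + u * xi k x + c'))).
  apply: (@prob_bounded_integrable _ _ _ P _ 1); first exact: measurable_funM.
  move=> x; rewrite normrM mulr_ile1 ?cos_max ?normr_ge0 //.
  by rewrite ger0_norm; case/andP: (i01 (cyl xi k B) x).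
have CE (s : bool) t c' : \int[P]_x (C x * cos (s%:R * S x + t * xi k x + c')) =
    p * (expR (- (s%:R * A + t ^+ 2) / 2) * cos c').
  rewrite -aaA -IE; last exact: aa0.
  by apply: eq_Rintegral => x _; rewrite aaS.
have C1 : \int[P]_x C x = p.
  have := CE false 0 0; rewrite !mul0r expr0n addr0 oppr0 mul0r expR0 cos0 !mulr1 => <-.
  by apply: eq_Rintegral => x _; rewrite !mul0r !addr0 cos0 mulr1.
have C2 t c' : \int[P]_x (C x * cos (t * xi k x + c')) = p * (expR (- t ^+ 2 / 2) * cos c').
  have := CE false t c'; rewrite mul0r add0r => <-.
  by apply: eq_Rintegral => x _; rewrite mul0r add0r.
have C3 t c' : \int[P]_x (C x * cos (S x + t * xi k x + c')) =
    p * (expR (- A / 2) * expR (- t ^+ 2 / 2) * cos c').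
  have := CE true t c'; rewrite mul1r opprD mulrDl expRD => <-.
  by apply: eq_Rintegral => x _; rewrite mul1r.
have Ci1 c' : P.-integrable setT (EFin \o (fun x => C x * cos (S x + c'))).
  have := Ci 1 0 c'; apply: eq_integrable => // x _ /=.
  by rewrite mul1r mul0r addr0.
have Ci0 : P.-integrable setT (EFin \o C).
  have := Ci 0 0 0; apply: eq_integrable => // x _ /=.
  by rewrite !mul0r !addr0 cos0 mulr1.
have Ci2 t c' : P.-integrable setT (EFin \o (fun x => C x * cos (t * xi k x + c'))).
  have := Ci 0 t c'; apply: eq_integrable => // x _ /=.
  by rewrite mul0r add0r.
have Ci3 t c' : P.-integrable setT (EFin \o (fun x => C x * cos (S x + t * xi k x + c'))).
  have := Ci 1 t c'; apply: eq_integrable => // x _ /=.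
  by rewrite mul1r.
(* [weighted_gauss_law] asks for a nonnegative weight: [1 + cos] is one, and the contribution of the
   1 is computed apart in [hC] and subtracted. *)
pose W x := C x * (1 + cos (S x + c)).
have mW : measurable_fun setT W.
  apply: measurable_funM => //; apply: measurable_funD => //; apply: measurable_fun_cos.
  exact: measurable_funD.
have c01 x : 0 <= C x <= 1 by exact: i01.
have W02 x : 0 <= W x <= 2.
  have := c01 x => /andP[h1 h2]; have := cos_max (S x + c); rewrite ler_norml => /andP[h3 h4].
  by rewrite /W; apply/andP; split; nra.
have WE : \int[P]_x W x = p + p * (expR (- A / 2) * cos c).
  have := C3 0 c; rewrite expr0n oppr0 mul0r expR0 mulr1 => <-; rewrite -{1}C1 -RintegralD //.
    by apply: eq_Rintegral => x _; rewrite /W mul0r addr0 mulrDr mulr1.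
have hW : \int[P]_x (W x * \1_(B k) (xi k x)) = \int[P]_x W x * fine (gauss (B k)).
  apply: (weighted_gauss_law mW W02) => // t c'.
  (* A product of cosines is half the sum of the cosines of the sum and of the difference, so [C3]
     applies at the frequencies [t] and [- t]. *)
  transitivity (\int[P]_x (C x * cos (t * xi k x + c') +
     (2^-1 * (C x * cos (S x + t * xi k x + (c + c'))) + 2^-1 * (C x * cos (S x + (- t) * xi k x + (c - c')))))).
    apply: eq_Rintegral => x _; rewrite /W.
    have -> : S x + t * xi k x + (c + c') = (S x + c) + (t * xi k x + c') by ring.
    have -> : S x + - t * xi k x + (c - c') = (S x + c) - (t * xi k x + c') by ring.
    by rewrite (cosD (S x + c)) (cosB (S x + c)); field.
  rewrite RintegralD //; last first.
    by apply: integrableDR => //; apply: integrableZlR => //; exact: Ci3.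
  rewrite RintegralD //; [|by apply: integrableZlR => //; exact: Ci3..].
  rewrite !RintegralZl //; [|exact: Ci3..].
  by rewrite C2 !C3 WE (cosD c c') (cosB c c') sqrrN; field.
have hC : \int[P]_x (C x * \1_(B k) (xi k x)) = p * fine (gauss (B k)).
  rewrite -C1; apply: (@weighted_gauss_law C 1) => // t c'.
  by rewrite C2 C1 mulrA.
have b01 x : `|\1_(B k) (xi k x) : R| <= 1.
  by rewrite indicE; case: (_ \in _); rewrite /= ?normr1 ?normr0 ?ler01.
have mBk : measurable_fun setT (fun x => \1_(B k) (xi k x) : R).
  exact: (measurableT_comp (measurable_indic (mB k) : measurable_fun setT (\1_(B k) : RR -> R)) (mxi k)).
have bi (f : E -> R) : measurable_fun setT f -> (forall x, `|f x| <= 2) ->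
    P.-integrable setT (EFin \o (fun x => f x * \1_(B k) (xi k x))).
  move=> mf f1; apply: (@prob_bounded_integrable _ _ _ P _ 2); first exact: measurable_funM.
  by move=> x; rewrite normrM (le_trans _ (f1 x)) // ler_piMr.
transitivity (\int[P]_x (W x * \1_(B k) (xi k x) - C x * \1_(B k) (xi k x))).
  by apply: eq_Rintegral => x _; rewrite indS /W -/(S x); ring.
rewrite RintegralB //.
- by rewrite hW hC WE /std_law -/A; ring.
- by apply: bi => // x; rewrite ger0_norm; case/andP: (W02 x).
- apply: bi => // x; rewrite ger0_norm; case/andP: (c01 x) => // _ h.
  by rewrite (le_trans h) // ler1n.
Qed.

Theorem std_family_of_cos : std_family sg P xi.
Proof.
move=> n B mB; have := @std_family_cos n n B (fun=> 0) 0 (leqnn n) mB (fun _ _ => erefl).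
rewrite [X in expR (- X / 2)]big1 ?oppr0 ?mul0r ?expR0 ?cos0 ?mulr1; last first.
  by move=> j _; rewrite expr0n mulr0.
have mC : measurable (cyl xi n B) by apply: measurable_cyl => // i _; exact: mxi.
have -> : \int[P]_x (\1_(cyl xi n B) x * cos (\sum_(j < n) 0 * xi j x + 0)) = fine (P (cyl xi n B)).
  rewrite /Rintegral -[cyl xi n B]setIT -integral_indic //; congr fine.
  apply: eq_integral => x _; rewrite setIT big1 ?addr0 ?cos0 ?mulr1 // => j _.
  by rewrite mul0r.
move=> h; rewrite -[LHS]fineK ?fin_num_measure // h -prodEFin.
apply: eq_bigr => i _; rewrite fineK // ge0_fin_numE ?std_law_ge0 // /std_law; case: (sg i).
  exact: (le_lt_trans (probability_le1 _ (mB i)) (ltry _)).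
by rewrite diracE ltry.
Qed.

End independence.

(** * The path space *)

Lemma sum_CS (R : realFieldType) (n : nat) (x y : 'I_n -> R) :
  (\sum_i x i * y i) ^+ 2 <= (\sum_i x i ^+ 2) * (\sum_i y i ^+ 2).
Proof.
set S := \sum_i _ * _; set A := \sum_i x _ ^+ 2; set B := \sum_i _ ^+ 2.
have E a s : \sum_i (a * y i - s * x i) ^+ 2 = a ^+ 2 * B - 2 * a * s * S + s ^+ 2 * A.
  rewrite /B /S /A !mulr_sumr -sumrN -!big_split /=.
  by apply: eq_bigr => i _; ring.
have P a s : 0 <= a ^+ 2 * B - 2 * a * s * S + s ^+ 2 * A.
  by rewrite -E; apply: sumr_ge0 => i _; exact: sqr_ge0.
have A0 : 0 <= A by apply: sumr_ge0 => i _; exact: sqr_ge0.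
have [A00|An0] := eqVneq A 0; last first.
  have Ap : 0 < A by rewrite lt_neqAle eq_sym An0.
  rewrite -subr_ge0 -(pmulr_rge0 _ Ap).
  by have := P A S; nra.
rewrite A00 mul0r; have := A00; move/eqP.
rewrite /A psumr_eq0 => [/allP h|i _]; last exact: sqr_ge0.
rewrite /S big1 ?expr0n // => i _; have := h i (mem_index_enum _).
by rewrite sqrf_eq0 => /eqP ->; exact: mul0r.
Qed.

(** * The Euclidean norm *)

Section enorm.
Context {R : realType} {d : nat}.
Implicit Types x y : 'rV[R]_d.

Lemma enorm_ge0 x : 0 <= enorm x.
Proof. exact: sqrtr_ge0. Qed.

Lemma sqr_enorm x : enorm x ^+ 2 = \sum_(i < d) x 0 i ^+ 2.
Proof. by rewrite sqr_sqrtr // sumr_ge0 // => i _; rewrite sqr_ge0. Qed.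

Lemma enorm0 : enorm (0 : 'rV[R]_d) = 0.
Proof.
by rewrite /enorm big1 ?sqrtr0 // => i _; rewrite mxE expr0n.
Qed.

Lemma enormZ (a : R) x : enorm (a *: x) = `|a| * enorm x.
Proof.
rewrite /enorm -sqrtr_sqr -sqrtrM ?sqr_ge0 // mulr_sumr; congr Num.sqrt.
by apply: eq_bigr => i _; rewrite mxE exprMn.
Qed.

Lemma enormN x : enorm (- x) = enorm x.
Proof. by rewrite -scaleN1r enormZ normrN1 mul1r. Qed.

Lemma enormB_sym x y : enorm (x - y) = enorm (y - x).
Proof. by rewrite -enormN opprB. Qed.

Lemma enorm_CS x y : \sum_(i < d) x 0 i * y 0 i <= enorm x * enorm y.
Proof.
rewrite /enorm -sqrtrM ?sumr_ge0 // => [|i _]; last exact: sqr_ge0.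
apply: le_trans (ler_norm _) _; rewrite -sqrtr_sqr; apply: ler_wsqrtr.
exact: sum_CS.
Qed.

Lemma enormD x y : enorm (x + y) <= enorm x + enorm y.
Proof.
rewrite -(@ler_pXn2r _ 2) // ?nnegrE ?addr_ge0 ?enorm_ge0 // sqrrD !sqr_enorm.
have -> : \sum_(i < d) (x + y) 0 i ^+ 2 = \sum_(i < d) x 0 i ^+ 2 +
    (\sum_(i < d) x 0 i * y 0 i) *+ 2 + \sum_(i < d) y 0 i ^+ 2.
  rewrite -sumrMnl -!big_split /=; apply: eq_bigr => i _; rewrite mxE; ring.
by rewrite lerD2r lerD2l ler_wMn2r // enorm_CS.
Qed.

Lemma enormB x y : enorm (x - y) <= enorm x + enorm y.
Proof. by rewrite -[enorm y]enormN enormD. Qed.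

Lemma enorm_distB x y : `|enorm x - enorm y| <= enorm (x - y).
Proof.
have h (u v : 'rV[R]_d) : enorm u - enorm v <= enorm (u - v).
  by rewrite lerBlDr; have := enormD (u - v) v; rewrite subrK.
by rewrite ler_norml h lerNl opprB enormB_sym h.
Qed.

Lemma enorm_sum I (r : seq I) (P : pred I) (F : I -> 'rV[R]_d) :
  enorm (\sum_(i <- r | P i) F i) <= \sum_(i <- r | P i) enorm (F i).
Proof.
elim/big_rec2: _ => [|i u v _ h]; first by rewrite enorm0.
by rewrite (le_trans (enormD _ _)) // lerD2l.
Qed.

Lemma coord_le_enorm x i : `|x 0 i| <= enorm x.
Proof.
rewrite -sqrtr_sqr /enorm; apply: ler_wsqrtr.
by rewrite (bigD1 i) //= lerDl sumr_ge0 // => j _; exact: sqr_ge0.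
Qed.

Lemma enorm_le_sum x : enorm x <= \sum_(i < d) `|x 0 i|.
Proof.
have -> : x = \sum_(i < d) x 0 i *: delta_mx 0 i :> 'rV[R]_d.
  by rewrite {1}(row_sum_delta x).
apply: le_trans (enorm_sum _ _ _) _; apply: ler_sum => i _.
rewrite enormZ (_ : enorm _ = 1) ?mulr1.
  rewrite summxE (bigD1 i) //= !mxE !eqxx mulr1 big1 ?addr0 // => j ji.
  by rewrite !mxE eqxx [i == j]eq_sym (negbTE ji) mulr0.
rewrite /enorm (bigD1 i) //= mxE !eqxx expr1n big1 ?addr0 ?sqrtr1 // => j ji.
by rewrite mxE eqxx (negbTE ji) expr0n.
Qed.

Lemma norm_le_enorm x : `|x| <= enorm x.
Proof.
have -> : `|x| = mx_norm x by [].
rewrite mx_normrE; apply: bigmax_le => [|[i j] _ /=]; first exact: enorm_ge0.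
by rewrite ord1 coord_le_enorm.
Qed.

Lemma coord_le_norm x i : `|x 0 i| <= `|x|.
Proof.
have -> : `|x| = mx_norm x by [].
by rewrite mx_normrE; apply: (le_bigmax _ (fun k : 'I_1 * 'I_d => `|x k.1 k.2|) (0, i)).
Qed.

Lemma enorm_le_norm x : enorm x <= d%:R * `|x|.
Proof.
apply: le_trans (enorm_le_sum x) _.
apply: (@le_trans _ _ (\sum_(i < d) `|x|)); first by apply: ler_sum => i _; exact: coord_le_norm.
by rewrite sumr_const card_ord mulr_natl.
Qed.

End enorm.

Section cpath_topology.
Context {R : realType} {d : nat} {T : R} {xi : 'rV[R]_d}.
Local Notation C := (cpath T xi).
Implicit Types x y z : C.

(** Translates the uniform structure, which is built on the max norm, into uniform distance for the
    Euclidean norm. *)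
Lemma nbhs_cpathP x (P : set C) : nbhs x P <->
  exists2 e, 0 < e & forall y, (forall t, t \in `[0, T] -> enorm (x t - y t) < e) -> P y.
Proof.
split=> [[_ [[A oA <-] /= Ax AP]]|[e e0 eP]].
  have : nbhs (to_uniform x) A by exact: open_nbhs_nbhs.
  rewrite uniform_nbhs => -[E [entE EA]].
  move: entE; rewrite -entourage_ballE => -[e /= e0 eE].
  exists e => // y hy; apply: AP; apply: EA => t tT; apply: eE => /=.
  by rewrite -ball_normE /=; apply: le_lt_trans (norm_le_enorm _) (hy t tT).
(* [d.+1] bounds the ratio of the Euclidean norm to the max norm and is positive in dimension 0
   too. *)
have d0 : 0 < (d.+1)%:R :> R by [].
have : nbhs (to_uniform x) [set h : {uniform` `[0, T] -> 'rV[R]_d} |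
    forall t, `[0, T]%classic t -> ball (x t) (e / d.+1%:R) (h t)].
  rewrite uniform_nbhs; exists [set p | ball p.1 (e / d.+1%:R) p.2]; split => //.
  by rewrite -entourage_ballE; exists (e / d.+1%:R) => //=; rewrite divr_gt0.
move/(@initial_continuous _ _ (@to_uniform R d T xi)) => h.
apply: (@filterS _ _ (nbhs_filter x) _ P _ h) => y /= hy; apply: eP => t tT.
have := hy t tT; rewrite -ball_normE /= => {}h.
apply: le_lt_trans (enorm_le_norm _) _.
move: h; rewrite ltr_pdivlMr // mulrC; apply: le_lt_trans.
by rewrite ler_wpM2r // ler_nat.
Qed.

Lemma cpath_continuousP (f : C -> R) : continuous (f : C -> R^o) <->
  forall x e, 0 < e -> exists2 dl, 0 < dl &
    forall y, (forall t, t \in `[0, T] -> enorm (x t - y t) < dl) -> `|f x - f y| < e.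
Proof.
split=> [cf x e e0|h x].
  have /nbhs_cpathP[dl dl0 hdl] : nbhs x [set y | `|f x - f y| < e].
    by have /(@cvgrPdist_lt _ R^o _ _ (nbhs_filter x))/(_ e e0) := cf x.
  by exists dl.
apply/(@cvgrPdist_lt _ R^o _ _ (nbhs_filter x)) => e e0; apply/nbhs_cpathP.
by have [dl dl0 hdl] := h x e e0; exists dl.
Qed.

Lemma continuous_cpath_measurable (f : C -> R) : continuous (f : C -> R^o) ->
  measurable_fun setT (f : C -> measurableTypeR R).
Proof.
move=> cf; apply: (@measurability _ _ _ _ setT _ (@RGenOpens.G R)).
  exact: RGenOpens.measurableE.
move=> _ [_ [a [b ->]] <-]; rewrite setTI; apply: sub_sigma_algebra.
by move/continuousP : cf; apply; exact: interval_open.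
Qed.

(** Evaluations, the noise map and the solution map all come with uniform Lipschitz bounds; their
    Borel measurability is obtained from this. *)
Lemma lipschitz_cpath_measurable (f : C -> R) (K : R) :
  (forall x y e, (forall t, t \in `[0, T] -> enorm (x t - y t) <= e) ->
     `|f x - f y| <= K * e) ->
  measurable_fun setT (f : C -> measurableTypeR R).
Proof.
move=> fK; apply: continuous_cpath_measurable; apply/cpath_continuousP => x e e0.
have K0 : 0 < `|K| + 1 by rewrite ltr_pwDr.
exists (e / (`|K| + 1)); first by rewrite divr_gt0.
move=> y hy; apply: (@le_lt_trans _ _ (K * (e / (`|K| + 1)))).
  by apply: fK => t /hy/ltW.
rewrite mulrA ltr_pdivrMr // mulrC ltr_pM2l // (le_lt_trans (ler_norm _)) //.
by rewrite ltrDl.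
Qed.

Lemma measurable_eval t i : t \in `[0, T] ->
  measurable_fun setT ((fun x => x t 0 i) : C -> measurableTypeR R).
Proof.
move=> tT; apply: (@lipschitz_cpath_measurable _ 1) => x y e h.
rewrite mul1r; apply: le_trans (h t tT).
by have := coord_le_enorm (x t - y t) i; rewrite !mxE.
Qed.

Lemma cpath_eqP x y : (forall t, t \in `[0, T] -> x t = y t) -> x = y.
Proof.
move=> h; case: x y h => f cf f0 fo [g cg g0 go] /= h.
have fg : f = g.
  apply/funext => t; have [/h//|tT] := boolP (t \in `[0, T]); by rewrite fo ?go.
subst g; congr Cpath; exact: Prop_irrelevance.
Qed.

Lemma cpath_within_dist x t e : t \in `[0, T] -> 0 < e ->
  exists2 dl, 0 < dl & forall s, s \in `[0, T] -> `|t - s| < dl -> enorm (x t - x s) < e.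
Proof.
move=> tT e0; have d0 : 0 < d.+1%:R :> R by [].
have [dl dl0 h] := within_continuous_dist (@cpath_continuous _ _ _ _ x) tT (divr_gt0 e0 d0).
exists dl => // s sT ts; have := h s sT ts.
rewrite ltr_pdivlMr // mulrC; apply: le_lt_trans; apply: le_trans (enorm_le_norm _) _.
by rewrite ler_wpM2r // ler_nat.
Qed.

Lemma cpath_unif_continuous x e : 0 < e ->
  exists2 dl, 0 < dl & forall s t, s \in `[0, T] -> t \in `[0, T] ->
    `|s - t| < dl -> enorm (x s - x t) < e.
Proof.
move=> e0; have d0 : 0 < d.+1%:R :> R by [].
have [dl dl0 h] := compact_unif_continuous (@segment_compact R 0 T)
  (@cpath_continuous _ _ _ _ x) (divr_gt0 e0 d0).
exists dl => // s t sT tT st; have := h s t sT tT st.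
rewrite ltr_pdivlMr // mulrC; apply: le_lt_trans; apply: le_trans (enorm_le_norm _) _.
by rewrite ler_wpM2r // ler_nat.
Qed.

End cpath_topology.

Section make_cpath.
Context {R : realType} {d : nat} {T : R} (xi : 'rV[R]_d).

(** An epsilon-delta form in the Euclidean norm, which is easy to check for sums, limits and
    integrals and ignores the values outside [[0, T]]. *)
Definition path_cont (f : R -> 'rV[R]_d) := forall t e, t \in `[0, T] -> 0 < e ->
  exists2 dl, 0 < dl & forall s, s \in `[0, T] -> `|t - s| < dl -> enorm (f t - f s) < e.

Lemma cpath_exists (f : R -> 'rV[R]_d) : path_cont f -> f 0 = xi ->
  exists x : cpath T xi, forall t, t \in `[0, T] -> x t = f t.
Proof.
move=> cf f0; pose g t := if t \in `[0, T] then f t else xi.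
have cg : {within `[0, T], continuous g}.
  apply/subspace_continuousP => t tT; apply/cvgrPdist_lt => e e0.
  have [dl dl0 h] := cf t e tT e0.
  rewrite /within /=; exists dl => //= s ts sT.
  have gE r : r \in `[0, T] -> g r = f r by move=> rT; rewrite /g rT.
  rewrite -[X in X < _]/(`|g t - g s|) (gE t tT) (gE s sT).
  apply: le_lt_trans (norm_le_enorm _) _.
  exact: h.
have g0 : g 0 = xi by rewrite /g; case: ifP.
have go t : t \notin `[0, T] -> g t = xi by rewrite /g => /negbTE ->.
by exists (Cpath cg g0 go) => t tT /=; rewrite /g tT.
Qed.

(** Total in [f]: the value is meaningful under the hypotheses of [to_cpathE]. *)
Definition to_cpath (f : R -> 'rV[R]_d) : cpath T xi :=
  get [set x : cpath T xi | forall t, t \in `[0, T] -> x t = f t].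

Lemma to_cpathE (f : R -> 'rV[R]_d) : path_cont f -> f 0 = xi ->
  forall t, t \in `[0, T] -> to_cpath f t = f t.
Proof. move=> cf f0.
exact: (@getPex _ [set x : cpath T xi | forall t, t \in `[0, T] -> x t = f t] (cpath_exists cf f0)). Qed.

Lemma path_cont_cpath (x : cpath T xi) : path_cont x.
Proof. by move=> t e; exact: cpath_within_dist. Qed.

End make_cpath.
Arguments path_cont {R d} T f.

(** * Borel sets of the path space and evaluations *)

Section generated.
Context {R : realType} {d : nat} {T : R} {xi : 'rV[R]_d}.
Hypothesis T0 : 0 < T.
Local Notation C := (cpath T xi).

(** Rational fractions of [T] instead of rational times, so that the end point [T] is among them. *)
Definition rtime (p : rat) : R := T * ratr p.

(* the [k]-th coordinate functional: pairs (rational time, coordinate) are enumerated *)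
Definition ev (k : nat) (x : C) : measurableTypeR R :=
  if unpickle k is Some (p, i) then
    if rtime p \in `[0, T] then x (rtime p) 0 (i : 'I_d) else 0
  else 0.

Lemma evE (p : rat) (i : 'I_d) x : rtime p \in `[0, T] ->
  ev (pickle (p, i)) x = x (rtime p) 0 i.
Proof. by move=> pT; rewrite /ev pickleK pT. Qed.

Lemma measurable_ev k : measurable_fun setT (ev k).
Proof.
rewrite /ev; case: (unpickle k) => [[p i]|] //.
by have [pT|pT] := boolP (rtime p \in `[0, T]); [exact: measurable_eval|exact: measurable_cst].
Qed.

Lemma rtime_dense t e : t \in `[0, T] -> 0 < e ->
  exists2 p, rtime p \in `[0, T] & `|t - rtime p| < e.
Proof.
rewrite in_itv /= => /andP[t0 tT] e0.
have [tT'|] := ltP t T; last first.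
  move=> Tt; exists 1; rewrite /rtime rmorph1 mulr1 ?in_itv /= ?lexx ?(ltW T0) //.
  by rewrite (_ : t - T = 0) ?normr0 //; apply/eqP; rewrite subr_eq0 eq_le tT.
have h : t / T < Num.min 1 ((t + e) / T).
  by rewrite lt_min ltr_pdivrMr // mul1r tT' ltr_pM2r ?invr_gt0 // ltrDl.
have [p] := rat_in_itvoo h; rewrite in_itv /= lt_min => /and3P[p1 p2 p3].
move: p1 p3; rewrite ltr_pdivrMr // ltr_pdivlMr // [_ * T]mulrC -/(rtime p) => p1 p3.
exists p.
  rewrite in_itv /= (le_trans t0 (ltW p1)) /rtime -[leRHS]mulr1 ler_pM2l // ltW //.
by rewrite distrC ger0_norm ?subr_ge0 ?(ltW p1) //; lra.
Qed.

Local Notation evG := (cylG ev).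

Local Notation CG := (g_sigma_algebraType evG).

Let measurable_evG := @measurable_cylG R C ev.

(* step functions with rational values on the grid of mesh [T / (size s).-1] *)
Let stepf (s : seq (seq rat)) (t : R) (i : 'I_d) : R :=
  ratr (nth 0 (nth [::] s (Num.truncn (t * (size s).-1%:R / T))) i).

(** A countable family of sets, each given by conditions at countably many times and thus measurable
    for the evaluations. Every open set is a union of such sets by [nbh_base]. *)
Let nbh (s : seq (seq rat)) (m : nat) : set C :=
  [set x : C | forall p i, rtime p \in `[0, T] -> `|x (rtime p) 0 i - stepf s (rtime p) i| <= m.+1%:R^-1].

Let measurable_nbh s m : measurable (nbh s m : set CG).
Proof.
pose B k : set (measurableTypeR R) := if unpickle k is Some (p, i) then
    if rtime p \in `[0, T] then
      `[stepf s (rtime p) (i : 'I_d) - m.+1%:R^-1, stepf s (rtime p) i + m.+1%:R^-1]%classic else setT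
  else setT.
have mB k : measurable (B k).
  by rewrite /B; case: (unpickle k) => [[p i]|] //; case: ifP.
have -> : nbh s m = \bigcap_k (ev k @^-1` B k).
  apply/seteqP; split => x /=.
    move=> h k _ /=; rewrite /ev /B; case: (unpickle k) => [[p i]|] //=; case: ifPn => // pT.
    by have := h p i pT; rewrite ler_distl /= in_itv.
  move=> h p i pT; have hk k : B k (ev k x) := h k I.
  have BE : B (pickle (p, i)) = `[stepf s (rtime p) i - m.+1%:R^-1, stepf s (rtime p) i + m.+1%:R^-1]%classic.
    by rewrite /B pickleK pT.
  have ek := evE i x pT; move: (hk (pickle (p, i))) ek BE {h}.
  by move: (pickle (p, i)) => k hB ek BE; rewrite BE ek in hB; rewrite ler_distl.
by apply: bigcapT_measurable => k; exact: measurable_evG.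
Qed.

Let nbh_base (U : set C) y : open U -> U y -> exists s m, nbh s m y /\ nbh s m `<=` U.
Proof.
move=> oU Uy; have /nbhs_cpathP[e e0 eU] : nbhs y U by exact: open_nbhs_nbhs.
(* Coordinates within [2 h] cost at most [2 h d <= e / 2] in Euclidean norm; moving to a time
   [rtime p] costs [e / 4] for each of [y] and [z]. *)
have e4 : 0 < e / (4 * d.+1%:R) by rewrite divr_gt0 // mulr_gt0.
have [m hm] : exists m : nat, m.+1%:R^-1 < e / (4 * d.+1%:R).
  have [N _ /(_ N (leqnn N)) h] := near_infty_natSinv_lt (PosNum e4).
  by exists N.
set h : R := m.+1%:R^-1 in hm.
have h0 : 0 < h by rewrite invr_gt0.
have h20 : 0 < h / 2 by rewrite divr_gt0.
have [dl dl0 hdl] := cpath_unif_continuous y h20.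
have [n hn] : exists n : nat, T / n.+1%:R < dl.
  have [N _ /(_ N (leqnn N)) hN] := near_infty_natSinv_lt (PosNum (divr_gt0 dl0 T0)).
  by exists N; rewrite /= ltr_pdivlMr // mulrC in hN.
pose tj j : R := j%:R * (T / n.+1%:R).
have [v hv] : exists v : nat -> 'I_d -> rat, forall j i, `|ratr (v j i) - y (tj j) 0 i| < h / 2.
  have /choice[f hf] : forall ji : nat * 'I_d, exists q : rat, `|ratr q - y (tj ji.1) 0 ji.2| < h / 2.
    move=> [j i] /=; have hlt : y (tj j) 0 i < y (tj j) 0 i + h / 2 by rewrite ltrDl.
    have [q] := rat_in_itvoo hlt; rewrite in_itv /= => /andP[q1 q2]; exists q.
    by rewrite ltr_norml; apply/andP; split; lra.
  by exists (fun j i => f (j, i)) => j i; exact: (hf (j, i)).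
(* There are [n.+2] values because the truncated index reaches [n.+1] at [t = T]. *)
pose s := mkseq (fun j => [seq v j i | i <- enum 'I_d]) n.+2.
have sE t i : t \in `[0, T] -> `|y t 0 i - stepf s t i| <= h.
  rewrite in_itv /= => /andP[t0 tT]; rewrite /stepf size_mkseq /=.
  set j := Num.truncn _.
  have u0 : 0 <= t * n.+1%:R / T by rewrite divr_ge0 ?mulr_ge0 ?(ltW T0).
  have /andP[j1 j2] : j%:R <= t * n.+1%:R / T < j.+1%:R by exact: truncn_itv.
  have jn : (j <= n.+1)%N.
    rewrite -(ler_nat R) (le_trans j1) // ler_pdivrMr // mulrC ler_pM2l //.
  rewrite nth_mkseq ?ltnS // (nth_map i) ?size_enum_ord // nth_ord_enum.
  have tjt : tj j <= t by move: j1; rewrite ler_pdivlMr // /tj mulrA ler_pdivrMr.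
  have tjt' : t < tj j + T / n.+1%:R.
    have -> : tj j + T / n.+1%:R = j.+1%:R * T / n.+1%:R by rewrite /tj -natr1; ring.
    by rewrite ltr_pdivlMr // -ltr_pdivrMr.
  have jT : tj j \in `[0, T].
    by rewrite in_itv /= mulr_ge0 ?divr_ge0 ?(ltW T0) //= (le_trans tjt).
  have h1 : `|y t 0 i - y (tj j) 0 i| < h / 2.
    have := coord_le_enorm (y t - y (tj j)) i; rewrite !mxE => /le_lt_trans; apply.
    apply: hdl => //; first by rewrite in_itv /= t0.
    by rewrite ger0_norm ?subr_ge0 //; move: hn tjt'; set w := T / _; lra.
  have h2 := hv j i.
  rewrite -(subrK (y (tj j) 0 i) (y t 0 i)) -addrA (le_trans (ler_normD _ _)) //.
  rewrite distrC in h2; move: h1 h2 ; set a := `|_|; set b := `|_|; lra.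
exists s, m; split; first by move=> p i pT; exact: sE.
move=> z hz; apply: eU => t tT.
have e40 : 0 < e / 4 by rewrite divr_gt0.
have [d1 d10 hd1] := cpath_within_dist y tT e40.
have [d2 d20 hd2] := cpath_within_dist z tT e40.
have [p pT hp] : exists2 p, rtime p \in `[0, T] & `|t - rtime p| < Num.min d1 d2.
  by apply: rtime_dense => //; rewrite lt_min d10.
move: hp; rewrite lt_min => /andP[hp1 hp2].
have H1 := hd1 _ pT hp1; have H2 := hd2 _ pT hp2.
have H3 : enorm (y (rtime p) - z (rtime p)) <= e / 2.
  apply: le_trans (enorm_le_sum _) _.
  apply: (@le_trans _ _ (\sum_(i < d) (2 * h))).
    apply: ler_sum => i _; rewrite !mxE.
    have a1 := sE _ i pT; have a2 := hz p i pT.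
    rewrite -(subrK (stepf s (rtime p) i) (y (rtime p) 0 i)) -addrA (le_trans (ler_normD _ _)) //.
    by rewrite distrC in a2; move: a1 a2; rewrite -/h; set a := `|_|; set b := `|_|; lra.
  rewrite sumr_const card_ord -mulr_natl.
  move: hm; rewrite ltr_pdivlMr ?mulr_gt0 // => hm.
  have dd : d%:R <= d.+1%:R :> R by rewrite ler_nat.
  have : h * d%:R <= h * d.+1%:R by rewrite ler_pM2l.
  lra.
have -> : y t - z t = (y t - y (rtime p)) + (y (rtime p) - z (rtime p)) + (z (rtime p) - z t).
  by rewrite !addrA !subrK.
apply: le_lt_trans (enormD _ _) _.
have := enormD (y t - y (rtime p)) (y (rtime p) - z (rtime p)).
rewrite [enorm (z _ - z t)]enormB_sym; lra.
Qed.

(** Every open set is a countable union of sets [nbh], and each of these is a countable intersection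
    of evaluation events. A law on paths is thus determined by its finite families of
    evaluations. *)
Lemma cpath_measurableE : @measurable _ C = <<s evG >>.
Proof.
apply/seteqP; split; last first.
  apply: smallest_sub; first exact: sigma_algebra_measurable.
  move=> _ [n _ [B [mB ->]]]; apply: measurable_cyl => // k _; exact: measurable_ev.
rewrite [X in X `<=` _](_ : _ = <<s open >>) //; apply: smallest_sub.
  exact: smallest_sigma_algebra.
move=> U oU.
pose good (k : nat) := if unpickle k is Some (s, m) then if `[< nbh s m `<=` U >] then nbh s m else set0 else set0.
have -> : U = \bigcup_k good k.
  apply/seteqP; split => [y Uy|y [k _]].
    have [s [m [h1 h2]]] := nbh_base oU Uy.
    by exists (pickle (s, m)) => //; rewrite /good pickleK ifT //; exact/asboolP.
  rewrite /good; case: (unpickle k) => [[s m]|] //.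
  by case: ifPn => // /asboolP h /h.
apply: (@bigcupT_measurable _ CG) => k; rewrite /good; case: (unpickle k) => [[s m]|].
  by case: ifPn => _; [exact: measurable_nbh|exact: measurable0].
exact: measurable0.
Qed.

Lemma cpath_measurable_fun d' (E : measurableType d') (F : E -> C) :
  (forall p i, rtime p \in `[0, T] ->
     measurable_fun setT ((fun y => F y (rtime p) 0 i) : E -> measurableTypeR R)) ->
  measurable_fun setT F.
Proof.
move=> mF; apply: (@measurability _ _ _ _ setT _ evG); first exact: cpath_measurableE.
move=> _ [_ [n _ [B [mB ->]]] <-]; rewrite setTI.
have -> : F @^-1` cyl ev n B = cyl (fun k y => ev k (F y)) n B by [].
apply: measurable_cyl => // k _; rewrite /ev; case: (unpickle k) => [[p i]|] //.
by have [pT|pT] := boolP (rtime p \in `[0, T]); [exact: mF|exact: measurable_cst].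
Qed.

Lemma cpath_prob_eq (m1 m2 : probability C R) :
  (forall n B, (forall k, measurable (B k)) -> m1 (cyl ev n B) = m2 (cyl ev n B)) ->
  forall A, measurable A -> m1 A = m2 A.
Proof.
move=> h; apply: (prob_eq_generated cpath_measurableE (setI_closed_cylG (z := ev)) (cylGT ev)).
  exact: (le_lt_trans (probability_le1 m1 measurableT) (ltry _)).
by move=> _ [n _ [B [mB ->]]]; exact: h.
Qed.

End generated.

(** * The Ito map *)

Lemma primitive_exists (R : realType) (g : R -> R) : continuous g ->
  exists G : R -> R, (forall x : R, 0 <= x -> is_derive x (1:R) G (g x)) /\
    forall t : R, 0 <= t -> \int[lebesgue_measure]_(s in `[0, t]) g s = G t - G 0.
Proof.
move=> cg.
have gi (u v : R) : lebesgue_measure.-integrable `[u, v] (EFin \o g).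
  by apply: continuous_compact_integrable; [exact: segment_compact|exact: continuous_subspaceT].
(* Integrating from -1 makes the primitive differentiable from both sides at 0. *)
exists (fun t => \int[lebesgue_measure]_(s in `[-1, t]) g s); split.
  move=> x x0; have x1 : x < x + 1 by rewrite ltrDl.
  have x2 : -1 < x by rewrite (lt_le_trans _ x0) // ltrN10.
  have [h1 h2] := continuous_FTC1_closed x1 (gi (-1) (x + 1)) x2 (cg x).
  exact: (DeriveDef h1 (etrans (esym (derive1E _ _)) h2)).
move=> t t0; rewrite (@Rintegral_itvB _ g (BLeft (-1)) (BRight t) 0).
- rewrite Rintegral_itv_obnd_cbnd //.
  by apply: integrableS (gi 0 t) => //; apply: subset_itvr; rewrite bnd_simp.
- exact: gi.
- by rewrite bnd_simp oppr_le0.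
- by rewrite bnd_simp.
Qed.

Section vector_integral.
Context {R : realType} {d : nat}.

(** Projection on [v = V t - V r]: by Cauchy-Schwarz [|v| G - <v, V>] is nondecreasing, and its
    increment from [r] to [t] is [|v| (G t - G r) - |v|^2]. *)
Lemma enorm_integral (g : R -> 'rV[R]_d) (u G : R -> R) (V : R -> 'rV[R]_d) (r t : R) :
  (forall i (s : R), 0 <= s -> is_derive s (1:R) (fun s => V s 0 i) (g s 0 i)) ->
  (forall s : R, 0 <= s -> is_derive s (1:R) G (u s)) ->
  0 <= r <= t -> (forall s, r <= s <= t -> enorm (g s) <= u s) ->
  enorm (V t - V r) <= G t - G r.
Proof.
move=> dV dG /andP[r0 rt] gu; set v := V t - V r.
have [v0|v0] := eqVneq (enorm v) 0.
  rewrite v0 subr_ge0; apply: (@is_derive_ge0_le _ G u r t) => //.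
    by move=> x; rewrite in_itv /= => /andP[h _]; apply: dG; exact: le_trans h.
  by move=> x; rewrite in_itv /= => /gu; apply: le_trans; exact: enorm_ge0.
have {}v0 : 0 < enorm v by rewrite lt_neqAle eq_sym v0 enorm_ge0.
rewrite -(ler_pM2l v0) -expr2 sqr_enorm.
pose psi s := enorm v * G s - \sum_(i < d) v 0 i * V s 0 i.
have : psi r <= psi t.
  apply: (@is_derive_ge0_le _ psi (fun s => enorm v * u s - \sum_(i < d) v 0 i * g s 0 i)) => //.
    move=> x; rewrite in_itv /= => /andP[h _]; have x0 := le_trans r0 h.
    apply: is_deriveB; first by apply: is_deriveZ; exact: dG.
    rewrite (_ : (fun s => _) = \sum_(i < d) (fun s => v 0 i * V s 0 i)); last first.
      by apply/funext => s; rewrite fct_sumE.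
    by apply: is_derive_sum => i; apply: is_deriveZ; exact: dV.
  move=> x; rewrite in_itv /= => /gu h; rewrite subr_ge0.
  by apply: le_trans (enorm_CS _ _) _; rewrite ler_pM2l.
rewrite /psi mulrBr lerBlDr -subr_ge0 => h.
have -> : \sum_(i < d) v 0 i ^+ 2 = \sum_(i < d) v 0 i * V t 0 i - \sum_(i < d) v 0 i * V r 0 i.
  rewrite -sumrB; apply: eq_bigr => i _; rewrite -mulrBr expr2; congr (_ * _).
  by rewrite /v !mxE.
move: h; set a := \sum_(i < d) _; set b := \sum_(i < d) _; lra.
Qed.

End vector_integral.

Section clamp.
Context {R : realType} {d : nat} (T : R).
Hypothesis T0 : 0 < T.

(** Precomposition with [clamp T] extends a path from [[0, T]] to a continuous function on the line,
    to which the fundamental theorem of calculus applies; [clamp 1] later supplies the ramps of the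
    interpolation. *)
Definition clamp (t : R) : R := Num.max 0 (Num.min t T).

Lemma clamp_in t : clamp t \in `[0, T].
Proof. by rewrite /clamp in_itv /= le_max lexx ge_max (ltW T0) ge_min lexx orbT. Qed.

Lemma clampE t : t \in `[0, T] -> clamp t = t.
Proof. by rewrite in_itv /= => /andP[t0 tT]; rewrite /clamp (min_l tT) (max_r t0). Qed.

Lemma clamp_dist s t : `|clamp s - clamp t| <= `|s - t|.
Proof.
rewrite /clamp.
have T0' := T0.
have := ler_norm (s - t); have := ler_norm (t - s); rewrite distrC.
move: `|s - t| => a ha hb.
case: (leP s T) => hs; case: (leP t T) => ht; rewrite ?(max_r (ltW T0));
  case: (leP 0 s) => h1; case: (leP 0 t) => h2;
  rewrite ler_norml; apply/andP; split; lra.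
Qed.

Lemma continuous_clamp (g : R -> R) (K : R) (f : R -> 'rV[R]_d) : path_cont T f ->
  (forall s t, s \in `[0, T] -> t \in `[0, T] -> `|g s - g t| <= K * enorm (f s - f t)) ->
  continuous (g \o clamp).
Proof.
move=> cf gf t; apply/cvgrPdist_lt => e e0.
have K0 : 0 < `|K| + 1 by rewrite ltr_pwDr.
have [dl dl0 h] := cf (clamp t) (e / (`|K| + 1)) (clamp_in t) (divr_gt0 e0 K0).
exists dl => //= s ts; apply: le_lt_trans (gf _ _ (clamp_in t) (clamp_in s)) _.
have := h (clamp s) (clamp_in s) (le_lt_trans (clamp_dist t s) ts).
rewrite ltr_pdivlMr // => h1; apply: le_lt_trans h1; rewrite mulrC ler_wpM2l ?enorm_ge0 //.
by rewrite (le_trans (ler_norm K)) // lerDl.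
Qed.

End clamp.

Lemma enorm_eq0 (R : realType) (d : nat) (x : 'rV[R]_d) : (enorm x == 0) = (x == 0).
Proof.
apply/eqP/eqP => [h|->]; last exact: enorm0.
apply/rowP => i; rewrite mxE; apply/eqP; rewrite -normr_le0 -h; exact: coord_le_enorm.
Qed.

Lemma geometric_small (R : realType) (D e : R) : 0 < e -> exists n : nat, D / 2 ^+ n < e.
Proof.
move=> e0; exists (Num.truncn (`|D| / e)).+1; rewrite ltr_pdivrMr ?exprn_gt0 //.
set N := (Num.truncn _).+1.
have h1 : `|D| / e < N%:R by exact: truncnS_gt.
have h2 : N%:R <= 2 ^+ N :> R by rewrite -natrX ler_nat ltnW // ltn_expl.
rewrite ltr_pdivrMr // in h1.
have h3 : N%:R * e <= 2 ^+ N * e by rewrite ler_pM2r.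
have := ler_norm D; lra.
Qed.

Section path_cont_facts.
Context {R : realType} {d : nat} {T : R}.
Hypothesis T0 : 0 < T.
Implicit Types f g : R -> 'rV[R]_d.

Lemma path_contD f g : path_cont T f -> path_cont T g -> path_cont T (fun t => f t + g t).
Proof.
move=> cf cg t e tT e0; have e2 : 0 < e / 2 by rewrite divr_gt0.
have [d1 d10 h1] := cf t _ tT e2; have [d2 d20 h2] := cg t _ tT e2.
exists (Num.min d1 d2); first by rewrite lt_min d10.
move=> s sT; rewrite lt_min => /andP[/(h1 s sT) {}h1 /(h2 s sT) {}h2].
have -> : f t + g t - (f s + g s) = (f t - f s) + (g t - g s) by rewrite opprD addrACA.
by apply: le_lt_trans (enormD _ _) _; lra.
Qed.

Lemma path_contN f : path_cont T f -> path_cont T (fun t => - f t).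
Proof.
move=> cf t e tT e0; have [dl dl0 h] := cf t e tT e0.
by exists dl => // s sT /(h s sT); rewrite -opprD enormN.
Qed.

Lemma path_contB f g : path_cont T f -> path_cont T g -> path_cont T (fun t => f t - g t).
Proof. by move=> cf cg; exact: path_contD (path_contN cg). Qed.

Lemma path_cont_cst (v : 'rV[R]_d) : path_cont T (fun=> v).
Proof. by move=> t e tT e0; exists 1 => // s _ _; rewrite subrr enorm0. Qed.

Lemma path_cont_bounded f : path_cont T f ->
  exists2 K, 0 <= K & forall t, t \in `[0, T] -> enorm (f t) <= K.
Proof.
move=> cf; have h : continuous ((fun t => enorm (f t)) \o clamp T).
  apply: (continuous_clamp T0 (K := 1) cf) => s t _ _; rewrite mul1r; exact: enorm_distB.
have [c cT hc] := EVT_max (ltW T0) (continuous_subspaceT h).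
exists (enorm (f (clamp T c))); first exact: enorm_ge0.
by move=> t tT; have := hc t tT; rewrite /= clampE.
Qed.

Lemma path_cont_unif (fn : nat -> R -> 'rV[R]_d) f (D : R) :
  (forall n, path_cont T (fn n)) ->
  (forall n t, t \in `[0, T] -> enorm (f t - fn n t) <= D / 2 ^+ n) -> path_cont T f.
Proof.
move=> cfn hf t e tT e0.
have D0 : 0 <= D.
  by have := hf 0%N t tT; rewrite expr0 divr1; apply: le_trans; exact: enorm_ge0.
have [n hn] : exists n : nat, D / 2 ^+ n < e / 4.
  by apply: geometric_small; rewrite divr_gt0.
have e2 : 0 < e / 2 by rewrite divr_gt0.
have [dl dl0 h] := cfn n t _ tT e2.
exists dl => // s sT /(h s sT) {}h.
have -> : f t - f s = (f t - fn n t) + (fn n t - fn n s) + (fn n s - f s).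
  by rewrite !addrA !subrK.
have h1 := hf n t tT; have h2 := hf n s sT.
apply: le_lt_trans (enormD _ _) _; rewrite [enorm (fn n s - _)]enormB_sym.
have := enormD (f t - fn n t) (fn n t - fn n s); lra.
Qed.

End path_cont_facts.

(** The intervals of radius [2 C / 2^n] around [u n] are nested, and the supremum of their left ends
    lies in all of them. *)
Lemma geometric_limit (R : realType) (u : nat -> R) (C : R) :
  (forall n, `|u n.+1 - u n| <= C / 2 ^+ n) ->
  exists l, forall n, `|l - u n| <= 2 * C / 2 ^+ n.
Proof.
move=> hu; pose lo n := u n - 2 * C / 2 ^+ n; pose hi n := u n + 2 * C / 2 ^+ n.
have half n : C / 2 ^+ n = 2 * C / 2 ^+ n.+1.
  by rewrite exprS invfM mulrACA mulfV // mul1r.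
have los n : lo n <= lo n.+1.
  have := hu n; rewrite ler_norml /lo -half => /andP[h _].
  by move: h; rewrite -[2 * C / 2 ^+ n]mulrA; set a := C / _; lra.
have his n : hi n.+1 <= hi n.
  have := hu n; rewrite ler_norml /hi -half => /andP[_ h].
  by move: h; rewrite -[2 * C / 2 ^+ n]mulrA; set a := C / _; lra.
have C0 : 0 <= C.
  by have := hu 0%N; rewrite expr0 divr1; apply: le_trans.
have lohi n m : lo n <= hi m.
  have lon k : lo n <= lo (n + k)%N by elim: k => [|k ih]; rewrite ?addn0 // addnS (le_trans ih).
  have him k : hi (m + k)%N <= hi m by elim: k => [|k ih]; rewrite ?addn0 // addnS (le_trans _ ih).
  apply: le_trans (lon m) _; apply: le_trans (him n); rewrite [(m + n)%N]addnC /lo /hi lerD2l.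
  by rewrite ge0_cp // ?mulr_ge0 ?invr_ge0 ?exprn_ge0.
have hs : has_sup [set lo n | n in setT].
  split; first by exists (lo 0%N); exists 0%N.
  by exists (hi 0%N) => _ [n _ <-].
exists (sup [set lo n | n in setT]) => n; rewrite ler_distl; apply/andP; split.
  by apply: ub_le_sup; [case: hs|exists n].
apply: sup_le_ub; first by case: hs.
by move=> _ [m _ <-]; exact: lohi.
Qed.

Section ito_map.
Context {R : realType} {d : nat} {T : R} (xi : 'rV[R]_d).
Variables (b : 'rV[R]_d -> 'rV[R]_d) (L : R).
Hypotheses (T0 : 0 < T) (hL : 0 < L).
Hypothesis hb : forall x y : 'rV[R]_d, enorm (b x - b y) <= L * enorm (x - y).
Implicit Types (f g x y : R -> 'rV[R]_d).

Definition drift_int f (t : R) : 'rV[R]_d :=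
  \row_(i < d) \int[lebesgue_measure]_(s in `[0, t]) (b (f s)) 0 i.
Local Notation bI := drift_int.

Let b_cont f i : path_cont T f -> continuous (fun s => b (f (clamp T s)) 0 i).
Proof.
move=> cf; apply: (continuous_clamp T0 (g := fun s => b (f s) 0 i) (K := L) cf) => s t _ _.
apply: le_trans (hb _ _).
by have := coord_le_enorm (b (f s) - b (f t)) i; rewrite !mxE.
Qed.

Let bI_prim f : path_cont T f -> exists V : R -> 'rV[R]_d,
  (forall i (s : R), 0 <= s -> is_derive s (1:R) (fun s => V s 0 i) (b (f (clamp T s)) 0 i)) /\
  forall t, t \in `[0, T] -> bI f t = V t - V 0.
Proof.
move=> cf; have /choice[G hG] := fun i => primitive_exists (@b_cont f i cf).
exists (fun t => \row_i G i t); split=> [i s s0|t tT].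
  have -> : (fun s => (\row_i G i s) 0 i) = G i by apply/funext => r; rewrite mxE.
  by have [h _] := hG i; exact: h.
apply/rowP => i; rewrite !mxE; have [_ <-] := hG i; last by move: tT; rewrite in_itv => /andP[].
apply: eq_Rintegral => s; rewrite inE /= in_itv /= => /andP[s0 st]; rewrite clampE // in_itv /= s0.
by move: tT; rewrite in_itv /= => /andP[_]; exact: le_trans.
Qed.

Lemma drift_int0 f : path_cont T f -> bI f 0 = 0.
Proof.
move=> cf; have [V [_ ->]] := bI_prim cf; first by rewrite subrr.
by rewrite in_itv /= lexx ltW.
Qed.

(** The majorant [u] and its primitive [G] are left free: the Picard contraction, Gronwall's lemma
    and the Lipschitz bound of the drift each choose their own. *)
Lemma drift_int_diff f g (u G : R -> R) r t : path_cont T f -> path_cont T g ->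
  (forall s : R, 0 <= s -> is_derive s (1:R) G (u s)) ->
  (forall s, s \in `[0, T] -> L * enorm (f s - g s) <= u s) ->
  0 <= r -> r <= t -> t <= T ->
  enorm ((bI f t - bI g t) - (bI f r - bI g r)) <= G t - G r.
Proof.
move=> cf cg dG hu r0 rt tT.
have [V [dV VE]] := bI_prim cf; have [W [dW WE]] := bI_prim cg.
have tI : t \in `[0, T] by rewrite in_itv /= tT (le_trans r0).
have rI : r \in `[0, T] by rewrite in_itv /= r0 (le_trans rt).
have -> : (bI f t - bI g t) - (bI f r - bI g r) = (V t - W t) - (V r - W r).
  rewrite !VE ?WE //; apply/rowP => i; rewrite !mxE; ring.
apply: (enorm_integral (g := fun s => b (f (clamp T s)) - b (g (clamp T s))) (u := u)
  (V := fun s => V s - W s)) => //.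
- move=> i s s0; rewrite !mxE.
  have -> : (fun s => (V s - W s) 0 i) = (fun s => V s 0 i - W s 0 i).
    by apply/funext => z; rewrite !mxE.
  by apply: is_deriveB; [exact: dV|exact: dW].
- by rewrite r0.
move=> s /andP[rs st]; have sI : s \in `[0, T] by rewrite in_itv /= (le_trans r0 rs) (le_trans st).
by rewrite clampE // (le_trans (hb _ _)) // hu.
Qed.

Lemma path_cont_drift_int f : path_cont T f -> path_cont T (bI f).
Proof.
move=> cf; have cu : continuous ((fun s => enorm (b (f s))) \o clamp T).
  apply: (continuous_clamp T0 (K := L) cf) => s t _ _.
  exact: le_trans (enorm_distB _ _) (hb _ _).
have [G [dG _]] := primitive_exists cu; have [V [dV VE]] := bI_prim cf.
have inc r t : 0 <= r -> r <= t -> t <= T -> enorm (bI f t - bI f r) <= G t - G r.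
  move=> r0 rt tT.
  have tI : t \in `[0, T] by rewrite in_itv /= tT (le_trans r0).
  have rI : r \in `[0, T] by rewrite in_itv /= r0 (le_trans rt).
  have -> : bI f t - bI f r = V t - V r by rewrite !VE // opprB addrA subrK.
  apply: (enorm_integral dV dG); first by rewrite r0.
  by move=> s _ /=.
move=> t e tI e0.
have t0 : 0 <= t by move: tI; rewrite in_itv => /andP[].
have cG : {for t, continuous G} by exact: is_derive_continuous (dG t t0).
have /cvgrPdist_lt/(_ e e0)[dl /= dl0 h] := cG.
exists dl => // s sI ts; have hts := h s ts.
have [st|ts'] := leP s t.
  apply: le_lt_trans (inc s t _ st _) _; [by move: sI; rewrite in_itv => /andP[]|by move: tI; rewrite in_itv => /andP[]|].
  exact: le_lt_trans (ler_norm _) hts.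
rewrite enormB_sym; apply: le_lt_trans (inc t s t0 (ltW ts') _) _; first by move: sI; rewrite in_itv => /andP[].
by apply: le_lt_trans (ler_norm _) _; rewrite distrC.
Qed.

Definition ito_step x f (t : R) : 'rV[R]_d := xi + bI f t + x t.
Local Notation S := ito_step.

Lemma path_cont_ito_step x f : path_cont T x -> path_cont T f -> path_cont T (S x f).
Proof.
move=> cx cf; apply: path_contD => //; apply: path_contD; first exact: path_cont_cst.
exact: path_cont_drift_int.
Qed.

Let ito_stepB x f g t : S x f t - S x g t = bI f t - bI g t.
Proof. by rewrite /S; apply/rowP => i; rewrite !mxE; ring. Qed.

(** With the weight [exp(2 L s)], integrating [L K exp(2 L s)] gives half of the constant, whatever
    the length of the interval. *)
Lemma ito_step_contract x f g (K : R) : 0 <= K -> path_cont T f -> path_cont T g ->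
  (forall s, s \in `[0, T] -> enorm (f s - g s) <= K * expR (2 * L * s)) ->
  forall t, t \in `[0, T] -> enorm (S x f t - S x g t) <= K / 2 * expR (2 * L * t).
Proof.
move=> K0 cf cg h t; rewrite in_itv /= => /andP[t0 tT]; rewrite ito_stepB.
pose G (s : R) := K / 2 * expR (2 * L * s).
have dG (s : R) : 0 <= s -> is_derive s (1:R) G (L * (K * expR (2 * L * s))).
  by move=> _; apply: is_derive_eq; rewrite /GRing.scale /=; field.
have := drift_int_diff cf cg dG _ (lexx 0) t0 tT.
rewrite !drift_int0 // !subr0 => /(_ _)/le_trans; apply.
  by move=> s sI; rewrite ler_pM2l // h.
by rewrite gerBl mulr_ge0 ?divr_ge0 ?expR_ge0.
Qed.

(** Picard iteration: the contraction in the weighted norm becomes a geometric bound in the uniform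
    norm at the price of the factor [exp(2 L T)]. *)
Lemma ito_exists x : path_cont T x -> exists f, path_cont T f /\
  forall t, t \in `[0, T] -> f t = S x f t.
Proof.
move=> cx; pose fn n := iter n (S x) (fun=> xi).
have cfn n : path_cont T (fn n).
  by elim: n => [|n ih]; [exact: path_cont_cst|exact: path_cont_ito_step].
have [K K0 hK] := path_cont_bounded T0 (path_contB (cfn 1%N) (cfn 0%N)).
have step n t : t \in `[0, T] -> enorm (fn n.+1 t - fn n t) <= K / 2 ^+ n * expR (2 * L * t).
  elim: n t => [|n ih] t tI.
    rewrite expr0 divr1; apply: le_trans (hK t tI) _; rewrite ler_peMr // -expR0 ler_expR.
    by move: tI; rewrite in_itv /= => /andP[t0 _]; rewrite !mulr_ge0 // ltW.
  have K0n : 0 <= K / 2 ^+ n by rewrite divr_ge0 ?exprn_ge0.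
  have h := @ito_step_contract x _ _ _ K0n (cfn n.+1) (cfn n) ih t tI.
  by apply: le_trans h _; rewrite exprSr invfM mulrA.
pose C := K * expR (2 * L * T).
have hC n t : t \in `[0, T] -> enorm (fn n.+1 t - fn n t) <= C / 2 ^+ n.
  move=> tI; apply: le_trans (step n t tI) _; rewrite /C mulrAC ler_pM2r ?invr_gt0 ?exprn_gt0 //.
  rewrite ler_wpM2l // ler_expR ler_pM2l ?mulr_gt0 //.
  by move: tI; rewrite in_itv /= => /andP[].
have /choice[f hf] : forall t, exists v : 'rV[R]_d, t \in `[0, T] ->
    forall n, enorm (v - fn n t) <= (d%:R * (2 * C)) / 2 ^+ n.
  move=> t; have [tI|tI] := boolP (t \in `[0, T]); last by exists 0.
  have /choice[l hl] : forall i : 'I_d, exists l : R, forall n, `|l - fn n t 0 i| <= 2 * C / 2 ^+ n.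
    move=> i; apply: geometric_limit => n; apply: le_trans (hC n t tI).
    by have := coord_le_enorm (fn n.+1 t - fn n t) i; rewrite !mxE.
  exists (\row_i l i) => _ n; apply: le_trans (enorm_le_sum _) _.
  apply: (@le_trans _ _ (\sum_(i < d) (2 * C / 2 ^+ n))).
    by apply: ler_sum => i _; rewrite !mxE.
  by rewrite sumr_const card_ord -[_ *+ d]mulr_natl mulrA.
set D := d%:R * (2 * C) in hf.
have cf : path_cont T f by apply: (path_cont_unif cfn (D := D)) => n t /hf.
exists f; split => // t tI.
have t0T : 0 <= t <= T by move: tI; rewrite in_itv.
have D0 : 0 <= D.
  by have := hf t tI 0%N; rewrite expr0 divr1; apply: le_trans; exact: enorm_ge0.
(* The residual of the limit lies below every term of a geometric sequence, hence is zero. *)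
have key n : enorm (f t - S x f t) <= (D * (1 + L * T)) / 2 ^+ n.
  have -> : f t - S x f t = (f t - fn n.+1 t) + (S x (fn n) t - S x f t).
    by rewrite [S x (fn n) t]/(fn n.+1 t) addrA subrK.
  apply: le_trans (enormD _ _) _.
  have h1 : enorm (f t - fn n.+1 t) <= D / 2 ^+ n.
    apply: le_trans (hf t tI n.+1) _; rewrite ler_wpM2l // exprS invfM ler_piMl ?invr_ge0 ?exprn_ge0 //.
    by rewrite invf_le1 // ler1n.
  have h2 : enorm (S x (fn n) t - S x f t) <= (L * (D / 2 ^+ n)) * T.
    rewrite ito_stepB; pose G (s : R) := (L * (D / 2 ^+ n)) * s.
    have dG (s : R) : 0 <= s -> is_derive s (1:R) G (L * (D / 2 ^+ n)).
      by move=> _; apply: is_derive_eq; rewrite /GRing.scale /=; ring.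
    have /andP[t0 tT] := t0T.
    have := drift_int_diff (cfn n) cf dG _ (lexx 0) t0 tT.
    rewrite !drift_int0 // !subr0 => /(_ _)/le_trans; apply.
      by move=> s sI; rewrite ler_pM2l // enormB_sym hf.
    rewrite /G mulr0 subr0 ler_wpM2l // mulr_ge0 ?(ltW hL) // divr_ge0 ?exprn_ge0 //.
  apply: le_trans (lerD h1 h2) _; rewrite le_eqVlt; apply/orP; left; apply/eqP; ring.
apply/eqP; rewrite -subr_eq0 -enorm_eq0.
have [//|n0] := eqVneq (enorm (f t - S x f t)) 0.
have p0 : 0 < enorm (f t - S x f t) by rewrite lt_neqAle eq_sym n0 enorm_ge0.
have := geometric_small (D * (1 + L * T)) p0 => -[n hn].
by have := lt_le_trans hn (key n); rewrite ltxx.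
Qed.

(** [G] is a primitive of [L |f - g|] and dominates all increments of the difference of drifts,
    which therefore has finite 1-variation. The difference [x - y] of the driving paths is kept
    apart, as it is controlled in q-variation only. *)
Lemma ito_gronwall x y f g (A : R) : path_cont T f -> path_cont T g ->
  (forall t, t \in `[0, T] -> f t = S x f t) -> (forall t, t \in `[0, T] -> g t = S y g t) ->
  (forall t, t \in `[0, T] -> enorm (x t - y t) <= A) ->
  exists G : R -> R, (forall r t, 0 <= r -> r <= t -> t <= T ->
     enorm ((f t - g t) - (f r - g r) - ((x t - y t) - (x r - y r))) <= G t - G r) /\
   (forall t, t \in `[0, T] -> G t - G 0 + A <= A * expR (L * t)).
Proof.
move=> cf cg fE gE hA.
have cu : continuous ((fun s => L * enorm (f s - g s)) \o clamp T).
  apply: (continuous_clamp T0 (K := L) (path_contB cf cg)) => s t _ _.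
  rewrite -mulrBr normrM (ger0_norm (ltW hL)) ler_pM2l //; exact: enorm_distB.
have [G [dG _]] := primitive_exists cu.
have hu s : s \in `[0, T] -> L * enorm (f s - g s) <= ((fun s => L * enorm (f s - g s)) \o clamp T) s.
  by move=> sI; rewrite /= clampE.
have inc r t : 0 <= r -> r <= t -> t <= T ->
     enorm ((f t - g t) - (f r - g r) - ((x t - y t) - (x r - y r))) <= G t - G r.
  move=> r0 rt tT.
  have tI : t \in `[0, T] by rewrite in_itv /= tT (le_trans r0).
  have rI : r \in `[0, T] by rewrite in_itv /= r0 (le_trans rt).
  apply: le_trans (drift_int_diff cf cg dG hu r0 rt tT).
  rewrite (fE t) // (gE t) // (fE r) // (gE r) // le_eqVlt; apply/orP; left; apply/eqP; congr enorm.
  by rewrite /S; apply/rowP => i; rewrite !mxE; ring.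
exists G; split => // t tI.
have /andP[t0 tT] : 0 <= t <= T by move: tI; rewrite in_itv.
have I0 : 0 \in `[0, T] by rewrite in_itv /= lexx ltW.
have fg0 : f 0 - g 0 = x 0 - y 0.
  by rewrite fE // gE // /S !drift_int0 //; apply/rowP => i; rewrite !mxE; ring.
have bd s : s \in `[0, T] -> enorm (f s - g s) <= G s - G 0 + A.
  move=> sI; have /andP[s0 sT] : 0 <= s <= T by move: sI; rewrite in_itv.
  have := inc 0 s (lexx 0) s0 sT; rewrite fg0 => h1; have h2 := hA s sI.
  have -> : f s - g s = (f s - g s - (x 0 - y 0) - (x s - y s - (x 0 - y 0))) + (x s - y s).
    by apply/rowP => i; rewrite !mxE; ring.
  by apply: le_trans (enormD _ _) _; exact: lerD.
(* Gronwall's lemma: since [|f - g| <= G - G 0 + A] by [bd], this function is nondecreasing. *)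
pose psi (s : R) := - expR (- (L * s)) * (G s - G 0 + A).
have : psi 0 <= psi t.
  apply: (@is_derive_ge0_le R psi (fun s => expR (- (L * s)) * (L * (G s - G 0 + A) - L * enorm (f (clamp T s) - g (clamp T s)))) 0 t); last by [].
    move=> s; rewrite in_itv /= => /andP[s0 _]; have h := dG s s0.
    by apply: is_derive_eq; rewrite /GRing.scale /=; ring.
  move=> s; rewrite in_itv /= => /andP[s0 st]; rewrite mulr_ge0 ?expR_ge0 // -mulrBr mulr_ge0 ?(ltW hL) //.
  have sI : s \in `[0, T] by rewrite in_itv /= s0 (le_trans st).
  by rewrite subr_ge0 clampE // bd.
rewrite /psi mulr0 oppr0 expR0 subrr add0r mulN1r mulNr lerN2 expRN => h.
by rewrite -ler_pdivrMr ?expR_gt0 // mulrC.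
Qed.

Lemma ito_bound x y f g (A : R) : path_cont T f -> path_cont T g ->
  (forall t, t \in `[0, T] -> f t = S x f t) -> (forall t, t \in `[0, T] -> g t = S y g t) ->
  (forall t, t \in `[0, T] -> enorm (x t - y t) <= A) ->
  forall t, t \in `[0, T] -> enorm (f t - g t) <= A * expR (L * t).
Proof.
move=> cf cg fE gE hA t tI; have [G [inc hG]] := ito_gronwall cf cg fE gE hA.
have /andP[t0 tT] : 0 <= t <= T by move: tI; rewrite in_itv.
have I0 : 0 \in `[0, T] by rewrite in_itv /= lexx ltW.
have fg0 : f 0 - g 0 = x 0 - y 0.
  by rewrite fE // gE // /S !drift_int0 //; apply/rowP => i; rewrite !mxE; ring.
have := inc 0 t (lexx 0) t0 tT; rewrite fg0 => h1; have h2 := hA t tI.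
have -> : f t - g t = (f t - g t - (x 0 - y 0) - (x t - y t - (x 0 - y 0))) + (x t - y t).
  by apply/rowP => i; rewrite !mxE; ring.
apply: le_trans (hG t tI); apply: le_trans (enormD _ _) _; exact: lerD.
Qed.

End ito_map.

(** * Variation of paths *)

Section powR.
Context {R : realType} (q : R).
Hypothesis q1 : 1 <= q.

Let q0 : 0 < q. Proof. exact: lt_le_trans q1. Qed.

Let powR_split (c : R) : c != 0 -> 0 <= c -> c `^ q = c * c `^ (q - 1).
Proof.
move=> c0 cge; have h : (q - 1 + 1 == 0) ==> (c != 0) by rewrite c0 implybT.
by have := powRD h; rewrite subrK powRr1 // mulrC.
Qed.

(** From [a^q = a a^(q-1) <= a (a + b)^(q-1)], and likewise for [b]. *)
Lemma powR_superadd (a b : R) : 0 <= a -> 0 <= b -> a `^ q + b `^ q <= (a + b) `^ q.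
Proof.
move=> a0 b0.
have h (x y : R) : 0 <= x -> 0 <= y -> x `^ q <= x * (x + y) `^ (q - 1).
  rewrite le_eqVlt => /predU1P[<- _|x0 y0]; first by rewrite powR0 ?gt_eqF // mul0r.
  rewrite powR_split ?gt_eqF ?(ltW x0) // ler_pM2l //; apply: ge0_ler_powR; rewrite ?nnegrE ?subr_ge0 ?(ltW x0) //.
    by rewrite addr_ge0 // ltW.
  by rewrite lerDl.
have [s0|s0] := eqVneq (a + b) 0.
  have -> : a = 0 by apply/eqP; rewrite eq_le a0 andbT -s0 lerDl.
  by rewrite add0r powR0 ?gt_eqF // add0r.
have sp : 0 < a + b by rewrite lt_neqAle eq_sym s0 addr_ge0.
have -> : (a + b) `^ q = a * (a + b) `^ (q - 1) + b * (b + a) `^ (q - 1).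
  by rewrite [b + a]addrC -mulrDl powR_split // ltW.
by apply: lerD; exact: h.
Qed.

Lemma sum_powR_le (n : nat) (a : nat -> R) : (forall i, (i < n)%N -> 0 <= a i) ->
  \sum_(0 <= i < n) a i `^ q <= (\sum_(0 <= i < n) a i) `^ q.
Proof.
elim: n => [|n ih] a0; first by rewrite !big_nil powR0 // gt_eqF.
rewrite !big_nat_recr //=.
have h : forall i, (i < n)%N -> 0 <= a i by move=> i ilt; apply: a0; exact: ltn_trans ilt _.
apply: le_trans (powR_superadd _ (a0 n (ltnSn n))); first by rewrite lerD2r ih.
by rewrite big_nat_cond sumr_ge0 // => i /andP[/andP[_ ilt] _]; exact: h.
Qed.

(** Convexity of the power at the midpoint; the source of [2^(1-1/q)] in the final constant. *)
Lemma powR_conv2 (a b : R) : 0 <= a -> 0 <= b ->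
  (a + b) `^ q <= 2 `^ (q - 1) * (a `^ q + b `^ q).
Proof.
move=> a0 b0.
have h1 : 2^-1 <= 1 :> R by rewrite invf_le1 // ler1n.
have h0 : 0 <= 2^-1 :> R by rewrite invr_ge0.
have := @convex_powR R q q1 (Itv01 h0 h1) a b.
rewrite !inE /= !in_itv /= !andbT => /(_ a0 b0).
have E (u v : R) : conv (Itv01 h0 h1) (u : R^o) (v : R^o) = 2^-1 * (u + v) :> R.
  by rewrite convRE -[X in _ + X * _]/(1 - 2^-1) /=; field.
rewrite !E => h.
have {h} : (2^-1 * (a + b)) `^ q <= 2^-1 * (a `^ q + b `^ q) by rewrite -(E a b); exact: h.
rewrite powRM ?addr_ge0 // => h.
have c0 : 0 < 2^-1 `^ q :> R by rewrite powR_gt0 // invr_gt0.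
have -> : 2 `^ (q - 1) = 2^-1 / 2^-1 `^ q :> R.
  rewrite -[X in _ / X `^ q]powR_inv1 // -powRrM mulN1r powRN invrK powRB ?pnatr_eq0 ?implybT //.
  by rewrite powRr1 // mulrC.
by rewrite mulrAC ler_pdivlMr // mulrC.
Qed.

End powR.

Section qvar_ito.
Context {R : realType} {d : nat} {T q : R}.
Hypotheses (T0 : 0 < T) (q1 : 1 <= q).
Let q0 : 0 < q. Proof. exact: lt_le_trans q1. Qed.

Let pt (s : seq R) i := nth T (0 :: s) i.

Lemma partition_point s i : itv_partition 0 T s -> (i < (size s).+1)%N -> pt s i \in `[0, T].
Proof.
move=> hs ilt; rewrite in_itv /= /pt.
by rewrite (itv_partition_nth_ge ilt hs) (itv_partition_nth_le ilt hs).
Qed.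

Lemma partition_step s i : itv_partition 0 T s -> (i < size s)%N -> pt s i < pt s i.+1.
Proof. by move=> [/(pathP T) h _] ilt; exact: h. Qed.

Lemma partition_telescope s (G : R -> R) : itv_partition 0 T s ->
  \sum_(0 <= i < size s) (G (pt s i.+1) - G (pt s i)) = G T - G 0.
Proof.
move=> hs; rewrite (telescope_sumr (fun i => G (pt s i))) //.
by rewrite /pt (itv_partition_nth_size T hs).
Qed.

Definition qsum (z : R -> 'rV[R]_d) (s : seq R) : R :=
  \sum_(0 <= i < size s) enorm (z (pt s i.+1) - z (pt s i)) `^ q.

Lemma qsum_ge0 z s : 0 <= qsum z s.
Proof. by apply: sumr_ge0 => i _; exact: powR_ge0. Qed.

Lemma qvar_leP (z : R -> 'rV[R]_d) (V : R) : 0 <= V ->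
  (qvar T q z <= V%:E)%E <-> forall s, itv_partition 0 T s -> qsum z s <= V `^ q.
Proof.
move=> V0; split=> [h s hs|h].
  have : ((qsum z s `^ q^-1)%:E <= V%:E)%E.
    by apply: le_trans h; apply: ereal_sup_ubound; exists s.
  rewrite lee_fin => hV.
  have : (qsum z s `^ q^-1) `^ q <= V `^ q.
    by apply: ge0_ler_powR => //; rewrite ?nnegrE ?powR_ge0 // ltW.
  by rewrite -powRrM mulVf ?gt_eqF // powRr1 // qsum_ge0.
apply: ge_ereal_sup => _ [s hs <-]; rewrite lee_fin.
have -> : V = (V `^ q) `^ q^-1 by rewrite -powRrM mulfV ?gt_eqF // powRr1.
by apply: ge0_ler_powR; rewrite ?nnegrE ?powR_ge0 ?qsum_ge0 ?invr_ge0 ?(ltW q0) //; exact: h.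
Qed.

(** The partition with points 0, [t] and [T] has the increment as one of its terms; at [t = T] it is
    the only one. *)
Lemma enorm_le_qvar (z : R -> 'rV[R]_d) (V : R) t : 0 <= V -> (qvar T q z <= V%:E)%E ->
  t \in `[0, T] -> enorm (z t - z 0) <= V.
Proof.
move=> V0 /(qvar_leP _ V0) h; rewrite in_itv /= => /andP[].
rewrite le_eqVlt => /predU1P[<- _|t0 tT]; first by rewrite subrr enorm0.
suff : enorm (z t - z 0) `^ q <= V `^ q.
  move=> hq; rewrite -[leLHS]powRr1 ?enorm_ge0 // -[leRHS]powRr1 // -(mulfV (lt0r_neq0 q0)) !powRrM.
  by apply: ge0_ler_powR; rewrite ?nnegrE ?powR_ge0 ?invr_ge0 ?(ltW q0).
have [tT'|Tt] := ltP t T.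
  have hs : itv_partition 0 T [:: t; T] by split; rewrite /= ?t0 ?tT' ?eqxx.
  apply: le_trans (h _ hs); rewrite /qsum /= big_nat_recl // /pt /= lerDl.
  by apply: sumr_ge0 => i _; exact: powR_ge0.
have -> : t = T by apply/eqP; rewrite eq_le tT.
have hs : itv_partition 0 T [:: T] by exact: itv_partition1.
by apply: le_trans (h _ hs); rewrite /qsum /= big_nat1.
Qed.

Lemma qvar_ge0 (z : R -> 'rV[R]_d) : (0 <= qvar T q z)%E.
Proof.
apply: le_trans (ereal_sup_ubound _); last by exists [:: T] => //; exact: itv_partition1.
by rewrite lee_fin powR_ge0.
Qed.

(** On each cell [|dz|^q <= 2^(q-1) (|dh|^q + (dG)^q)]. The first terms sum to at most [V^q], the
    second to at most [(G T - G 0)^q] because [G] increases along the partition, and superadditivity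
    recombines the two into [A^q]. *)
Lemma qvar_perturb (z h : R -> 'rV[R]_d) (G : R -> R) (V A : R) : 0 <= V ->
  (qvar T q h <= V%:E)%E ->
  (forall r t, 0 <= r -> r <= t -> t <= T -> enorm (z t - z r - (h t - h r)) <= G t - G r) ->
  V + (G T - G 0) <= A ->
  (qvar T q z <= (2 `^ (1 - q^-1) * A)%:E)%E.
Proof.
move=> V0 /(qvar_leP _ V0) hV inc hA.
have A0 : 0 <= A.
  apply: le_trans hA; rewrite addr_ge0 //.
  by apply: le_trans (inc 0 T (lexx 0) (ltW T0) (lexx T)); exact: enorm_ge0.
apply/qvar_leP => [|s hs]; first by rewrite mulr_ge0 ?powR_ge0.
rewrite powRM ?powR_ge0 // -powRrM mulrBl mul1r mulVf ?gt_eqF //.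
have inc' i : (i < size s)%N -> enorm (z (pt s i.+1) - z (pt s i) - (h (pt s i.+1) - h (pt s i)))
    <= G (pt s i.+1) - G (pt s i).
  move=> ilt.
  have := partition_point hs (ltnW ilt : (i < (size s).+1)%N); rewrite in_itv /= => /andP[h1 h2].
  have := partition_point hs (ilt : (i.+1 < (size s).+1)%N); rewrite in_itv /= => /andP[h3 h4].
  by apply: inc => //; apply: ltW; exact: partition_step.
pose a i := G (pt s i.+1) - G (pt s i).
have a0 i : (i < size s)%N -> 0 <= a i.
  by move=> /inc'; apply: le_trans; exact: enorm_ge0.
apply: (@le_trans _ _ (\sum_(0 <= i < size s)
    2 `^ (q - 1) * (enorm (h (pt s i.+1) - h (pt s i)) `^ q + a i `^ q))).
  rewrite /qsum !big_nat; apply: ler_sum => i ilt.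
  apply: le_trans (powR_conv2 q1 (enorm_ge0 _) (a0 i _)) => //.
  have sum0 : 0 <= enorm (h (pt s i.+1) - h (pt s i)) + a i by rewrite addr_ge0 ?enorm_ge0 ?a0.
  apply: ge0_ler_powR; rewrite ?nnegrE ?enorm_ge0 ?(ltW q0) //.
  rewrite -[X in enorm X <= _](subrK (h (pt s i.+1) - h (pt s i))) [X in enorm X <= _]addrC.
  by apply: le_trans (enormD _ _) _; rewrite lerD2l inc'.
rewrite -mulr_sumr ler_pM2l ?powR_gt0 // big_split /=.
have h1 : \sum_(0 <= i < size s) a i `^ q <= (G T - G 0) `^ q.
  by rewrite -(partition_telescope G hs); exact: sum_powR_le.
have GT0 : 0 <= G T - G 0 by apply: le_trans (inc 0 T (lexx 0) (ltW T0) (lexx T)); exact: enorm_ge0.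
apply: le_trans (lerD (hV s hs) h1) _.
apply: le_trans (powR_superadd q1 V0 GT0) _.
by apply: ge0_ler_powR; rewrite ?nnegrE ?(addr_ge0 V0 GT0) ?(ltW q0).
Qed.

End qvar_ito.

(** * Gaussian variables and Gram-Schmidt *)

Lemma Rintegral_prob_cst d (E : measurableType d) (R : realType) (P : probability E R) (c : R) :
  \int[P]_x c = c.
Proof.
rewrite Rintegral_cst // (_ : fine _ = 1) ?mulr1 //.
exact: (f_equal fine (probability_setT P)).
Qed.

Section gaussian_rv.
Context d {E : measurableType d} {R : realType} (P : probability E R).
Local Notation RR := (measurableTypeR R).

Definition gaussian_rv (Z : E -> RR) (m s : R) : Prop :=
  measurable_fun setT Z /\
  forall A : set RR, measurable A -> P (Z @^-1` A) = gaussian_law m s A.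

Variables (Z : E -> RR) (m s : R).
Hypothesis hZ : gaussian_rv Z m s.

Let mZ : measurable_fun setT Z := hZ.1.

Let Zlaw (C : set RR) : s != 0 -> measurable C ->
  law P mZ C = (normal_prob m s : probability RR R) C.
Proof. by move=> s0 mC; rewrite lawE hZ.2 // /gaussian_law (negbTE s0). Qed.

Let Zdeg : s = 0 -> {ae P, forall x, Z x = m}.
Proof.
move=> s0; exists (Z @^-1` (~` [set m])); split.
- by rewrite -[X in measurable X]setTI; apply: mZ => //; exact: measurableC.
- rewrite hZ.2; last exact: measurableC.
  rewrite /gaussian_law s0 eqxx diracE memNset //= => h; exact: h.
- by move=> x /=.
Qed.

Let normal_integrable (f : RR -> R) (C : R) : s != 0 -> measurable_fun setT f ->
  (forall x, `|f x| <= C * (1 + (x - m) ^+ 2)) ->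
  (normal_prob m s : probability RR R).-integrable setT (EFin \o f).
Proof.
move=> s0 mf fC; apply/(integral_density (mu := lebesgue_measure) (g := normal_pdf m s)) => //.
- exact: measurable_normal_pdf.
- by move=> x; exact: normal_pdf_ge0.
- exact: (integrable_mul_normal_pdf s0 mf fC).
Qed.

(** Treats the point mass and the density together; quadratic growth covers the mean, the variance
    and the characteristic function. *)
Let gaussian_expect (f : RR -> R) (C : R) : measurable_fun setT f ->
  (forall x, `|f x| <= C * (1 + (x - m) ^+ 2)) ->
  P.-integrable setT (EFin \o (f \o Z)) /\
  \int[P]_x f (Z x) = if s == 0 then f m else
    \int[lebesgue_measure]_x (f x * normal_pdf m s x).
Proof.
move=> mf fC; have mfZ : measurable_fun setT (f \o Z) by exact: measurableT_comp.
have [s0|s0] := eqVneq s 0.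
  have ae : ae_eq P setT (EFin \o (f \o Z)) (cst (f m)%:E).
    by apply: filterS (Zdeg s0) => x /= -> _.
  split.
    apply/integrableP; split; first exact/measurable_EFinP.
    rewrite (ae_eq_integral (cst `|(f m)%:E|%E)) //.
    - rewrite integral_cst //= (_ : P [set: E] = 1%E) ?mule1 ?ltry //.
      exact: probability_setT.
    - by apply: measurableT_comp => //; exact/measurable_EFinP.
    - by apply: filterS ae => x h _; rewrite (h I).
  rewrite /Rintegral (ae_eq_integral (cst (f m)%:E)) //; last exact/measurable_EFinP.
  exact: Rintegral_prob_cst.
have ni := normal_integrable s0 mf fC.
have i : P.-integrable setT (fun x => (f (Z x))%:E).
  apply/(integrable_law P mZ mf); have /integrableP[h1 h2] := ni.
  apply/integrableP; split => //; apply: le_lt_trans h2.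
  rewrite le_eqVlt; apply/orP; left; apply/eqP.
  by apply: eq_measure_integral => A mA _; exact: Zlaw.
split => //.
rewrite -(Rintegral_law mZ) //.
rewrite -(Rintegral_normal_prob s0 mf ni) /Rintegral; congr fine.
by apply: eq_measure_integral => A mA _; exact: Zlaw.
Qed.

Lemma gaussian_rv_mean : P.-integrable setT (EFin \o Z) /\ \int[P]_x Z x = m.
Proof.
have fC (x : R) : `|x - m| <= 1 * (1 + (x - m) ^+ 2).
  have := sqr_ge0 (`|x - m| - 1); have := sqr_ge0 (x - m).
  rewrite -(real_normK (num_real (x - m))); set a := `|x - m|; nra.
have mf : measurable_fun setT (fun x : RR => x - m) by exact: measurable_funB.
have [i e] := gaussian_expect mf fC.
have mi : P.-integrable setT (EFin \o cst m).
  by apply: (@prob_bounded_integrable _ _ _ P (cst m) `|m|).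
have Zi : P.-integrable setT (EFin \o Z).
  rewrite (_ : _ \o _ = (EFin \o (fun x => (Z x - m) + m))); last first.
    by apply/funext => x; rewrite /= subrK.
  exact: (integrableDR _ i mi).
split=> //; have := e; rewrite RintegralB // Rintegral_prob_cst.
case: ifPn => [_|s0]; first by rewrite subrr => /eqP; rewrite subr_eq0 => /eqP.
by rewrite normal_mean // => /eqP; rewrite subr_eq0 => /eqP.
Qed.

Lemma gaussian_rv_variance : P.-integrable setT (EFin \o (fun x => (Z x - m) ^+ 2)) /\
  \int[P]_x (Z x - m) ^+ 2 = s ^+ 2.
Proof.
have fC (x : R) : `|(x - m) ^+ 2| <= 1 * (1 + (x - m) ^+ 2).
  by rewrite ger0_norm ?sqr_ge0 // mul1r lerDr.
have mf : measurable_fun setT (fun x : RR => (x - m) ^+ 2).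
  by apply: measurable_funX; exact: measurable_funB.
have [i ->] := gaussian_expect mf fC; split => //.
case: ifPn => [/eqP ->|s0]; first by rewrite subrr.
exact: normal_variance.
Qed.

Lemma gaussian_rv_cos t c :
  \int[P]_x cos (t * (Z x - m) + c) = expR (- (s ^+ 2 * t ^+ 2) / 2) * cos c.
Proof.
have fC (x : R) : `|cos (t * (x - m) + c)| <= 1 * (1 + (x - m) ^+ 2).
  by rewrite mul1r (le_trans (cos_max _)) // lerDl sqr_ge0.
have mf : measurable_fun setT (fun x : RR => cos (t * (x - m) + c)).
  apply: measurable_fun_cos; apply: measurable_funD => //; apply: measurable_funM => //.
  exact: measurable_funB.
have [_ ->] := gaussian_expect mf fC.
case: ifPn => [/eqP ->|s0]; last exact: normal_cos.
by rewrite subrr mulr0 add0r expr0n mul0r oppr0 mul0r expR0 mul1r.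
Qed.

End gaussian_rv.

Section L2.
Context d {E : measurableType d} {R : realType} (P : probability E R).
Implicit Types X Y W : E -> R.

Definition L2 X : Prop :=
  measurable_fun setT X /\ P.-integrable setT (EFin \o (fun x => X x ^+ 2)).

Definition ip X Y : R := \int[P]_x (X x * Y x).

Lemma L2_ip X Y : L2 X -> L2 Y -> P.-integrable setT (EFin \o (fun x => X x * Y x)).
Proof.
move=> [mX iX] [mY iY]; have iXY := integrableDR measurableT iX iY.
apply: (le_integrable measurableT _ _ iXY).
  by apply/measurable_EFinP; exact: measurable_funM.
move=> x _ /=; rewrite lee_fin [leRHS]ger0_norm ?addr_ge0 ?sqr_ge0 //.
rewrite normrM; have := sqr_ge0 (`|X x| - `|Y x|).
rewrite -(real_normK (num_real (X x))) -(real_normK (num_real (Y x))) sqrrB.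
have := mulr_ge0 (normr_ge0 (X x)) (normr_ge0 (Y x)); lra.
Qed.

Lemma L2_0 : L2 (fun=> 0).
Proof.
split=> //; apply: (@prob_bounded_integrable _ _ _ P (fun=> 0 ^+ 2) 0) => // x.
by rewrite expr0n normr0.
Qed.

Lemma L2_lin (a : R) X Y : L2 X -> L2 Y -> L2 (fun x => a * X x + Y x).
Proof.
move=> hX hY; have [mX iX] := hX; have [mY iY] := hY; split.
  by apply: measurable_funD => //; exact: measurable_funM.
have h := L2_ip hX hY.
have h1 := integrableDR measurableT (integrableZlR measurableT iX (a ^+ 2)) (integrableDR measurableT (integrableZlR measurableT h (2 * a)) iY).
apply: eq_integrable h1 => // x _ /=; congr EFin; ring.
Qed.

Lemma ipC X Y : ip X Y = ip Y X.
Proof. by apply: eq_Rintegral => x _; rewrite mulrC. Qed.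

Lemma ip_linl (a : R) X Y W : L2 X -> L2 Y -> L2 W ->
  ip (fun x => a * X x + Y x) W = a * ip X W + ip Y W.
Proof.
move=> hX hY hW; rewrite /ip -RintegralZl //; last exact: L2_ip.
rewrite -RintegralD //; [|exact: (integrableZlR measurableT (L2_ip hX hW) a)|exact: L2_ip].
by apply: eq_Rintegral => x _; ring.
Qed.

Lemma ip_linr (a : R) X Y W : L2 X -> L2 Y -> L2 W ->
  ip W (fun x => a * X x + Y x) = a * ip W X + ip W Y.
Proof. by move=> hX hY hW; rewrite ipC ip_linl // !(ipC W). Qed.

Lemma ip_ge0 X : 0 <= ip X X.
Proof. by apply: Rintegral_ge0 => x _; rewrite -expr2 sqr_ge0. Qed.

Lemma ip_0l X : ip (fun=> 0) X = 0.
Proof. by rewrite /ip; under eq_Rintegral do rewrite mul0r; rewrite Rintegral_cst // mul0r. Qed.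

Lemma ip_sumr (n : nat) (a : nat -> R) (X : nat -> E -> R) W : (forall i, L2 (X i)) -> L2 W ->
  L2 (fun x => \sum_(i < n) a i * X i x) /\
  ip W (fun x => \sum_(i < n) a i * X i x) = \sum_(i < n) a i * ip W (X i).
Proof.
move=> hX hW; elim: n => [|n [ihL ih]].
  have -> : (fun x => \sum_(i < 0) a i * X i x) = fun=> 0 :> R.
    by apply/funext => x; rewrite big_ord0.
  by rewrite big_ord0 ipC ip_0l; split => //; exact: L2_0.
have -> : (fun x => \sum_(i < n.+1) a i * X i x) =
    (fun x => a n * X n x + \sum_(i < n) a i * X i x).
  by apply/funext => x; rewrite big_ord_recr addrC.
split; first exact: L2_lin.
by rewrite ip_linr // ih big_ord_recr addrC.
Qed.

Lemma ip_suml (n : nat) (a : nat -> R) (X : nat -> E -> R) W : (forall i, L2 (X i)) -> L2 W ->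
  ip (fun x => \sum_(i < n) a i * X i x) W = \sum_(i < n) a i * ip (X i) W.
Proof.
move=> hX hW; rewrite ipC (ip_sumr n a hX hW).2; apply: eq_bigr => i _.
by rewrite ipC.
Qed.

Lemma ip_ae_eq X Y W : measurable_fun setT X -> measurable_fun setT Y -> measurable_fun setT W ->
  {ae P, forall x, X x = Y x} -> ip X W = ip Y W.
Proof.
move=> mX mY mW h; rewrite /ip /Rintegral; congr fine; apply: ae_eq_integral => //.
- by apply/measurable_EFinP; exact: measurable_funM.
- by apply/measurable_EFinP; exact: measurable_funM.
- by apply: filterS h => x -> _.
Qed.

Lemma ip_eq0 X : L2 X -> ip X X = 0 -> {ae P, forall x, X x = 0}.
Proof.
move=> [mX iX] h.
have mX2 : measurable_fun setT (fun x => (X x ^+ 2)%:E).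
  by apply/measurable_EFinP; exact: measurable_funX.
have : (\int[P]_x `|(X x ^+ 2)%:E| = 0)%E.
  under eq_integral do rewrite gee0_abs ?lee_fin ?sqr_ge0 //.
  by rewrite Rintegral_EFin //; congr EFin.
move/(ae_eq_integral_abs _ measurableT mX2); apply: filterS => x /(_ I) /= [] /eqP.
by rewrite sqrf_eq0 => /eqP.
Qed.

End L2.

Section gram_schmidt.
Context d {E : measurableType d} {R : realType} (P : probability E R).
Implicit Types X Y W : E -> R.
Local Notation ip := (ip P).
Local Notation L2 := (L2 P).
Variable V : (E -> R) -> Prop.
Hypotheses (V0 : V (fun=> 0)) (Vlin : forall a X Y, V X -> V Y -> V (fun x => a * X x + Y x)).
Hypothesis VL2 : forall X, V X -> L2 X.
Variable Z : nat -> E -> R.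
Hypothesis VZ : forall k, V (Z k).

Definition residual (s : seq (E -> R)) (z : E -> R) : E -> R :=
  fun x => z x - \sum_(y <- s) ip z y * y x.

(** A null residual yields the zero function, so that coordinate [k] always belongs to variable [k].
    The final [+ 0] gives the value the shape to which [Vlin] applies. *)
Definition gs_next (s : seq (E -> R)) (z : E -> R) : E -> R :=
  if ip (residual s z) (residual s z) == 0 then fun=> 0
  else fun x => (Num.sqrt (ip (residual s z) (residual s z)))^-1 * residual s z x + 0.

Fixpoint gs_seq (n : nat) : seq (E -> R) :=
  if n is k.+1 then rcons (gs_seq k) (gs_next (gs_seq k) (Z k)) else [::].

Definition gs (k : nat) : E -> R := gs_next (gs_seq k) (Z k).
Local Notation xi := gs.

Lemma gs_seqE n : gs_seq n = mkseq xi n.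
Proof. by elim: n => //= n ih; rewrite mkseqS -ih. Qed.

Let res k : E -> R := residual (gs_seq k) (Z k).
Definition gs_nondeg k : bool := ip (res k) (res k) != 0.

Let resE k x : res k x = Z k x - \sum_(i < k) ip (Z k) (xi i) * xi i x.
Proof.
rewrite /res /residual gs_seqE big_map (_ : iota 0 k = index_iota 0 k) ?big_mkord //.
by rewrite /index_iota subn0.
Qed.

Lemma V_sum (n : nat) (a : nat -> R) (X : nat -> E -> R) : (forall i, (i < n)%N -> V (X i)) ->
  V (fun x => \sum_(i < n) a i * X i x).
Proof.
elim: n => [|n ih] hX.
  by rewrite (_ : (fun x => _) = fun=> 0) //; apply/funext => x; rewrite big_ord0.
rewrite (_ : (fun x => _) = fun x => a n * X n x + \sum_(i < n) a i * X i x); last first.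
  by apply/funext => x; rewrite big_ord_recr addrC.
by apply: Vlin; [exact: hX|apply: ih => i ilt; apply: hX; exact: ltn_trans ilt _].
Qed.

Let V_res k : (forall i, (i < k)%N -> V (xi i)) -> V (res k).
Proof.
move=> h; have hs := V_sum (fun i => ip (Z k) (xi i)) h.
rewrite (_ : res k = fun x => (-1) * (\sum_(i < k) ip (Z k) (xi i) * xi i x) + Z k x).
  exact: Vlin.
by apply/funext => x; rewrite resE mulN1r addrC.
Qed.

Lemma V_gs k : V (xi k).
Proof.
have [n] := ubnP k; elim: n k => // n ih k kn.
rewrite /xi /gs_next; case: ifP => // _; apply: Vlin => //.
apply: V_res => i ik; apply: ih; exact: leq_trans ik kn.
Qed.

Let L2gs k : L2 (xi k). Proof. exact/VL2/V_gs. Qed.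
Let L2Z k : L2 (Z k). Proof. exact/VL2/VZ. Qed.
Let L20 : L2 (fun=> 0). Proof. exact: L2_0. Qed.
Let L2res k : L2 (res k). Proof. by apply/VL2/V_res => i _; exact: V_gs. Qed.
Lemma gs_deg k : ~~ gs_nondeg k -> xi k = fun=> 0.
Proof. by rewrite /gs_nondeg negbK => h; rewrite /xi /gs_next -/(res k) h. Qed.

Let res_gt0 k : gs_nondeg k -> 0 < ip (res k) (res k).
Proof. by move=> hk; rewrite lt_neqAle ip_ge0 andbT eq_sym. Qed.

Let ip_gs k W : L2 W -> gs_nondeg k ->
  ip (xi k) W = (Num.sqrt (ip (res k) (res k)))^-1 * ip (res k) W.
Proof.
move=> hW hk; rewrite [xi k](_ : _ = fun x => (Num.sqrt (ip (res k) (res k)))^-1 * res k x + 0).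
  by rewrite ip_linl // ip_0l addr0.
by rewrite /xi /gs_next -/(res k) ifF //; apply/negbTE.
Qed.

Let ip_resl k W : L2 W -> ip (res k) W = ip (Z k) W - \sum_(i < k) ip (Z k) (xi i) * ip (xi i) W.
Proof.
move=> hW; have [hs _] := ip_sumr k (fun i => ip (Z k) (xi i)) L2gs hW.
rewrite (_ : res k = fun x => (-1) * (\sum_(i < k) ip (Z k) (xi i) * xi i x) + Z k x).
  by rewrite ip_linl // mulN1r addrC (ip_suml k (fun i => ip (Z k) (xi i)) L2gs hW).
by apply/funext => x; rewrite resE mulN1r addrC.
Qed.

Lemma gs_orthonormal i j : ip (xi i) (xi j) = ((i == j) && gs_nondeg i)%:R.
Proof.
have diag k : ip (xi k) (xi k) = (gs_nondeg k)%:R.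
  have [hk|hk] := boolP (gs_nondeg k); last by rewrite gs_deg // ip_0l.
  rewrite ip_gs // ipC ip_gs //; set r := ip _ _; have r0 : 0 < r := res_gt0 hk.
  have w0 : Num.sqrt r != 0 by rewrite gt_eqF // sqrtr_gt0.
  by rewrite -[X in _ * (_ * X)](sqr_sqrtr (ltW r0)) expr2 mulKf // mulVf.
have orth k : forall i, (i < k)%N -> ip (xi k) (xi i) = 0.
  have [n] := ubnP k; elim: n k => // n ih k kn l lk.
  have [hk|hk] := boolP (gs_nondeg k); last by rewrite gs_deg // ip_0l.
  rewrite ip_gs // [ip (res k) (xi l)]ip_resl //; apply/eqP; rewrite mulf_eq0; apply/orP; right; apply/eqP.
  rewrite (bigD1 (Ordinal lk)) //= big1 ?addr0 => [|m ml].
    rewrite diag; case: (boolP (gs_nondeg l)) => hl; first by rewrite mulr1 subrr.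
    by rewrite (gs_deg hl) [ip (Z k) _]ipC ip_0l mul0r subrr.
  have [ml'|lm|lm] := ltngtP (m : nat) l.
  - by rewrite (ipC P (xi m)) (ih l (leq_trans lk kn)) ?mulr0.
  - by rewrite (ih m (leq_trans (ltn_ord m) kn)) ?mulr0.
  - by case/negP: ml; apply/eqP/val_inj.
have [ij|ij|->] := ltngtP i j; last exact: diag.
- by rewrite ipC orth.
- by rewrite orth.
Qed.

(** An identity when the residual can be normalised; a residual of norm zero vanishes only almost
    everywhere. *)
Lemma gs_decomp k : {ae P, forall x, Z k x = \sum_(i < k.+1) ip (Z k) (xi i) * xi i x}.
Proof.
have [hk|hk] := boolP (gs_nondeg k).
  apply: aeW => x; rewrite big_ord_recr /=.
  have -> : ip (Z k) (xi k) * xi k x = res k x.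
    have -> : ip (Z k) (xi k) = Num.sqrt (ip (res k) (res k)).
      have -> : ip (Z k) (xi k) = ip (fun x => 1 * res k x + \sum_(i < k) ip (Z k) (xi i) * xi i x) (xi k).
        by apply: eq_Rintegral => z _; rewrite mul1r resE subrK.
      have [hs _] := ip_sumr k (fun i => ip (Z k) (xi i)) L2gs (L2gs k).
      rewrite ip_linl // mul1r (ip_suml k (fun i => ip (Z k) (xi i)) L2gs (L2gs k)) big1 ?addr0; last first.
        by move=> i _; rewrite gs_orthonormal ltn_eqF // mulr0.
      rewrite ipC ip_gs //; set r := ip _ _; have r0 : 0 < r := res_gt0 hk.
      by rewrite -[X in _ * X](sqr_sqrtr (ltW r0)) expr2 mulKf // gt_eqF // sqrtr_gt0.
    rewrite /xi /gs_next -/(res k) ifF; last exact/negbTE.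
    by rewrite addr0 mulVKf // gt_eqF // sqrtr_gt0 res_gt0.
  by rewrite resE addrC subrK.
have h0 : ip (res k) (res k) = 0 by apply/eqP; move: hk; rewrite negbK.
apply: filterS (ip_eq0 (L2res k) h0) => x hx.
rewrite big_ord_recr /= (gs_deg hk) mulr0 addr0; apply/eqP; rewrite -subr_eq0 -resE.
exact/eqP.
Qed.

(** By [gs_decomp] variable [k] lies in the span of the first [k.+1] coordinates. This triangularity
    makes the series below finite on evaluations. *)
Lemma gs_coef0 k i : (k < i)%N -> ip (Z k) (xi i) = 0.
Proof.
move=> ki; have [hs e] := ip_sumr k.+1 (fun i => ip (Z k) (xi i)) L2gs (L2gs i).
rewrite (ip_ae_eq _ _ _ (gs_decomp k)); [|exact: (L2Z k).1|exact: hs.1|exact: (L2gs i).1].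
rewrite (ip_suml k.+1 (fun i => ip (Z k) (xi i)) L2gs (L2gs i)) big1 // => j _.
rewrite gs_orthonormal ltn_eqF ?mulr0 //.
by apply: leq_trans ki; exact: ltn_ord.
Qed.

End gram_schmidt.

(** * Gaussian functionals of a path *)

Section pairing.
Context d {E : measurableType d} {R : realType} (P : probability E R).
Variables (xi : nat -> E -> R) (sg : nat -> bool).
Hypothesis L2xi : forall i, L2 P (xi i).
Hypothesis orth : forall i j, ip P (xi i) (xi j) = ((i == j) && sg i)%:R.
Local Notation ip := (ip P).
Local Notation L2 := (L2 P).

Lemma bessel W n : L2 W -> \sum_(i < n) ip (xi i) W ^+ 2 <= ip W W.
Proof.
move=> hW; pose a i := - ip (xi i) W.
have [hs e] := ip_sumr n a L2xi hW.
have := ip_ge0 P (fun x => 1 * W x + \sum_(i < n) a i * xi i x).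
rewrite ip_linl //; last exact: L2_lin.
rewrite !ip_linr // e (ipC P _ W) e.
rewrite (ip_suml n a L2xi hs).
rewrite !mul1r [X in _ <= _ + X + _ -> _](_ : _ = - \sum_(i < n) ip (xi i) W ^+ 2); last first.
  by rewrite -sumrN; apply: eq_bigr => i _; rewrite (ipC P W) mulNr expr2.
set S2 := (X in _ <= _ + (_ + X) -> _).
rewrite [X in _ <= _ + (X + _) -> _](_ : _ = - \sum_(i < n) ip (xi i) W ^+ 2); last first.
  by rewrite -sumrN; apply: eq_bigr => i _; rewrite (ipC P W) mulNr expr2.
have : S2 <= \sum_(i < n) ip (xi i) W ^+ 2.
  apply: ler_sum => i _; rewrite (ip_sumr n a L2xi (L2xi i)).2.
  rewrite (bigD1 i) //= big1 ?addr0 => [|j ji]; last first.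
    by rewrite orth (_ : (_ == _ :> nat) = false) ?mulr0 //; apply/negbTE; rewrite eq_sym.
  rewrite orth eqxx /= /a mulrA mulrNN -expr2 ler_piMr ?sqr_ge0 //; by case: (sg i); rewrite ?ler01.
lra.
Qed.

Variables (u : nat -> R) (U : R).
Hypothesis U0 : 0 <= U.
Hypothesis hU : forall n, \sum_(i < n) u i ^+ 2 <= U ^+ 2.

(** The inner product of [W] with the formal series of [u i * xi i], whose [L^2] sum is never
    constructed: square summability of [u] and Bessel's inequality give convergence. *)
Definition pairing W : R := limn (series (fun i => u i * ip (xi i) W)).

Let seriesE (f : nat -> R) n : series f n = \sum_(i < n) f i.
Proof. by rewrite /series /= big_mkord. Qed.

Let partial_bound W n : L2 W -> \sum_(i < n) `|u i * ip (xi i) W| <= U * Num.sqrt (ip W W).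
Proof.
move=> hW.
under eq_bigr do rewrite normrM.
rewrite -(@ler_pXn2r _ 2) // ?nnegrE; last 2 first.
- by apply: sumr_ge0 => i _; exact: mulr_ge0.
- by rewrite mulr_ge0 // sqrtr_ge0.
rewrite exprMn sqr_sqrtr ?ip_ge0 //; apply: (le_trans (sum_CS _ _)).
apply: ler_pM; [by apply: sumr_ge0 => i _; exact: sqr_ge0..| |].
- by under eq_bigr do rewrite real_normK ?num_real //; exact: hU.
- by under eq_bigr do rewrite real_normK ?num_real //; exact: bessel.
Qed.

Lemma pairing_cvg W : L2 W -> series (fun i => u i * ip (xi i) W) @ \oo --> pairing W.
Proof.
move=> hW; apply: normed_cvg; apply: nondecreasing_is_cvgn.
  by apply: nondecreasing_series => n _ _ /=; exact: normr_ge0.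
exists (U * Num.sqrt (ip W W)) => _ [n _ <-].
rewrite /= seriesE; exact: partial_bound.
Qed.

Lemma pairing_bound W : L2 W -> `|pairing W| <= U * Num.sqrt (ip W W).
Proof.
move=> hW; have h0 := cvg_norm (pairing_cvg hW); have h := h0 eventually_filter.
rewrite -(cvg_lim _ h) //; apply: limr_le; first by apply/cvg_ex; eexists; exact: h.
apply: nearW => n; rewrite seriesE; apply: le_trans (partial_bound n hW).
exact: ler_norm_sum.
Qed.

Lemma pairing_lin a X Y : L2 X -> L2 Y ->
  pairing (fun x => a * X x + Y x) = a * pairing X + pairing Y.
Proof.
move=> hX hY; apply/cvg_lim => //.
rewrite (_ : series _ = (fun n => a * series (fun i => u i * ip (xi i) X) n + series (fun i => u i * ip (xi i) Y) n)); last first.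
  apply/funext => n; rewrite !seriesE mulr_sumr -big_split; apply: eq_bigr => i _ /=.
  by rewrite ip_linr //; ring.
by apply: cvgD; [apply: cvgM; [exact: cvg_cst|exact: pairing_cvg]|exact: pairing_cvg].
Qed.

Lemma pairing_finite W n : (forall i, (n <= i)%N -> ip (xi i) W = 0) ->
  pairing W = \sum_(i < n) u i * ip (xi i) W.
Proof.
move=> h; apply/cvg_lim => //; apply: (cvg_near_cst).
near=> m; rewrite seriesE.
have nm : (n <= m)%N by near: m; exact: nbhs_infty_ge.
rewrite -(subnKC nm) big_split_ord /= [X in _ + X]big1 ?addr0 // => i _.
by rewrite h ?mulr0 // leq_addr.
Unshelve. all: by end_near.
Qed.

End pairing.

Section dct_cos.
Context d {E : measurableType d} {R : realType} (P : probability E R).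

Lemma cos_dct (f : nat -> E -> R) (g : E -> R) :
  (forall n, measurable_fun setT (f n)) -> measurable_fun setT g ->
  (forall x, f n x @[n --> \oo] --> g x) ->
  \int[P]_x cos (f n x) @[n --> \oo] --> \int[P]_x cos (g x).
Proof.
move=> mf mg fg.
have ic (h : E -> R) : measurable_fun setT h -> P.-integrable setT (EFin \o (fun x => cos (h x))).
  move=> mh; apply: (@prob_bounded_integrable _ _ _ P _ 1) => [|x]; last exact: cos_max.
  exact: measurable_fun_cos.
have i1 : P.-integrable setT (EFin \o cst (1 : R)).
  by apply: (@prob_bounded_integrable _ _ _ P (cst 1) 1) => // x; rewrite normr1.
have mi (h : E -> R) : measurable_fun setT h -> measurable_fun setT (EFin \o (fun x => cos (h x))).
  by move=> mh; exact/measurable_EFinP/measurable_fun_cos.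
have cv x : (EFin \o (fun x => cos (f n x))) x @[n --> \oo] --> (EFin \o (fun x => cos (g x))) x.
  apply: cvg_EFin; first exact: nearW.
  exact: (cvg_comp (fun n => f n x) cos (fg x) (continuous_cos (x := g x))).
have dom n x : (`|(EFin \o (fun x => cos (f n x))) x| <=  (cst 1 x)%:E)%E.
  by rewrite /= lee_fin; exact: cos_max.
have [_ _] := @dominated_convergence _ E R P setT measurableT _ _ _
  (fun n => mi _ (mf n)) (mi _ mg) (aeW _ (fun x _ => cv x)) i1
  (aeW _ (fun x n _ => dom n x)).
move=> h; apply: fine_cvg; rewrite -Rintegral_EFin; last exact: ic.
exact: h.
Qed.

End dct_cos.

(** From [cos y = 1 - 2 sin^2 (y/2)] and [|sin z| <= |z|]. *)
Lemma cos_ge_quadratic (R : realType) (y : R) : 1 - y ^+ 2 / 2 <= cos y.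
Proof.
have sin_bound z : sin z ^+ 2 <= z ^+ 2 :> R.
  wlog z0 : z / 0 <= z.
    move=> h; have [|z0] := leP 0 z; first exact: h.
    by rewrite -(sqrrN z) -(sqrrN (sin z)) -sinN h // oppr_ge0 ltW.
  have [c _ e] : exists2 c, c \in `[0, z] & sin z - sin 0 = cos c * (z - 0).
    have [<-|zn] := eqVneq 0 z; first by exists 0; rewrite ?subrr ?mulr0 // in_itv /= lexx.
    have [||c cz ->] := @MVT R sin cos 0 z _ (fun x _ => is_derive_sin x).
    - by rewrite lt_neqAle zn.
    - by apply: continuous_subspaceT; exact: continuous_sin.
    - by exists c => //; move: cz; rewrite !in_itv /= => /andP[/ltW -> /ltW ->].
  move: e; rewrite sin0 !subr0 => ->; by rewrite exprMn ler_piMl ?sqr_ge0.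
have := sin_bound (y / 2); rewrite -[X in _ <= cos X](_ : y / 2 + y / 2 = y); last by field.
rewrite cosD -!expr2; have := cos2Dsin2 (y / 2).
rewrite expr_div_n; set s := sin _ ^+ 2; set c := cos _ ^+ 2; lra.
Qed.

Section gaussian_fd.
Context {R : realType} {d : nat} {T : R}.
Local Notation C0 := (cpath T (0 : 'rV[R]_d)).

Definition fdfun (s : seq (R * 'rV[R]_d)) (x : C0) : R :=
  \sum_(p <- s) \sum_(i < d) p.2 0 i * x p.1 0 i.

Definition fd (l : C0 -> R) : Prop :=
  exists2 s, all (fun p => p.1 \in `[0, T]) s & l = fdfun s.

Lemma fd0 : fd (fun=> 0).
Proof. by exists [::] => //; apply/funext => x; rewrite /fdfun big_nil. Qed.

Lemma fd_lin a l l' : fd l -> fd l' -> fd (fun x => a * l x + l' x).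
Proof.
move=> [s hs ->] [s' hs' ->]; exists ([seq (p.1, a *: p.2) | p <- s] ++ s').
  by rewrite all_cat hs' andbT all_map.
apply/funext => x; rewrite /fdfun big_cat big_map mulr_sumr; congr (_ + _).
by apply: eq_bigr => p _; rewrite mulr_sumr; apply: eq_bigr => i _; rewrite mxE mulrA.
Qed.

Lemma fd_eval t i : t \in `[0, T] -> fd (fun x => x t 0 i).
Proof.
move=> ht; exists [:: (t, delta_mx 0 i)]; first by rewrite /= ht.
apply/funext => x; rewrite /fdfun big_seq1 (bigD1 i) //= big1 ?addr0 => [|j ji].
  by rewrite mxE !eqxx mul1r.
by rewrite mxE eqxx /= (negbTE ji) mul0r.
Qed.

Lemma fd_sum (I : Type) (r : seq I) (Q : pred I) (l : I -> C0 -> R) :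
  (forall i, Q i -> fd (l i)) -> fd (fun x => \sum_(i <- r | Q i) l i x).
Proof.
move=> h; elim: r => [|i r ih].
  by rewrite (_ : (fun x => _) = fun=> 0); [exact: fd0|apply/funext => x; rewrite big_nil].
case: (boolP (Q i)) => hi.
  rewrite (_ : (fun x => _) = fun x => 1 * l i x + \sum_(j <- r | Q j) l j x).
    by apply: fd_lin => //; exact: h.
  by apply/funext => x; rewrite big_cons hi mul1r.
by rewrite (_ : (fun x => _) = fun x => \sum_(j <- r | Q j) l j x) //; apply/funext => x; rewrite big_cons (negbTE hi).
Qed.

Lemma fd_ev k : fd (ev k).
Proof.
rewrite /ev; case: (unpickle k) => [[p i]|]; last exact: fd0.
have [h|h] := boolP (rtime p \in `[0, T]); last exact: fd0.
exact: fd_eval.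
Qed.

Variable gamma : probability C0 R.

(** A list of times and weights is read as the indexed family of [gaussian_process], after which the
    law of [X] transfers the claim. *)
Lemma fd_gaussian disp (Omega : measurableType disp) (P : probability Omega R) (X : Omega -> C0) l :
  gaussian_process P T X -> is_law P X gamma -> fd l -> exists m s, gaussian_rv gamma l m s.
Proof.
move=> hX hg [s hs ->].
have ml : measurable_fun setT (fdfun s : C0 -> measurableTypeR R).
  elim: s hs {hX} => [_|p s ih /= /andP[hp /ih mh]].
    by rewrite (_ : fdfun [::] = cst 0) //; apply/funext => x; rewrite /fdfun big_nil.
  rewrite (_ : fdfun (p :: s) = fun x => \sum_(i < d) p.2 0 i * x p.1 0 i + fdfun s x); last first.
    by apply/funext => x; rewrite /fdfun big_cons.
  apply: measurable_funD => //; apply: measurable_sum => i; apply: measurable_funM => //.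
  exact: measurable_eval.
have hs' (j : 'I_(size s)) : (nth (0, 0) s j).1 \in `[0, T].
  by have /all_nthP -> := hs.
have [_ [m [v h]]] := hX (size s) (fun j => (nth (0, 0) s j).1) (fun j => (nth (0, 0) s j).2) hs'.
exists m, v; split => // A mA; rewrite hg; last by rewrite -[X in measurable X]setTI; exact: ml.
rewrite -h //; congr (P _); apply/seteqP; split => w /=; rewrite /fdfun (big_nth (0, 0)) big_mkord //.
Qed.

Hypothesis fdG : forall l, fd l -> exists m s, gaussian_rv gamma l m s.

Definition center (l : C0 -> R) : C0 -> R := fun x => l x - \int[gamma]_x l x.

Local Notation ip := (ip gamma).
Local Notation L2 := (L2 gamma).
Definition fd_centered (W : C0 -> R) : Prop := exists2 l, fd l & W = center l.
Local Notation V := fd_centered.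

Let fd_integrable l : fd l -> gamma.-integrable setT (EFin \o l).
Proof. by move=> /fdG[m [s /gaussian_rv_mean[]]]. Qed.

Lemma center_lin a l l' : fd l -> fd l' ->
  center (fun x => a * l x + l' x) = fun x => a * center l x + center l' x.
Proof.
move=> /fd_integrable h /fd_integrable h'; apply/funext => x; rewrite /center.
rewrite RintegralD //; last exact: integrableZlR.
by rewrite RintegralZl //; ring.
Qed.

Lemma center0 : center (fun=> 0) = fun=> 0.
Proof. by apply/funext => x; rewrite /center Rintegral_prob_cst subr0. Qed.

Lemma fd_centered0 : V (fun=> 0).
Proof. by exists (fun=> 0); [exact: fd0|rewrite center0]. Qed.

Lemma fd_centered_lin a W W' : V W -> V W' -> V (fun x => a * W x + W' x).
Proof.
move=> [l hl ->] [l' hl' ->]; exists (fun x => a * l x + l' x); first exact: fd_lin.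
by rewrite center_lin.
Qed.

Lemma center_fd l : fd l -> V (center l). Proof. by exists l. Qed.

Let centerE l : fd l -> exists m s, [/\ gaussian_rv gamma l m s,
  center l = fun x => l x - m & ip (center l) (center l) = s ^+ 2].
Proof.
move=> /fdG[m [s h]]; have [_ e] := gaussian_rv_mean h; exists m, s.
have ce : center l = fun x => l x - m by rewrite /center e.
by split => //; rewrite ce -(gaussian_rv_variance h).2.
Qed.

Lemma fd_centered_L2 W : V W -> L2 W.
Proof.
move=> [l /centerE[m [s [h ce _]]] ->]; rewrite ce; split.
  by apply: measurable_funB => //; exact: h.1.
exact: (gaussian_rv_variance h).1.
Qed.

Lemma fd_centered_cos W c : V W -> \int[gamma]_x cos (W x + c) = expR (- (ip W W) / 2) * cos c.
Proof.
move=> [l /centerE[m [s [h ce e]]] ->]; rewrite e ce.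
have := gaussian_rv_cos h 1 c; rewrite expr1n mulr1 => <-.
by apply: eq_Rintegral => x _; rewrite mul1r.
Qed.

Lemma fd_cos_le l (tau c : R) : fd l ->
  \int[gamma]_x cos (tau * (l x - c)) <= expR (- (ip (center l) (center l) * tau ^+ 2) / 2).
Proof.
move=> /centerE[m [s [h ce e]]]; rewrite e.
have := gaussian_rv_cos h tau (tau * (m - c)).
have -> : \int[gamma]_x cos (tau * (l x - m) + tau * (m - c)) = \int[gamma]_x cos (tau * (l x - c)).
  by apply: eq_Rintegral => x _; congr cos; ring.
move=> ->.
by rewrite ler_piMr ?expR_ge0 // (le_trans (ler_norm _)) // cos_max.
Qed.

(** Pointwise convergence does not bound the variances of the approximants, but Gaussianity does: a
    variance of at least [v + eta] would keep the cosine transform at [tau] below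
    [exp(- (v + eta) tau^2 / 2)], while its limit is at least [1 - v tau^2 / 2], which is larger for
    small [tau]. *)
Lemma fd_var_limit (l : nat -> C0 -> R) (f : C0 -> R) (c v eta : R) :
  (forall n, fd (l n)) -> measurable_fun setT f -> (forall x, l n x @[n --> \oo] --> f x) ->
  gamma.-integrable setT (EFin \o (fun x => (f x - c) ^+ 2)) ->
  \int[gamma]_x (f x - c) ^+ 2 <= v -> 0 <= v -> 0 < eta ->
  \forall n \near \oo, ip (center (l n)) (center (l n)) < v + eta.
Proof.
move=> hl mf lf i2 iv v0 eta0.
(* [z] stands for [tau^2 / 2]. By [exp(-w) <= 1 / (1 + w)] it suffices that [(v + eta) z v < eta],
   and here the left side is [eta v / (v + 1)]. *)
pose z := eta / ((v + 1) * (v + eta)); pose tau := Num.sqrt (2 * z).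
have z0 : 0 < z by rewrite divr_gt0 // mulr_gt0 //; lra.
have tau2 : tau ^+ 2 = 2 * z by rewrite sqr_sqrtr // mulr_ge0 // ltW.
have ml n : measurable_fun setT (l n) by have [m [s [h _]]] := fdG (hl n).
have key : expR (- (v + eta) * z) < 1 - z * v.
  have azv : (v + eta) * z * v = eta - eta / (v + 1) by rewrite /z; field; lra.
  have ev0 : 0 < eta / (v + 1) by rewrite divr_gt0 //; lra.
  have az0 : 0 < 1 + (v + eta) * z by rewrite ltr_pwDl // mulr_ge0 ?(ltW z0) //; lra.
  rewrite mulNr expRN; apply: (@le_lt_trans _ _ (1 + (v + eta) * z)^-1).
    by rewrite lef_pV2 ?posrE ?expR_gt0 // expR_ge1Dx.
  rewrite -[X in X < _]mul1r ltr_pdivrMr //.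
  rewrite (_ : (1 - z * v) * _ = 1 + z * (v + eta - v - (v + eta) * z * v)); last by ring.
  rewrite azv ltrDl mulr_gt0 //; move: (eta / _) ev0 => w; lra.
have lim : \int[gamma]_x cos (tau * (l n x - c)) @[n --> \oo] --> \int[gamma]_x cos (tau * (f x - c)).
  apply: cos_dct => [n||x].
  - by apply: measurable_funM => //; exact: measurable_funB.
  - by apply: measurable_funM => //; exact: measurable_funB.
  - apply: cvgM; first exact: cvg_cst.
    by apply: cvgB => //; exact: cvg_cst.
have low : 1 - z * v <= \int[gamma]_x cos (tau * (f x - c)).
  have ic : gamma.-integrable setT (EFin \o (fun x => cos (tau * (f x - c)))).
    apply: (@prob_bounded_integrable _ _ _ gamma _ 1) => [|x]; last exact: cos_max.
    by apply: measurable_fun_cos; apply: measurable_funM => //; exact: measurable_funB.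
  have i1 : gamma.-integrable setT (EFin \o (fun=> (1 : R))).
    by apply: (@prob_bounded_integrable _ _ _ gamma (cst 1) 1) => // x; rewrite normr1.
  have iz : gamma.-integrable setT (EFin \o (fun x => z * (f x - c) ^+ 2)) by exact: integrableZlR.
  apply: (@le_trans _ _ (\int[gamma]_x (1 - z * (f x - c) ^+ 2))).
    rewrite RintegralB // Rintegral_prob_cst RintegralZl //.
    by rewrite lerD2l lerN2 ler_pM2l.
  apply: le_Rintegral => //; first exact: integrableBR.
  move=> x _; apply: le_trans (cos_ge_quadratic _).
  by rewrite exprMn tau2; move: (_ ^+ 2) => w; lra.
have /cvgr_gt/(_ _ (lt_le_trans key low)) := lim.
apply: filterS => n hn; have := lt_le_trans hn (fd_cos_le tau c (hl n)).
rewrite ltr_expR tau2 => h; rewrite ltNge; apply/negP => le.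
have : (v + eta) * z <= ip (center (l n)) (center (l n)) * z by rewrite ler_pM2r.
move: h; rewrite mulNr; set I := ip _ _; move: (v + eta) => w; lra.
Qed.

Definition wxi : nat -> C0 -> R := gs gamma (fun k => center (ev k)).
Definition wsg : nat -> bool := gs_nondeg gamma (fun k => center (ev k)).
Let VZ k : V (center (ev k)). Proof. exact/center_fd/fd_ev. Qed.

Let Vxi k : V (wxi k).
Proof. by apply: V_gs => //; [exact: fd_centered0|exact: fd_centered_lin]. Qed.

Let L2xi k : L2 (wxi k). Proof. exact: fd_centered_L2 (Vxi k). Qed.

Lemma measurable_wxi k : measurable_fun setT (wxi k).
Proof. exact: (L2xi k).1. Qed.

Lemma wxi_deg k : ~~ wsg k -> wxi k = fun=> 0.
Proof. exact: gs_deg. Qed.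

Lemma wxi_orth i j : ip (wxi i) (wxi j) = ((i == j) && wsg i)%:R.
Proof. exact: (gs_orthonormal fd_centered0 fd_centered_lin fd_centered_L2 VZ). Qed.

Definition wcoef k i := ip (center (ev k)) (wxi i).

Lemma ev_wxi k : {ae gamma, forall x, ev k x = \int[gamma]_x ev k x + \sum_(i < k.+1) wcoef k i * wxi i x}.
Proof.
have := gs_decomp fd_centered0 fd_centered_lin fd_centered_L2 VZ k.
by apply: filterS => x <-; rewrite /center addrC subrK.
Qed.

(** The coordinates are orthonormal or null and jointly Gaussian, so the cosine transform of any
    combination is that of independent coordinates. *)
Lemma std_family_wxi : std_family wsg gamma wxi.
Proof.
apply: std_family_of_cos => [k|k /wxi_deg //|n a c]; first exact: measurable_wxi.
rewrite fd_centered_cos; last first.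
  by apply: V_sum => //; [exact: fd_centered0|exact: fd_centered_lin].
congr (expR (- _ / 2) * _).
have [hs e] := ip_sumr n a L2xi (L2_0 gamma).
rewrite (ip_suml n a L2xi hs); apply: eq_bigr => i _.
rewrite (ip_sumr n a L2xi (L2xi i)).2 (bigD1 i) //= big1 ?addr0 => [|j ji].
  by rewrite wxi_orth eqxx /= mulrA -expr2 mulrC.
by rewrite wxi_orth (_ : (_ == _ :> nat) = false) ?mulr0 //; apply/negbTE; rewrite eq_sym.
Qed.

End gaussian_fd.

(** * Cameron-Martin paths *)

Section linear_combination.
Context {R : realType} {d : nat} {T : R}.
Hypothesis T0 : 0 < T.
Local Notation C0 := (cpath T (0 : 'rV[R]_d)).

Lemma path_cont_lincomb (I : Type) (r : seq I) (a : I -> R) (F : I -> C0) :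
  path_cont T (fun t => \sum_(i <- r) a i *: F i t).
Proof.
elim: r => [|i r ih].
  by under [X in path_cont _ X]eq_fun do rewrite big_nil; exact: path_cont_cst.
under [X in path_cont _ X]eq_fun do rewrite big_cons.
apply: path_contD => //; move=> t e ht e0.
have [|dl dl0 h] := path_cont_cpath (F i) ht (e := e / (`|a i| + 1)).
  by rewrite divr_gt0 // ltr_wpDl.
exists dl => // s hs ts; rewrite -scalerBr enormZ.
have := h s hs ts; rewrite ltr_pdivlMr ?ltr_wpDl // mulrC; apply: le_lt_trans.
by apply: ler_wpM2r; [exact: enorm_ge0|rewrite lerDl].
Qed.

Lemma dual_sum (l : C0 -> R) (I : Type) (r : seq I) (a : I -> R) (F : I -> C0) (z : C0) :
  dual l -> (forall t, t \in `[0, T] -> z t = \sum_(i <- r) a i *: F i t) ->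
  l z = \sum_(i <- r) a i * l (F i).
Proof.
move=> [_ lin]; elim: r z => [|i r ih] z hz.
  rewrite big_nil (lin (-1) z z z) ?mulN1r ?addNr // => t.
  rewrite scaleN1r addNr; have [ht|ht] := boolP (t \in `[0, T]).
    by rewrite hz // big_nil.
  by rewrite cpath_outside.
(* Linearity in [dual] is stated for triples of paths, so the partial sum must be realised as a
   path. *)
pose z' : C0 := to_cpath 0 (fun t => \sum_(i <- r) a i *: F i t).
have hz' : forall t, t \in `[0, T] -> z' t = \sum_(i <- r) a i *: F i t.
  apply: to_cpathE; first exact: path_cont_lincomb.
  by rewrite big1 // => j _; rewrite cpath_start scaler0.
rewrite (lin (a i) (F i) z' z) ?big_cons ?(ih z') // => t.
have [ht|ht] := boolP (t \in `[0, T]); first by rewrite hz // hz' // big_cons.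
by rewrite !cpath_outside // scaler0 addr0.
Qed.

End linear_combination.

(** * Piecewise linear interpolation of paths *)

Section interpolation.
Context {R : realType} {d : nat} {T : R}.
Hypothesis T0 : 0 < T.
Local Notation C0 := (cpath T (0 : 'rV[R]_d)).
Local Notation RT := 'rV[R]_d.

Let clamp0 (s : R) : s <= 0 -> clamp 1 s = 0.
Proof. by move=> s0; rewrite /clamp; apply/max_idPl; rewrite ge_min s0. Qed.

Let clamp1 (s : R) : 1 <= s -> clamp 1 s = 1.
Proof. by move=> s1; rewrite /clamp (min_idPr s1); apply/max_idPr. Qed.

(** Ramps of index below [k] are saturated and telescope to [a k - a 0], the [k]-th is partial, and
    those above are still zero. *)
Lemma clamp_sum (a : nat -> RT) n (s : R) : 0 <= s <= n.+1%:R ->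
  exists k, [/\ (k <= n)%N, k%:R <= s <= k.+1%:R &
    \sum_(j < n.+1) clamp 1 (s - j%:R) *: (a j.+1 - a j) =
    a k - a 0%N + (s - k%:R) *: (a k.+1 - a k)].
Proof.
elim: n => [|n ih] /andP[s0 s1].
  exists 0%N; split => //; first by rewrite s0 s1.
  by rewrite big_ord_recl big_ord0 addr0 subrr add0r clampE // in_itv /= subr0 s0.
have [sn|sn] := leP s n.+1%:R.
  have [|k [kn ks e]] := ih; first by rewrite s0.
  exists k; split => //; first exact: leqW.
  by rewrite big_ord_recr /= e (clamp0 (s := s - _)) ?subr_le0 // scale0r addr0.
exists n.+1; split => //; first by rewrite (ltW sn).
rewrite big_ord_recr /= clampE; last by rewrite in_itv /= subr_ge0 (ltW sn) lerBlDl natr1.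
congr (_ + _); rewrite (eq_bigr (fun j : 'I_n.+1 => a j.+1 - a j)) => [|j _].
  by rewrite -(big_mkord xpredT (fun j => a j.+1 - a j)) telescope_sumr.
rewrite clamp1 ?scale1r // lerBrDr addrC natr1 (le_trans _ (ltW sn)) // ler_nat.
exact: ltn_ord.
Qed.

Definition gridpt (n j : nat) : R := T * (j%:R / n.+1%:R).

Lemma gridpt_in n j : (j <= n.+1)%N -> gridpt n j \in `[0, T].
Proof.
move=> jn; rewrite in_itv /= /gridpt mulr_ge0 ?divr_ge0 ?ler0n ?(ltW T0) //=.
by rewrite ler_piMr ?(ltW T0) // ler_pdivrMr // mul1r ler_nat.
Qed.

(** A ramp that stays at 1 after cell [j], to be weighted by an increment; it starts at 0 and
    therefore lies in [C0]. *)
Definition hat (n j : nat) (i : 'I_d) : C0 :=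
  to_cpath 0 (fun t => clamp 1 (n.+1%:R * (t / T) - j%:R) *: (delta_mx 0 i : RT)).

Lemma hatE n j i t : t \in `[0, T] ->
  hat n j i t = clamp 1 (n.+1%:R * (t / T) - j%:R) *: (delta_mx 0 i : RT).
Proof.
apply: to_cpathE; last by rewrite mul0r mulr0 sub0r clamp0 ?scale0r // oppr_le0.
move=> {}t e ht e0; set D := enorm (delta_mx 0 i : RT).
have D0 : 0 <= D by exact: enorm_ge0.
have nT : 0 < n.+1%:R / T by rewrite divr_gt0.
exists (e / (n.+1%:R / T * (D + 1))) => [|s hs].
  by rewrite divr_gt0 // mulr_gt0 //; lra.
rewrite ltr_pdivlMr; last by rewrite mulr_gt0 //; lra.
move=> lt; rewrite -scalerBl enormZ; apply: le_lt_trans lt.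
rewrite [leRHS]mulrA; apply: ler_pM => //; last by rewrite -/D lerDl.
apply: (le_trans (clamp_dist ltr01 _ _)).
rewrite opprB addrA subrK -mulrBr -mulrBl normrM normrM.
rewrite (gtr0_norm (x := n.+1%:R)) // (gtr0_norm (x := T^-1)) ?invr_gt0 //.
by rewrite mulrC -mulrA [X in _ <= _ * X]mulrC.
Qed.

(** The interpolant combines fixed paths with coefficients that are evaluations of [y], so a
    continuous linear functional composed with it is a finite-dimensional functional of [y]. *)
Definition interp (n : nat) (y : C0) : C0 := to_cpath 0 (fun t =>
  \sum_(p : 'I_n.+1 * 'I_d) (y (gridpt n p.1.+1) - y (gridpt n p.1)) 0 p.2 *: hat n p.1 p.2 t).

Lemma interpE n y t : t \in `[0, T] -> interp n y t =
  \sum_(p : 'I_n.+1 * 'I_d) (y (gridpt n p.1.+1) - y (gridpt n p.1)) 0 p.2 *: hat n p.1 p.2 t.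
Proof.
move: t; apply: to_cpathE; last first.
  by rewrite big1 // => p _; rewrite cpath_start scaler0.
exact: path_cont_lincomb.
Qed.

Lemma interp_clamp n y t : t \in `[0, T] -> interp n y t =
  \sum_(j < n.+1) clamp 1 (n.+1%:R * (t / T) - j%:R) *: (y (gridpt n j.+1) - y (gridpt n j)).
Proof.
move=> ht; rewrite interpE // -(pair_bigA _ (fun (j : 'I_n.+1) (i : 'I_d) => (y (gridpt n j.+1) - y (gridpt n j)) 0 i *: hat n j i t)) /=.
apply: eq_bigr => j _; rewrite [in RHS](row_sum_delta (y _ - y _)) scaler_sumr.
by apply: eq_bigr => i _; rewrite hatE // !scalerA mulrC.
Qed.

Lemma interp_cvg (y : C0) (e : R) : 0 < e ->
  \forall n \near \oo, forall t, t \in `[0, T] -> enorm (y t - interp n y t) < e.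
Proof.
move=> e0; have [dl dl0 hdl] := cpath_unif_continuous y (divr_gt0 e0 (ltr0n _ 2)).
near=> n => t ht.
have Tn : T / n.+1%:R < dl.
  rewrite mulrC -ltr_pdivlMr //.
  by near: n; exact: (near_infty_natSinv_lt (PosNum (divr_gt0 dl0 T0))).
have [t0 tT] : 0 <= t /\ t <= T by apply/andP.
have sb : 0 <= n.+1%:R * (t / T) <= n.+1%:R.
  by rewrite mulr_ge0 ?divr_ge0 ?(ltW T0) //= ler_piMr // ler_pdivrMr // mul1r.
rewrite interp_clamp //.
have [k [kn /andP[ks sk] ->]] := clamp_sum (fun j => y (gridpt n j)) sb.
have th : t = T * (n.+1%:R * (t / T) / n.+1%:R).
  by rewrite mulrAC mulfV ?pnatr_eq0 // mul1r mulrC divfK // gt_eqF.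
move: (n.+1%:R * (t / T)) ks sk th sb => s ks sk th sb.
have gk : gridpt n k \in `[0, T] by apply: gridpt_in; exact: leqW.
have gk1 : gridpt n k.+1 \in `[0, T] by apply: gridpt_in.
have d1 : enorm (y t - y (gridpt n k)) < e / 2.
  apply: hdl => //; apply: le_lt_trans Tn.
  rewrite th /gridpt -mulrBr -mulrBl normrM normrM (gtr0_norm T0) (ger0_norm (x := s - _)) ?subr_ge0 //.
  rewrite gtr0_norm ?invr_gt0 // ler_pM2l // ler_piMl ?invr_ge0 //.
  by rewrite lerBlDl natr1.
have d2 : enorm (y (gridpt n k.+1) - y (gridpt n k)) < e / 2.
  apply: hdl => //; apply: le_lt_trans Tn.
  rewrite /gridpt -mulrBr -mulrBl -natrB // subSnn mul1r.
  by rewrite gtr0_norm // divr_gt0.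
have y0 : y (gridpt n 0) = 0 by rewrite /gridpt mul0r mulr0 cpath_start.
rewrite y0 subr0 opprD addrA; apply: (le_lt_trans (enormB _ _)).
rewrite enormZ.
have s1 : `|s - k%:R| <= 1 by rewrite ger0_norm ?subr_ge0 // lerBlDl natr1.
have := ler_wpM2r (enorm_ge0 (y (gridpt n k.+1) - y (gridpt n k))) s1.
move: (`|_| * _) d1 d2 => w; lra.
Unshelve. all: by end_near.
Qed.

End interpolation.

(** * Paths represented by linear functionals of the process *)

Section shift.
Context {R : realType} {d : nat} {T : R}.
Hypothesis T0 : 0 < T.
Local Notation C0 := (cpath T (0 : 'rV[R]_d)).
Variable gamma : probability C0 R.
Hypothesis fdG : forall l, fd l -> exists m s, gaussian_rv gamma l m s.
Local Notation center := (center gamma).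
Local Notation ip := (ip gamma).

Variable H : (C0 -> R) -> R.
Hypothesis Hlin : forall a l l', fd l -> fd l' ->
  H (center (fun x => a * l x + l' x)) = a * H (center l) + H (center l').

Let H0 : H (center (fun=> 0)) = 0.
Proof.
have := Hlin (-1) (@fd0 R d T) (@fd0 R d T); rewrite mulr0 addr0 mulN1r addNr; exact.
Qed.

Let H_sum (I : Type) (r : seq I) (a : I -> R) (l : I -> C0 -> R) : (forall i, fd (l i)) ->
  H (center (fun x => \sum_(i <- r) a i * l i x)) = \sum_(i <- r) a i * H (center (l i)).
Proof.
move=> hl; elim: r => [|i r ih].
  by rewrite big_nil -[RHS]H0; congr (H (center _)); apply/funext => x; rewrite big_nil.
rewrite big_cons -ih -Hlin //.
  by congr (H (center _)); apply/funext => x; rewrite big_cons.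
elim: r {ih} => [|j r ih].
  rewrite (_ : (fun x => _) = fun=> 0); first exact: fd0.
  by apply/funext => x; rewrite big_nil.
rewrite (_ : (fun x => _) = fun x => a j * l j x + \sum_(i <- r) a i * l i x).
  exact: fd_lin.
by apply/funext => x; rewrite big_cons.
Qed.

(** When [H W] is the expectation of [Z W] for a fixed Gaussian [Z], this is the classical
    Cameron-Martin path, whose value at [t] is the covariance of [Z] with the process at time
    [t]. *)
Definition shift_path : C0 := to_cpath 0 (fun t => \row_c H (center (fun x => x t 0 c))).

Let fdB s t c : s \in `[0, T] -> t \in `[0, T] -> fd ((fun x => x s 0 c - x t 0 c) : C0 -> R).
Proof.
move=> hs ht; rewrite (_ : (fun x => _) = fun x : C0 => (-1) * x t 0 c + x s 0 c).
  by apply: fd_lin; exact: fd_eval.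
by apply/funext => x; rewrite mulN1r addrC.
Qed.

Let HB s t c : s \in `[0, T] -> t \in `[0, T] ->
  H (center (fun x => x s 0 c - x t 0 c)) =
  H (center (fun x => x s 0 c)) - H (center (fun x => x t 0 c)).
Proof.
move=> hs ht; rewrite addrC -mulN1r -Hlin; [|exact: fd_eval..].
by congr (H (center _)); apply/funext => x; rewrite mulN1r addrC.
Qed.

Section bound.
Variable U : R.
Hypothesis U0 : 0 <= U.
Hypothesis HU : forall l, fd l -> `|H (center l)| <= U * Num.sqrt (ip (center l) (center l)).

(** If continuity failed at [t] along times [s n], the differences [x t - x (s n)] would still tend
    to 0 for every path; being Gaussian they have variances tending to 0, by [fd_var_limit] with
    [v = 0], and [HU] carries this over to [H]. *)
Let shift_path_cont : path_cont T (fun t => \row_c H (center (fun x => x t 0 c))).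
Proof.
move=> t e ht e0; apply: contrapT => hn.
have {hn} hs n : exists s, [/\ s \in `[0, T], `|t - s| < n.+1%:R^-1 &
    e <= enorm ((\row_c H (center (fun x => x t 0 c))) - (\row_c H (center (fun x => x s 0 c))))].
  apply: contrapT => h; apply: hn; exists n.+1%:R^-1 => [|s hs ts]; first by rewrite invr_gt0.
  by rewrite ltNge; apply/negP => le; apply: h; exists s.
have /choice[s hs'] := hs.
have sin n : s n \in `[0, T] by have [] := hs' n.
(* Once the variance is below [eta], [HU] bounds each coordinate by [e / d.+1], and the sum of [d]
   of these is below [e]. *)
pose eta := (e / ((U + 1) * d.+1%:R)) ^+ 2.
have ep : 0 < e / ((U + 1) * d.+1%:R) by rewrite divr_gt0 // mulr_gt0 // ltr_wpDl.
have eta0 : 0 < eta by rewrite exprn_gt0.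
have near_c (c : 'I_d) : \forall n \near \oo,
    `|H (center (fun x => x t 0 c)) - H (center (fun x => x (s n) 0 c))| < e / d.+1%:R.
  have := @fd_var_limit _ _ _ _ fdG (fun n x => x t 0 c - x (s n) 0 c) (fun=> 0) 0 0 eta
    (fun n => fdB c ht (sin n)) (measurable_cst _).
  have lim (x : C0) : x t 0 c - x (s n) 0 c @[n --> \oo] --> (0 : R).
    apply/cvgrPdist_lt => e' e'0; have [dl dl0 h] := cpath_within_dist x ht e'0.
    near=> n; rewrite sub0r normrN; apply: (@le_lt_trans _ _ (enorm (x t - x (s n)))).
      by have := coord_le_enorm (x t - x (s n)) c; rewrite !mxE.
    apply: h => //; have [_ ts _] := hs' n; apply: (lt_trans ts).
    by near: n; exact: (near_infty_natSinv_lt (PosNum dl0)).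
  have i0 : gamma.-integrable setT (EFin \o (fun=> (0 - 0 : R) ^+ 2)) by apply: eq_integrable (L2_0 gamma).2 => // x _; rewrite /= subrr.
  have e00 : \int[gamma]_x ((fun=> 0) x - 0 : R) ^+ 2 <= 0.
    by rewrite Rintegral_prob_cst subrr expr0n.
  move=> /(_ lim i0 e00 (lexx 0) eta0); apply: filterS => n hn.
  rewrite -HB //; apply: (le_lt_trans (HU (fdB c ht (sin n)))).
  move: hn; rewrite add0r; set w := ip _ _ => hn.
  have hw : Num.sqrt w < e / ((U + 1) * d.+1%:R).
    rewrite -(@ltr_pXn2r _ 2) // ?nnegrE ?sqrtr_ge0 ?(ltW ep) // sqr_sqrtr //.
    exact: ip_ge0.
  have -> : e / d.+1%:R = (U + 1) * (e / ((U + 1) * d.+1%:R)).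
    by rewrite invfM mulrCA mulVKf // gt_eqF // ltr_wpDl.
  apply: (@le_lt_trans _ _ ((U + 1) * Num.sqrt w)); last by rewrite ltr_pM2l // ltr_wpDl.
  by rewrite ler_wpM2r ?sqrtr_ge0 // lerDl.
have [n _ /(_ n (leqnn n)) hn] := @filter_forall _ _ _ \oo _ near_c.
have [_ _] := hs' n; apply/negP; rewrite -ltNge.
apply: (le_lt_trans (enorm_le_sum _)).
apply: (@le_lt_trans _ _ (\sum_(c < d) e / d.+1%:R)).
  by apply: ler_sum => c _; rewrite !mxE ltW.
rewrite sumr_const card_ord -(mulr_natr (e / d.+1%:R)) -mulrA gtr_pMr //.
by rewrite mulrC ltr_pdivrMr // mul1r ltr_nat.
Unshelve. all: by end_near.
Qed.

Lemma shift_pathE t c : t \in `[0, T] -> shift_path t 0 c = H (center (fun x => x t 0 c)).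
Proof.
move=> ht; rewrite /shift_path (to_cpathE shift_path_cont _ ht) ?mxE //.
apply/rowP => i; rewrite !mxE; rewrite -[RHS]H0; congr (H (center _)).
by apply/funext => x; rewrite cpath_start mxE.
Qed.

(** On interpolants a continuous functional [l] is a finite combination of evaluations, so its value
    at the path is [H] of a centred Gaussian functional and is bounded by [U] times its deviation.
    [fd_var_limit] keeps the variance below [1 + eta] for large [n], and [eta] is arbitrary. *)
Lemma cm_norm_shift_path : (cm_norm gamma shift_path <= U%:E)%E.
Proof.
apply: ge_ereal_sup => _ [l [dl vl] <-]; rewrite lee_fin.
have ml : measurable_fun setT l by exact: continuous_cpath_measurable dl.1.
have [c vc] : exists c, (\int[gamma]_x ((l x - c) ^+ 2)%:E <= 1)%E.
  exists (fine 'E_gamma[l]%E); move: vl.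
  by rewrite /variance unlock expectation.unlock.
have m2 : measurable_fun setT (fun x => (l x - c) ^+ 2).
  by apply: measurable_funX; exact: measurable_funB.
have i2 : gamma.-integrable setT (EFin \o (fun x => (l x - c) ^+ 2)).
  apply/integrableP; split; first exact/measurable_EFinP.
  under eq_integral do rewrite /= ger0_norm ?sqr_ge0 //.
  exact: le_lt_trans vc (ltry _).
have v1 : \int[gamma]_x (l x - c) ^+ 2 <= 1 by rewrite -lee_fin -Rintegral_EFin.
have cvi x : l (interp n x) @[n --> \oo] --> l x.
  apply/cvgrPdist_lt => e e0.
  have [dl' dl'0 h] := (cpath_continuousP l).1 dl.1 x e e0.
  by apply: filterS (interp_cvg T0 x dl'0) => n hn; apply: h.
have liE n x : l (interp n x) = \sum_(p : 'I_n.+1 * 'I_d)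
    l (hat n p.1 p.2) * (x (@gridpt R T n p.1.+1) 0 p.2 - x (@gridpt R T n p.1) 0 p.2).
  rewrite (dual_sum dl (@interpE _ _ _ n x)).
  by apply: eq_bigr => p _; rewrite !mxE mulrC.
have gp n (p : 'I_n.+1 * 'I_d) : @gridpt R T n p.1.+1 \in `[0, T] /\ @gridpt R T n p.1 \in `[0, T].
  by split; apply: gridpt_in => //; exact: ltnW.
have fdl n : fd (fun x => l (interp n x)).
  rewrite (_ : (fun x => _) = fun x : C0 => \sum_(p : 'I_n.+1 * 'I_d)
    l (hat n p.1 p.2) * (x (@gridpt R T n p.1.+1) 0 p.2 - x (@gridpt R T n p.1) 0 p.2)); last first.
    by apply/funext => x; exact: liE.
  apply: fd_sum => p _; have [g1 g2] := gp n p.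
  rewrite (_ : (fun x => _) = fun x : C0 => l (hat n p.1 p.2) * (x (@gridpt R T n p.1.+1) 0 p.2 - x (@gridpt R T n p.1) 0 p.2) + 0).
    by apply: fd_lin; [exact: fdB|exact: fd0].
  by apply/funext => x; rewrite addr0.
have liH n : l (interp n shift_path) = H (center (fun x => l (interp n x))).
  rewrite liE (_ : (fun x => _) = fun x : C0 => \sum_(p : 'I_n.+1 * 'I_d)
    l (hat n p.1 p.2) * (x (@gridpt R T n p.1.+1) 0 p.2 - x (@gridpt R T n p.1) 0 p.2)); last first.
    by apply/funext => x; exact: liE.
  rewrite (H_sum _ _ (fun p => fdB p.2 (gp n p).1 (gp n p).2)); apply: eq_bigr => p _.
  by rewrite HB ?shift_pathE ?(gp n p).1 ?(gp n p).2.
apply/ler_addgt0Pr => e e0; pose eta := e / (U + 1).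
have U1 : 0 < U + 1 by rewrite ltr_wpDl.
have eta0 : 0 < eta by rewrite divr_gt0.
have near_l := fd_var_limit fdG fdl ml cvi i2 v1 ler01 eta0.
apply: (@le_trans _ _ (U * (1 + eta))).
  rewrite -(cvg_lim _ (cvi shift_path)) //; apply: limr_le; first by apply/cvg_ex; eexists; exact: cvi.
  apply: filterS near_l => n hn; rewrite liH (le_trans (ler_norm _)) // (le_trans (HU (fdl n))) //.
  apply: ler_wpM2l => //; rewrite -(@ler_pXn2r _ 2) // ?nnegrE ?sqrtr_ge0 ?addr_ge0 ?(ltW eta0) //.
  rewrite sqr_sqrtr ?ip_ge0 // (le_trans (ltW hn)) // expr2 ler_peMr ?lerDl ?(ltW eta0) //.
  by rewrite addr_ge0 // ltW.
rewrite mulrDr mulr1 lerD2l /eta mulrCA ger_pMr // ler_pdivrMr // mul1r lerDl; exact: ler01.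
Qed.

End bound.
End shift.

Section cameron_martin_path.
Context {R : realType} {d : nat} {T : R}.
Hypothesis T0 : 0 < T.
Local Notation C0 := (cpath T (0 : 'rV[R]_d)).
Variable gamma : probability C0 R.
Hypothesis fdG : forall l, fd l -> exists m s, gaussian_rv gamma l m s.
Local Notation center := (center gamma).
Variable u : nat -> R.

Definition cm_path : C0 := shift_path gamma (pairing gamma (wxi gamma) u).

Let L2c l : fd l -> L2 gamma (center l).
Proof. by move=> hl; apply: (fd_centered_L2 fdG); exact: center_fd. Qed.

Let L2xi k : L2 gamma (wxi gamma k).
Proof.
apply: (fd_centered_L2 fdG); apply: V_gs; first exact: fd_centered0.
- exact: fd_centered_lin.
- by move=> i; exact/center_fd/fd_ev.
Qed.

Section bounded.
Variable U : R.
Hypotheses (U0 : 0 <= U) (hU : forall n, \sum_(i < n) u i ^+ 2 <= U ^+ 2).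

Let Hlin a l l' : fd l -> fd l' ->
  pairing gamma (wxi gamma) u (center (fun x => a * l x + l' x)) =
  a * pairing gamma (wxi gamma) u (center l) + pairing gamma (wxi gamma) u (center l').
Proof.
move=> hl hl'; rewrite (center_lin fdG) //.
by apply: (pairing_lin L2xi (wxi_orth fdG) U0 hU); exact: L2c.
Qed.

Let HU l : fd l -> `|pairing gamma (wxi gamma) u (center l)| <=
  U * Num.sqrt (ip gamma (center l) (center l)).
Proof. by move=> hl; apply: (pairing_bound L2xi (wxi_orth fdG) U0 hU); exact: L2c. Qed.

Lemma cm_norm_cm_path : (cm_norm gamma cm_path <= U%:E)%E.
Proof. exact: (cm_norm_shift_path T0 fdG Hlin U0 HU). Qed.

(** The series stops at [k] because evaluation [k] is orthogonal to the later coordinates. As far as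
    evaluations can tell, adding this path moves each coordinate [wxi i] by [u i]. *)
Lemma ev_cm_path k : ev k cm_path = \sum_(i < k.+1) wcoef gamma k i * u i.
Proof.
have -> : ev k cm_path = pairing gamma (wxi gamma) u (center (ev k)).
  rewrite {1}/ev [in RHS]/ev; case: (unpickle k) => [[p i]|]; last first.
    by rewrite center0 (@pairing_finite _ _ _ gamma (wxi gamma) u _ 0) ?big_ord0 // => i _; rewrite ipC ip_0l.
  have [h|h] := boolP (rtime p \in `[0, T]); first exact: (shift_pathE fdG Hlin U0 HU).
  by rewrite center0 (@pairing_finite _ _ _ gamma (wxi gamma) u _ 0) ?big_ord0 // => j _; rewrite ipC ip_0l.
rewrite (@pairing_finite _ _ _ gamma (wxi gamma) u _ k.+1) => [|i ki].
  by apply: eq_bigr => i _; rewrite /wcoef ipC mulrC.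
rewrite ipC; apply: (@gs_coef0 _ _ _ gamma (fd_centered gamma)) ki.
- exact: fd_centered0.
- exact: fd_centered_lin.
- exact: fd_centered_L2.
- by move=> j; exact/center_fd/fd_ev.
Qed.

End bounded.
End cameron_martin_path.

(** * The coupling *)

Section transfer.
Context d1 d2 {E1 : measurableType d1} {E2 : measurableType d2} {R : realType}.
Local Notation RR := (measurableTypeR R).
Variables (P1 : probability E1 R) (P2 : probability E2 R).
Variables (Z1 : nat -> E1 -> RR) (Z2 : nat -> E2 -> RR) (sg : nat -> bool).
Hypotheses (mZ1 : forall k, measurable_fun setT (Z1 k)) (mZ2 : forall k, measurable_fun setT (Z2 k)).
Hypotheses (h1 : std_family sg P1 Z1) (h2 : std_family sg P2 Z2).

Local Notation coord := (fun k (s : nat -> RR) => s k).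
Local Notation S := (g_sigma_algebraType (cylG coord)).

Lemma measurable_sequence d (E : measurableType d) (Z : nat -> E -> RR) :
  (forall k, measurable_fun setT (Z k)) -> measurable_fun setT ((fun x k => Z k x) : E -> S).
Proof.
move=> mZ; apply: (@measurability _ _ E S setT _ (cylG coord)) => //.
move=> _ [_ [n _ [B [mB ->]]] <-]; rewrite setTI.
by have := @measurable_cyl _ _ _ Z n B (fun k _ => mZ k) mB.
Qed.

Lemma std_family_transfer (A : set S) : measurable A ->
  P1 [set x | A (fun k => Z1 k x)] = P2 [set x | A (fun k => Z2 k x)].
Proof.
move=> mA; pose m1 := law P1 (measurable_sequence mZ1); pose m2 := law P2 (measurable_sequence mZ2).
apply: (@prob_eq_generated _ S R (cylG coord) m1 m2) => //.
- exact: setI_closed_cylG.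
- exact: cylGT.
- exact: (le_lt_trans (probability_le1 m1 measurableT) (ltry _)).
move=> _ [n _ [B [mB ->]]]; exact: (etrans (h1 n mB) (esym (h2 n mB))).
Qed.

(** Evaluations are affine in the coordinates, so the equality in law of two standard families
    passes to them. *)
Lemma std_family_affine (m : nat -> R) (c : nat -> nat -> R) n (B : nat -> set RR) :
  (forall k, measurable (B k)) ->
  P1 (cyl (fun k x => m k + \sum_(i < k.+1) c k i * Z1 i x) n B) =
  P2 (cyl (fun k x => m k + \sum_(i < k.+1) c k i * Z2 i x) n B).
Proof.
move=> mB; pose A : set S := cyl (fun k (s : S) => m k + \sum_(i < k.+1) c k i * s i) n B.
apply: (@std_family_transfer A); apply: measurable_cyl => // k _.
apply: measurable_funD => //; apply: measurable_sum => i; apply: measurable_funM => //.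
by move=> _ D mD; rewrite setTI; exact: (measurable_cylG (z := coord) i mD).
Qed.

End transfer.

Lemma coord_dist_le_enorm (R : realType) (d : nat) (x y : 'rV[R]_d) i :
  `|x 0 i - y 0 i| <= enorm (x - y).
Proof. by have := coord_le_enorm (x - y) i; rewrite !mxE. Qed.

(** * The noise map and the solution map *)

Section ito_paths.
Context {R : realType} {d : nat} {T : R} (xi : 'rV[R]_d).
Variables (b : 'rV[R]_d -> 'rV[R]_d) (L : R).
Hypotheses (T0 : 0 < T) (hL : 0 < L).
Hypothesis hb : forall x y : 'rV[R]_d, enorm (b x - b y) <= L * enorm (x - y).
Local Notation C0 := (cpath T (0 : 'rV[R]_d)).
Local Notation C := (cpath T xi).

Definition noise (y : C) : C0 := to_cpath 0 (fun t => y t - xi - drift_int b y t).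

Let T00 : (0 : R) \in `[0, T]. Proof. by rewrite in_itv /= lexx ltW. Qed.

Lemma noiseE y t : t \in `[0, T] -> noise y t = y t - xi - drift_int b y t.
Proof.
move: t; apply: to_cpathE.
  apply: path_contB; last exact: (path_cont_drift_int T0 hb (path_cont_cpath y)).
  apply: path_contB; [exact: path_cont_cpath|exact: path_cont_cst].
by rewrite cpath_start subrr sub0r (drift_int0 T0 hb (path_cont_cpath y)) oppr0.
Qed.

Lemma noise_ito (y : C) t : t \in `[0, T] -> y t = ito_step xi b (noise y) y t.
Proof. by move=> ht; rewrite /ito_step noiseE //; apply/rowP => i; rewrite !mxE; ring. Qed.

Lemma drift_int_lipschitz (f g : C) e t : (forall s, s \in `[0, T] -> enorm (f s - g s) <= e) ->
  t \in `[0, T] -> enorm (drift_int b f t - drift_int b g t) <= L * T * e.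
Proof.
move=> h ht; have [t0 tT] : 0 <= t /\ t <= T by apply/andP.
have e0 : 0 <= e := le_trans (enorm_ge0 _) (h 0 T00).
have := drift_int_diff T0 hb (path_cont_cpath f) (path_cont_cpath g)
  (u := fun=> L * e) (G := fun s => s * (L * e)) (r := 0) (t := t).
rewrite !(drift_int0 T0 hb) ?subr0; [|exact: path_cont_cpath..].
move=> /(_ _ _ (lexx 0) t0 tT) k.
apply: (le_trans (k _ _)).
- by move=> s _; apply: is_derive_eq; rewrite /GRing.scale /=; ring.
- by move=> s /h hs; rewrite ler_pM2l.
- by rewrite mul0r subr0 [L * T]mulrC -mulrA ler_wpM2r // mulr_ge0 // ltW.
Qed.

Lemma measurable_noise : measurable_fun setT noise.
Proof.
apply: (cpath_measurable_fun T0) => p i; move: (rtime p) => s pT.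
apply: (@lipschitz_cpath_measurable _ _ _ _ _ (1 + L * T)) => x y e h.
apply: (@le_trans _ _ (enorm (noise x s - noise y s))).
  exact: coord_dist_le_enorm.
rewrite !noiseE // mulrDl mul1r.
rewrite [X in enorm X](_ : _ = (x s - y s) - (drift_int b x s - drift_int b y s)).
  by apply: (le_trans (enormB _ _)); apply: lerD; [exact: h|exact: drift_int_lipschitz].
by apply/rowP => j; rewrite !mxE; ring.
Qed.

Lemma ito_path_exists (x : C0) : exists y : C,
  forall t, t \in `[0, T] -> y t = ito_step xi b x y t.
Proof.
have [f [fc fE]] := ito_exists xi T0 hL hb (path_cont_cpath x).
have f0 : f 0 = xi by rewrite fE // /ito_step (drift_int0 T0 hb fc) cpath_start !addr0.
have [y yE] := cpath_exists fc f0; exists y => t ht.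
rewrite yE // fE // /ito_step; congr (_ + _ + _).
apply/rowP => i; rewrite !mxE; apply: eq_Rintegral => s.
rewrite inE /= in_itv /= => /andP[s0 st]; rewrite yE // in_itv /= s0 /=.
by apply: le_trans st _; move: ht; rewrite in_itv => /andP[].
Qed.

Definition ito_path (x : C0) : C :=
  get [set y : C | forall t, t \in `[0, T] -> y t = ito_step xi b x y t].

Lemma ito_pathE x t : t \in `[0, T] -> ito_path x t = ito_step xi b x (ito_path x) t.
Proof. move: t; pose A := [set y : C | forall t, t \in `[0, T] -> y t = ito_step xi b x y t].
by have [y hy] := ito_path_exists x; exact: (@getPex _ A (ex_intro _ y hy)). Qed.

Lemma ito_path_dist (x y : C0) e : (forall t, t \in `[0, T] -> enorm (x t - y t) <= e) ->
  forall t, t \in `[0, T] -> enorm (ito_path x t - ito_path y t) <= expR (L * T) * e.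
Proof.
move=> h t ht; have e0 : 0 <= e := le_trans (enorm_ge0 _) (h 0 T00).
apply: (le_trans (ito_bound T0 hL hb (path_cont_cpath (ito_path x)) (path_cont_cpath (ito_path y)) (@ito_pathE x) (@ito_pathE y) h ht)).
rewrite mulrC ler_wpM2r // ler_expR ler_pM2l //.
by move: ht; rewrite in_itv => /andP[].
Qed.

Lemma measurable_ito_path : measurable_fun setT ito_path.
Proof.
apply: (cpath_measurable_fun T0) => p i; move: (rtime p) => s pT.
apply: (@lipschitz_cpath_measurable _ _ _ _ _ (expR (L * T))) => x y e h.
apply: (@le_trans _ _ (enorm (ito_path x s - ito_path y s))).
  exact: coord_dist_le_enorm.
exact: ito_path_dist.
Qed.

(** Uniqueness of the solution: the stability bound with [A = 0]. *)
Lemma noiseK y : ito_path (noise y) = y.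
Proof.
apply: cpath_eqP => t ht; apply/eqP; rewrite -subr_eq0 -enorm_eq0 eq_le enorm_ge0 andbT.
have h0 s : s \in `[0, T] -> enorm (noise y s - noise y s) <= 0 by rewrite subrr enorm0.
have := ito_bound T0 hL hb (path_cont_cpath (ito_path (noise y))) (path_cont_cpath y)
  (@ito_pathE (noise y)) (@noise_ito y) h0 ht.
by rewrite mul0r.
Qed.

(** Identifies the given process [X] as the noise of [Y], so that [gamma] is the image of [mu] under
    the noise map. *)
Lemma noise_unique (y : C) (x : C0) :
  (forall t, t \in `[0, T] -> y t = ito_step xi b x y t) -> noise y = x.
Proof.
move=> h; apply: cpath_eqP => t ht; rewrite noiseE // {1}h // /ito_step.
by apply/rowP => i; rewrite !mxE; ring.
Qed.

End ito_paths.

(** * The norm of the embedding *)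

Section embedding.
Context {R : realType} {d : nat} {T q : R}.
Hypotheses (T0 : 0 < T) (q1 : 1 <= q).
Local Notation C0 := (cpath T (0 : 'rV[R]_d)).
Variable gamma : probability C0 R.

Lemma cm_norm_ge0 h : (0 <= cm_norm gamma h)%E.
Proof.
apply: ereal_sup_ubound; exists (fun=> 0) => //; split.
  split; first exact: cst_continuous.
  by move=> a x y z _; rewrite mulr0 addr0.
by rewrite (variance_cst gamma 0) lee_fin.
Qed.

Lemma dual_scale (l : C0 -> R) (a : R) (x y : C0) : dual l ->
  (forall t, t \in `[0, T] -> y t = a *: x t) -> l y = a * l x.
Proof.
move=> dl h; rewrite (@dual_sum _ _ _ l _ [:: tt] (fun=> a) (fun=> x) y dl) ?big_seq1 // => t ht.
by rewrite big_seq1 h.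
Qed.

Lemma cpath_scale (a : R) (x : C0) : exists y : C0, forall t, t \in `[0, T] -> y t = a *: x t.
Proof.
apply: cpath_exists; last by rewrite cpath_start scaler0.
have := @path_cont_lincomb R d T _ [:: tt] (fun=> a) (fun=> x).
by under eq_fun do rewrite big_seq1.
Qed.

(** The zero path makes the supremum nonnegative and the continuity constant bounds it, so a real
    number can replace the extended norm. *)
Lemma cm_embedding_fin : cm_embeds q gamma ->
  exists2 I, 0 <= I & cm_embedding_norm q gamma = I%:E.
Proof.
move=> [sub [C hC]]; pose h0 : C0 := Cpath (@cst_cpath_continuous R d T 0) erefl (fun _ _ => erefl).
have n0 : (cm_norm gamma h0 <= 1)%E.
  apply: ge_ereal_sup => _ [l [dl _] <-]; rewrite lee_fin.
  by rewrite (@dual_scale l 0 h0 h0) ?mul0r // => t _; rewrite scaler0.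
have ge : (0 <= cm_embedding_norm q gamma)%E.
  have hq : (0 <= qvar T q h0)%E by exact: qvar_ge0.
  by apply: (le_trans hq); apply: ereal_sup_ubound; exists h0.
have le : (cm_embedding_norm q gamma <= `|C|%:E)%E.
  apply: ge_ereal_sup => _ [h hh <-].
  apply: (le_trans (hC h _)); first by apply: le_lt_trans hh _; exact: ltry.
  apply: (@le_trans _ _ (`|C|%:E * cm_norm gamma h)%E).
    by apply: lee_wpmul2r; [exact: cm_norm_ge0|rewrite lee_fin ler_norm].
  by rewrite -[leRHS]mule1 lee_wpmul2l // lee_fin.
exists (fine (cm_embedding_norm q gamma)); first exact: fine_ge0.
by rewrite fineK // ge0_fin_numE // (le_lt_trans le) // ltry.
Qed.

Lemma qvar_scale (x y : R -> 'rV[R]_d) (a V : R) : 0 <= a -> 0 <= V ->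
  (forall t, t \in `[0, T] -> y t = a *: x t) -> (qvar T q x <= V%:E)%E ->
  (qvar T q y <= (a * V)%:E)%E.
Proof.
move=> a0 V0 h /(qvar_leP q1 _ V0) hx; apply/(qvar_leP q1 _ (mulr_ge0 a0 V0)) => s hs.
rewrite powRM //.
suff -> : @qsum R d T q y s = a `^ q * @qsum R d T q x s by rewrite ler_wpM2l ?powR_ge0 ?hx.
rewrite /qsum mulr_sumr big_nat [RHS]big_nat; apply: eq_bigr => i /andP[_ ilt].
rewrite !h; last 2 first.
- exact: (partition_point hs (ltnW ilt)).
- exact: (@partition_point _ _ s i.+1 hs ilt).
by rewrite -scalerBr enormZ ger0_norm // powRM // enorm_ge0.
Qed.

(** Homogeneity, at the slightly larger level [U' = U + e / (I + 1)]: it is positive even when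
    [U = 0], and after multiplication by [I] it exceeds the target by at most [e]. *)
Lemma qvar_le_embedding (I U : R) (h : C0) : cm_embedding_norm q gamma = I%:E ->
  0 <= I -> 0 <= U -> (cm_norm gamma h <= U%:E)%E -> (qvar T q h <= (U * I)%:E)%E.
Proof.
move=> hI I0 U0 hU; apply/lee_addgt0Pr => e e0.
have e1 : 0 < e / (I + 1) by rewrite divr_gt0 // ltr_wpDl.
pose U' := U + e / (I + 1); have U'0 : 0 < U' by rewrite ltr_wpDl.
have [h' hE] := cpath_scale U'^-1 h.
have n1 : (cm_norm gamma h' <= 1)%E.
  apply: ge_ereal_sup => _ [l [dl vl] <-]; rewrite (dual_scale dl hE) lee_fin ler_pdivrMl // mulr1.
  have : (cm_norm gamma h <= U'%:E)%E by rewrite (le_trans hU) // lee_fin lerDl ltW.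
  rewrite -lee_fin; apply: le_trans; apply: ereal_sup_ubound; by exists l.
have q' : (qvar T q h' <= I%:E)%E by rewrite -hI; apply: ereal_sup_ubound; exists h'.
have hE' t : t \in `[0, T] -> h t = U' *: h' t.
  by move=> /hE ->; rewrite scalerA divff ?scale1r // gt_eqF.
apply: (le_trans (qvar_scale (ltW U'0) I0 hE' q')).
rewrite -EFinD lee_fin /U' mulrDl lerD2l -mulrA mulrC ler_piMl ?(ltW e0) //.
by rewrite ler_pdivrMl ?mulr1 ?lerDl // ltr_wpDl.
Qed.

End embedding.

Section stability.
Context {R : realType} {d : nat} {T q : R} (xi : 'rV[R]_d).
Variables (b : 'rV[R]_d -> 'rV[R]_d) (L : R).
Hypotheses (T0 : 0 < T) (hL : 0 < L) (q1 : 1 <= q).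
Hypothesis hb : forall x y : 'rV[R]_d, enorm (b x - b y) <= L * enorm (x - y).
Local Notation C0 := (cpath T (0 : 'rV[R]_d)).

(** The solutions differ by [- h] plus a drift term dominated by [G]. As [h] starts at 0, its
    q-variation bounds its supremum, so [A = V] is admissible in Gronwall's lemma and
    [V + (G T - G 0)] is at most [V exp(L T)]. *)
Lemma dqvar_ito_path (x x' h : C0) (V : R) : 0 <= V ->
  (forall t, t \in `[0, T] -> x' t = x t + h t) -> (qvar T q h <= V%:E)%E ->
  (dqvar T q (ito_path xi b x) (ito_path xi b x') <= (2 `^ (1 - q^-1) * (V * expR (L * T)))%:E)%E.
Proof.
move=> V0 xE hV.
have hN t : t \in `[0, T] -> x t - x' t = - h t by move=> /xE ->; rewrite opprD addNKr.
have TT : T \in `[0, T] by rewrite in_itv /= lexx ltW.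
have A t : t \in `[0, T] -> enorm (x t - x' t) <= V.
  move=> ht; rewrite hN // enormN; have := enorm_le_qvar T0 q1 V0 hV ht.
  by rewrite cpath_start subr0.
have [G [inc GT]] := ito_gronwall T0 hL hb (path_cont_cpath (ito_path xi b x))
  (path_cont_cpath (ito_path xi b x')) (@ito_pathE _ _ _ xi _ _ T0 hL hb x) (@ito_pathE _ _ _ xi _ _ T0 hL hb x') A.
pose z t := ito_path xi b x t - ito_path xi b x' t.
have K := @qvar_perturb R d T q T0 q1 z (fun t => - h t) G V (V * expR (L * T)) V0.
apply: K.
- apply/(qvar_leP q1 _ V0) => s hs; apply: le_trans ((qvar_leP q1 h V0).1 hV s hs).
  rewrite le_eqVlt; apply/orP; left; apply/eqP; apply: eq_bigr => i _.
  by rewrite -opprD enormN.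
- move=> r t r0 rt tT; have := inc r t r0 rt tT.
  rewrite !hN //; rewrite in_itv /=; first by rewrite r0 (le_trans rt).
  by rewrite tT (le_trans r0).
- by rewrite addrC GT.
Qed.

End stability.

Section integral_law.
Import HBNNSimple.
Context d d' {E : measurableType d} {E' : measurableType d'} {R : realType}.

(* [f] need not be measurable: its integral is a supremum over the simple
   functions below it. *)
Lemma integral_law_le (P : probability E R) (phi : E -> E') (mphi : measurable_fun setT phi)
    (f : E' -> \bar R) (g : E -> \bar R) :
  measurable_fun setT g -> (forall y, 0 <= f y)%E -> (forall x, f (phi x) <= g x)%E ->
  (\int[law P mphi]_y f y <= \int[P]_x g x)%E.
Proof.
move=> mg f0 fg; rewrite ge0_integralTE //; apply: ge_ereal_sup => _ [h /= hf <-].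
have mh : measurable_fun setT (fun y => (h y)%:E) by apply/measurable_EFinP.
rewrite -integralT_nnsfun ge0_integral_law // => [|y]; last by rewrite lee_fin.
apply: ge0_le_integral => //.
- by move=> x _; rewrite lee_fin.
- exact: measurableT_comp mh mphi.
- by move=> x _; apply: le_trans (fg x); apply: hf.
Qed.

Lemma prob_ae_le (P : probability E R) (A B : set E) : measurable A -> measurable B ->
  {ae P, forall x, A x -> B x} -> (P A <= P B)%E.
Proof.
move=> mA mB [N [mN N0 sub]].
apply: (@le_trans _ _ (P (B `|` N))).
  apply: le_measure; rewrite ?inE //; first exact: measurableU.
  move=> x Ax; have [Bx|nB] := pselect (B x); [by left|right; apply: sub => /=].
  by move=> h; apply: nB; exact: h.
by rewrite measureU0.
Qed.

Lemma prob_ae_eq (P : probability E R) (A B : set E) : measurable A -> measurable B ->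
  {ae P, forall x, A x <-> B x} -> P A = P B.
Proof.
move=> mA mB h; apply/eqP; rewrite eq_le; apply/andP; split; apply: prob_ae_le => //.
- by apply: filterS h => x [].
- by apply: filterS h => x [].
Qed.

End integral_law.

Section coupling.
Context {R : realType} {d : nat} {T q : R} (xi : 'rV[R]_d).
Variables (b : 'rV[R]_d -> 'rV[R]_d) (L : R).
Hypotheses (T0 : 0 < T) (hL : 0 < L) (q1 : 1 <= q).
Hypothesis hb : forall x y : 'rV[R]_d, enorm (b x - b y) <= L * enorm (x - y).
Local Notation C0 := (cpath T (0 : 'rV[R]_d)).
Local Notation C := (cpath T xi).
Local Notation RR := (measurableTypeR R).
Variables (gamma : probability C0 R) (mu nu : probability C R).
Hypothesis fdG : forall l, fd l -> exists m s, gaussian_rv gamma l m s.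
Local Notation Psi := (@noise R d T xi b).
Local Notation Phi := (ito_path xi b).
Hypothesis gammaE : forall A, measurable A -> gamma A = mu (Psi @^-1` A).
Hypothesis numu : nu `<< mu.
Variable I : R.
Hypotheses (I0 : 0 <= I) (hI : cm_embedding_norm q gamma = I%:E).

Variable G : nat -> C -> RR.
Hypotheses (mG : forall k, measurable_fun setT (G k)) (stdG : std_family (wsg gamma) nu G).

Let mPsi : measurable_fun setT Psi := measurable_noise T0 hL hb.

Definition drift k y : R := G k y - wxi gamma k (Psi y).

Let m_drift k : measurable_fun setT (drift k).
Proof.
apply: measurable_funB; first exact: mG.
exact: measurableT_comp (measurable_wxi fdG k) mPsi.
Qed.

Definition drift_energy y : \bar R := (\sum_(k <oo) (drift k y ^+ 2)%:E)%E.
Local Notation S := drift_energy.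

Let S0 y : (0 <= S y)%E.
Proof. by apply: nneseries_ge0 => k _ _; rewrite lee_fin sqr_ge0. Qed.

Let mS : measurable_fun setT S.
Proof.
apply: ge0_emeasurable_sum => [k x _ _|k _]; first by rewrite lee_fin sqr_ge0.
by apply/measurable_EFinP; exact: measurable_funX.
Qed.

(* the cut-off makes the shift below defined, and measurable, everywhere *)
Definition cut_drift k y : R := if (S y < +oo)%E then drift k y else 0.

Let m_cut k : measurable_fun setT (cut_drift k).
Proof.
apply: measurable_fun_ifT => //; apply: measurable_fun_lte => //.
Qed.

Let U y := Num.sqrt (fine (S y)).

Let hU y n : \sum_(i < n) cut_drift i y ^+ 2 <= U y ^+ 2.
Proof.
rewrite sqr_sqrtr ?fine_ge0 //; rewrite /cut_drift.
have [h|h] := boolP (S y < +oo)%E; last first.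
  by rewrite big1 ?fine_ge0 // => i _; rewrite expr0n.
rewrite -lee_fin fineK ?ge0_fin_numE // -sumEFin.
rewrite -(big_mkord xpredT (fun i => (drift i y ^+ 2)%:E)).
by apply: nneseries_lim_ge => k _ _; rewrite lee_fin sqr_ge0.
Qed.

Definition shift y : C0 := cm_path gamma (cut_drift^~ y).

Definition moved y : C0 := to_cpath 0 (fun t => Psi y t + shift y t).

Let movedE y t : t \in `[0, T] -> moved y t = Psi y t + shift y t.
Proof.
move: t; apply: to_cpathE; last by rewrite !cpath_start addr0.
by apply: path_contD; exact: path_cont_cpath.
Qed.

Let ev_moved k y : ev k (moved y) = ev k (Psi y) + \sum_(i < k.+1) wcoef gamma k i * cut_drift i y.
Proof.
have <- : ev k (shift y) = \sum_(i < k.+1) wcoef gamma k i * cut_drift i y.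
  exact: (ev_cm_path fdG (sqrtr_ge0 _) (hU y)).
rewrite /ev; case: (unpickle k) => [[p i]|]; last by rewrite addr0.
by have [h|h] := boolP (rtime p \in `[0, T]); rewrite ?addr0 // movedE // mxE.
Qed.

Let m_ev_moved k : measurable_fun setT (fun y => ev k (moved y) : RR).
Proof.
rewrite (_ : (fun y => _) = fun y => ev k (Psi y) + \sum_(i < k.+1) wcoef gamma k i * cut_drift i y); last first.
  by apply/funext => y; exact: ev_moved.
apply: measurable_funD; first exact: measurableT_comp (measurable_ev k) mPsi.
by apply: measurable_sum => i; apply: measurable_funM.
Qed.

Lemma measurable_moved : measurable_fun setT moved.
Proof.
apply: (cpath_measurable_fun T0) => p i hp.
rewrite (_ : (fun y => _) = fun y => ev (pickle (p, i)) (moved y)); first exact: m_ev_moved.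
by apply/funext => y; rewrite evE.
Qed.

Section energy.
Hypothesis Soo : (\int[nu]_y S y < +oo)%E.

Let ae_finite : {ae nu, forall y, (S y < +oo)%E}.
Proof.
have i : nu.-integrable setT S.
  apply/integrableP; split => //.
  by under eq_integral do rewrite gee0_abs //.
apply: filterS (integrable_ae measurableT i) => y /(_ Logic.I) h.
by rewrite -ge0_fin_numE.
Qed.

Let mean k := \int[gamma]_x ev k x.

Let ae_decomp : {ae gamma, forall x, forall k,
  ev k x = mean k + \sum_(i < k.+1) wcoef gamma k i * wxi gamma i x}.
Proof. by apply/ae_foralln => k; exact: ev_wxi. Qed.

(** A [gamma]-null set pulls back along [Psi] to a [mu]-null set, hence to a [nu]-null one. Off it,
    and where the energy is finite, the cut-off is inactive and [wxi i (Psi y) + drift i y] is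
    [G i y]. *)
Let ae_moved : {ae nu, forall y, forall k,
  ev k (moved y) = mean k + \sum_(i < k.+1) wcoef gamma k i * G i y}.
Proof.
have [N [mN N0 sub]] := ae_decomp.
have h : {ae nu, forall y, ~ N (Psi y)}.
  exists (Psi @^-1` N); split; first by rewrite -[X in measurable X]setTI; exact: mPsi.
    move/null_content_dominatesP : numu; apply; first by rewrite -[X in measurable X]setTI; exact: mPsi.
    exact: (etrans (esym (gammaE mN)) N0).
  by move=> y /=; apply: contra_notP.
apply: filterS2 h ae_finite => y hN hS k.
have hk : ev k (Psi y) = mean k + \sum_(i < k.+1) wcoef gamma k i * wxi gamma i (Psi y).
  apply: contrapT => hn; apply: hN; apply: sub => /= h; exact: hn.
rewrite ev_moved hk -addrA -big_split; congr (_ + _); apply: eq_bigr => i _ /=.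
by rewrite /cut_drift hS /drift -mulrDr addrC subrK.
Qed.

(** Up to null sets, the evaluations under [gamma] and those of [moved] under [nu] are the same
    affine expressions in two standard families, [wxi] and [G]. *)
Lemma law_moved A : measurable A -> gamma A = nu (moved @^-1` A).
Proof.
move: A; apply: (cpath_prob_eq T0 (m1 := gamma) (m2 := law nu measurable_moved)) => n B mB.
rewrite -[RHS]/(nu (moved @^-1` cyl ev n B)).
have m1 : measurable (cyl (fun k (x : C0) => mean k + \sum_(i < k.+1) wcoef gamma k i * wxi gamma i x) n B).
  apply: measurable_cyl => // k _; apply: measurable_funD => //; apply: measurable_sum => i.
  by apply: measurable_funM => //; exact: measurable_wxi.
have m2 : measurable (cyl (fun k (y : C) => mean k + \sum_(i < k.+1) wcoef gamma k i * G i y) n B).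
  apply: measurable_cyl => // k _; apply: measurable_funD => //; apply: measurable_sum => i.
  by apply: measurable_funM => //; exact: mG.
transitivity (gamma (cyl (fun k (x : C0) => mean k + \sum_(i < k.+1) wcoef gamma k i * wxi gamma i x) n B)).
  apply: prob_ae_eq => //; first by apply: measurable_cyl => // k _; exact: measurable_ev.
  apply: filterS ae_decomp => x hx; split => h k kn; [rewrite -hx|rewrite hx]; exact: h.
rewrite (std_family_affine (measurable_wxi fdG) mG (std_family_wxi fdG) stdG) //.
apply: prob_ae_eq => //.
  rewrite (_ : _ @^-1` _ = cyl (fun k y => ev k (moved y)) n B) //.
  by apply: measurable_cyl => // k _; exact: m_ev_moved.
by apply: filterS ae_moved => y hy; split => h k kn; [rewrite hy|rewrite -hy]; exact: h.
Qed.

Let pairing_map y : C * C := (y, Phi (moved y)).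

Let m_pairing : measurable_fun setT pairing_map.
Proof.
apply/measurable_fun_pairP; split; first exact: measurable_id.
exact: measurableT_comp (measurable_ito_path T0 hL hb) measurable_moved.
Qed.

(** The second marginal is the image of [gamma] under the solution map, which is [mu] because that
    map inverts the noise map and [gamma] is the image of [mu] under the latter. *)
Lemma coupling_law : coupling nu mu (law nu m_pairing).
Proof.
split => A mA //; have mPhi := measurable_ito_path (xi := xi) T0 hL hb.
have mA' : measurable (Phi @^-1` A) by rewrite -[X in measurable X]setTI; exact: mPhi.
have -> : mu A = gamma (Phi @^-1` A).
  rewrite gammaE //; congr (mu _); apply/seteqP.
  by split => y /=; rewrite (noiseK T0 hL hb).
by rewrite law_moved.
Qed.

Let K := 2 `^ (1 - q^-1) * (I * expR (L * T)).

Lemma dqvar_moved (y : C) : (dqvar T q y (Phi (moved y)) <= (U y * K)%:E)%E.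
Proof.
have V0 : 0 <= U y * I by rewrite mulr_ge0 // sqrtr_ge0.
have hV : (qvar T q (shift y) <= (U y * I)%:E)%E.
  apply: (qvar_le_embedding q1 hI) => //; first exact: sqrtr_ge0.
  exact: (cm_norm_cm_path T0 fdG (sqrtr_ge0 _) (hU y)).
have := dqvar_ito_path xi T0 hL q1 hb V0 (movedE y) hV.
rewrite (noiseK T0 hL hb) => h; apply: (le_trans h); rewrite lee_fin le_eqVlt; apply/orP; left; apply/eqP.
by rewrite /K; ring.
Qed.

Lemma transport_cost_le_energy : (transport_cost q nu mu <= (K ^+ 2)%:E * \int[nu]_y S y)%E.
Proof.
apply: (@le_trans _ _ (\int[law nu m_pairing]_z (dqvar T q z.1 z.2 ^+ 2))%E).
  by apply: ereal_inf_lbound; exists (law nu m_pairing) => //; exact: coupling_law.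
rewrite -ge0_integralZl // ?lee_fin ?sqr_ge0 //.
(* The cost is not shown to be measurable on pairs of paths; only its majorant, a function of [y],
   has to be. *)
apply: integral_law_le => [|z|y].
- by apply: emeasurable_funM.
- by apply: expe_ge0; exact: qvar_ge0.
- apply: (@le_trans _ _ ((U y * K)%:E ^+ 2)%E).
    rewrite lee_sqr; [exact: dqvar_moved|exact: qvar_ge0|].
    by rewrite lee_fin mulr_ge0 ?sqrtr_ge0 // /K mulr_ge0 ?powR_ge0 // mulr_ge0 // expR_ge0.
  rewrite -EFin_expe exprMn mulrC EFinM; apply: lee_wpmul2l; first by rewrite lee_fin sqr_ge0.
  rewrite sqr_sqrtr ?fine_ge0 //; have [h|h] := boolP (S y < +oo)%E.
    by rewrite fineK // ge0_fin_numE.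
  by move: h; rewrite -leNgt leye_eq => /eqP ->; rewrite leey.
Qed.

End energy.
End coupling.

Theorem theorem2p2 (R : realType) (d : nat) (T : R) (hT : 0 < T)
    (xi : 'rV[R]_d)
    (b : 'rV[R]_d -> 'rV[R]_d) (L : R) (hL : 0 < L)
    (hb : forall x y : 'rV[R]_d, enorm (b x - b y) <= L * enorm (x - y))
    (disp : measure_display) (Omega : measurableType disp)
    (P : probability Omega R)
    (X : Omega -> cpath T (0 : 'rV[R]_d))
    (hX : gaussian_process P T X)
    (gamma : probability (cpath T (0 : 'rV[R]_d)) R)
    (hgamma : is_law P X gamma)
    (q : R) (hq : 1 <= q)
    (hiota : cm_embeds q gamma)
    (Y : Omega -> cpath T xi)
    (hY : forall (w : Omega) (t : R), t \in `[0, T] -> forall i : 'I_d,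
       Y w t 0 i = xi 0 i
         + \int[lebesgue_measure]_(s in `[0, t]) (b (Y w s)) 0 i
         + X w t 0 i)
    (mu : probability (cpath T xi) R)
    (hmu : is_law P Y mu)
    (nu : probability (cpath T xi) R) :
  (transport_cost q nu mu <=
   mul_entropy
     ((2 `^ (3 - 2 / q) * expR (2 `^ (2 - q^-1) * L * T))%:E
        * cm_embedding_norm q gamma ^+ 2)
     (relative_entropy nu mu))%E.

Proof.
rewrite /mul_entropy; case: ifPn => [_|Hoo]; first exact: leey.
have numu : nu `<< mu by move: Hoo; rewrite /relative_entropy; case: pselect.
have fdG l : fd l -> exists m s, gaussian_rv gamma l m s by exact: (fd_gaussian hX hgamma).
have mN := measurable_noise (xi := xi) hT hL hb.
have gammaE A : measurable A -> gamma A = mu (@noise R d T xi b @^-1` A).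
  move=> mA; rewrite hgamma // hmu; last by rewrite -[X in measurable X]setTI; exact: mN.
  have NY w : noise b (Y w) = X w.
    apply: (noise_unique hT hb) => t ht.
    by apply/rowP => i; rewrite /ito_step !mxE hY.
  by congr (P _); apply/seteqP; split => w /=; rewrite NY.
have [I I0 hI] := cm_embedding_fin hT hiota.
pose x k y := wxi gamma k (@noise R d T xi b y).
have mx k : measurable_fun setT (x k : cpath T xi -> measurableTypeR R).
  exact: measurableT_comp (measurable_wxi fdG k) mN.
have x0 k : ~~ wsg gamma k -> x k = cst 0.
  by move=> hk; apply/funext => y; rewrite /x (wxi_deg hk).
have stdx : std_family (wsg gamma) mu x.
  move=> n B mB; rewrite -(std_family_wxi fdG n mB) gammaE //.
  by apply: measurable_cyl => // k _; exact: (measurable_wxi fdG).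
have [G [mG stdG sumG]] := rosenblatt numu mx x0 stdx.
set H := relative_entropy nu mu in Hoo sumG *.
have H0 : (0 <= H)%E.
  (* For the empty sum the bound reads [0 <= 2 H]. *)
  have := sumG 0%N; rewrite big_ord0 => h; rewrite leNgt; apply/negP => Hn.
  by move: h; rewrite leNgt; rewrite mule_gt0_lt0.
have energy : (\int[nu]_y drift_energy b gamma G y <= 2%:E * H)%E.
  rewrite integral_nneseries // => [|k|k y _].
  - apply: lime_le.
      by apply: is_cvg_nneseries => k _ _; apply: integral_ge0 => y _; rewrite lee_fin sqr_ge0.
    by apply: nearW => n; rewrite big_mkord; exact: sumG.
  - apply/measurable_EFinP/measurable_funX/measurable_funB; first exact: mG.
    exact: mx.
  - by rewrite lee_fin sqr_ge0.
have Hfin : H \is a fin_num by rewrite ge0_fin_numE // lt_neqAle Hoo leey.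
have Soo : (\int[nu]_y drift_energy b gamma G y < +oo)%E.
  by apply: le_lt_trans energy _; rewrite -(fineK Hfin) -EFinM ltry.
apply: (le_trans (transport_cost_le_energy hT hL hq hb fdG gammaE numu I0 hI mG stdG Soo)).
apply: (@le_trans _ _ (((2 `^ (1 - q^-1) * (I * expR (L * T))) ^+ 2)%:E * (2%:E * H))%E).
  by apply: lee_wpmul2l => //; rewrite lee_fin sqr_ge0.
rewrite hI muleA; apply: lee_wpmul2r => //.
rewrite -EFinM -EFin_expe -EFinM lee_fin.
have q0 : 0 < q by exact: lt_le_trans hq.
have qi : q^-1 <= 1 by rewrite invf_le1.
(* The squared splitting constant times Talagrand's 2: the exponents add up to
   [2 (1 - 1/q) + 1 = 3 - 2/q]. *)
have e1 : (2 `^ (1 - q^-1)) ^+ 2 * 2 = 2 `^ (3 - 2 / q) :> R.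
  rewrite -powR_mulrn ?powR_ge0 // -powRrM -[X in _ * X](powRr1 (ler0n R 2)) -powRD; last first.
    by apply/implyP => _; rewrite pnatr_eq0.
  by congr (_ `^ _); field; rewrite gt_eqF.
(* Here [2 <= 2^(2 - 1/q)], because [q >= 1]. *)
have e2 : expR (L * T) ^+ 2 <= expR (2 `^ (2 - q^-1) * L * T).
  rewrite -expRM_natl ler_expR -mulrA ler_wpM2r ?mulr_ge0 ?(ltW hL) ?(ltW hT) //.
  rewrite -[leLHS](powRr1 (ler0n R 2)) ler_powR ?ler1n //.
  by rewrite lerBrDr -lerBrDl (le_trans qi) // lerBrDr.
rewrite !exprMn -e1.
set a := 2 `^ _ ^+ 2; set c := expR _ ^+ 2 in e2 *; set D := expR _ in e2 *.
have a0 : 0 <= a by rewrite sqr_ge0.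
have := ler_wpM2l (mulr_ge0 a0 (sqr_ge0 I)) e2.
lra.
Qed.
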